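(* Let $s>0$, let $k^+,k^->0$ and $\kappa<0$ be real, with $(k^+)^2\neq\lambda_n$ and $(k^-)^2\neq\lambda_n$ for all $n\in\mathbb N$. Consider the transmission problem $$(P)\quad\begin{cases}\Delta u^++(k^+)^2u^+=0 & \text{in }(-\infty,0)\times\Gamma,\\ \Delta u^-+(k^-)^2u^-=0 & \text{in }(0,+\infty)\times\Gamma,\\ u^--u^+=f & \text{on }\{0\}\times\Gamma,\\ \partial_{\mathbf n}u^--\kappa\,\partial_{\mathbf n}u^+=g & \text{on }\{0\}\times\Gamma,\end{cases}$$ together with the boundary conditions on $\mathbb R\times\partial\Gamma$ and the radiation conditions at $x\to\pm\infty$ described in the context. 1. If $\kappa\neq-1$ (standard case): for $(f,g)\in\mathfrak H^s(\Gamma)\times\mathfrak H^{s-1}(\Gamma)$, $(P)$ has a unique solution, with $(u^-|_\Gamma,u^+|_\Gamma)\in\mathfrak H^s(\Gamma)^2$ (no order of regularity lost), except in the exceptional situation where there is $n$ with $\lambda_n>\max((k^-)^2,(k^+)^2)$ and $$\sqrt{\lambda_n-(k^-)^2}+\kappa\sqrt{\lambda_n-(k^+)^2}=0,\qquad\text{equivalently, only if}\quad \lambda_n=\frac{\kappa^2(k^+)^2-(k^-)^2}{\kappa^2-1};$$ in that situation $(P)$ has a kernel of finite dimension, equal to the multiplicity of the corresponding $\lambda_n$, spanned by the corresponding evanescent functions $G_n$. 2. If $\kappa=-1$ and $k^+\neq k^-$ (critical case): for $(f,g)\in\mathfrak H^{s+2}(\Gamma)\times\mathfrak H^{s+1}(\Gamma)$,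 $(P)$ has a unique solution, with $(u^-|_\Gamma,u^+|_\Gamma)\in\mathfrak H^s(\Gamma)^2$ (2 orders of regularity lost). 3. If $\kappa=-1$ and $k^+=k^-$ (super-critical case): $(P)$ has a kernel of infinite dimension, spanned by the evanescent functions $G_n$ for all $n$ such that $\lambda_n>\max((k^-)^2,(k^+)^2)$. Here $$G_n(x,\mathbf y)=\psi_n(\mathbf y)\,e^{-i\beta_n^-|x|}=\psi_n(\mathbf y)\,e^{-i\kappa\beta_n^+|x|},\qquad x\in\mathbb R,\ \mathbf y\in\Gamma.$$
   Context: $d\ge2$ and $\Gamma\subset\mathbb R^{d-1}$ is a non-empty bounded connected open set with Lipschitz boundary; points of the waveguide $\mathbb R\times\Gamma$ are written $(x,\mathbf y)$. $\{0\}\times\Gamma$ is identified with $\Gamma$, and $u^\pm|_\Gamma$ are the traces on it. $\mathbf n$ is the unit normal to $\{0\}\times\Gamma$ pointing out of $(0,+\infty)\times\Gamma$. Boundary conditions, independent of $x$, are fixed on $\partial\Gamma$ (e.g. homogeneous Dirichlet or Neumann) such that $\Delta_{\mathbf y}$ on $L^2(\Gamma)$ with these conditions is self-adjoint with compact resolvent; $(\lambda_n,\psi_n)_{n\in\mathbb N}$ are the eigenvalues (nonnegative, of finite multiplicity, counted with multiplicity, tending to $+\infty$) and eigenfunctions of $-\Delta_{\mathbf y}$ with these conditions, $(\psi_n)$ being a Hilbert basis of $L^2(\Gamma)$. $\beta_n^+=\sqrt{(k^+)^2-\lambda_n}$ if $\lambda_n<(k^+)^2$ and $\beta_n^+=i\sqrt{\lambda_n-(k^+)^2}$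 if $\lambda_n>(k^+)^2$; $\beta_n^-=\sqrt{(k^-)^2-\lambda_n}$ if $\lambda_n<(k^-)^2$ and $\beta_n^-=-i\sqrt{\lambda_n-(k^-)^2}$ if $\lambda_n>(k^-)^2$. Radiation conditions: $u^+$ satisfies the Sommerfeld (outgoing) condition as $x\to-\infty$, $u^-$ satisfies the reversed Sommerfeld condition as $x\to+\infty$ (the sign of $ik^-$ being changed, as appropriate to a negative material), and exponentially growing modes are discarded; that is, $u^+(x,\mathbf y)=\sum_nu_n^+e^{-i\beta_n^+x}\psi_n(\mathbf y)$ for $x<0$ and $u^-(x,\mathbf y)=\sum_nu_n^-e^{-i\beta_n^-x}\psi_n(\mathbf y)$ for $x>0$. For $t\ge0$, $\mathfrak H^t(\Gamma)=\{u\in L^2(\Gamma):\sum_n(1+\lambda_n)^t|u_n|^2<\infty\}$ with $u_n=\langle u,\psi_n\rangle_{L^2(\Gamma)}$; for negative exponents, $\mathfrak H^{-t}(\Gamma)=\{\phi\in\mathcal C^\infty(\Gamma)^*:\sum_n(1+\lambda_n)^{-t}|\phi_n|^2<\infty\}$ with $\phi_n=\phi(\overline{\psi_n})$. The kernel of $(P)$ is the space of solutions for $(f,g)=(0,0)$.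
   Formalization: In the exceptional standard case (κ≠-1) the printed even formula for G_n does not solve (P) for x<0; there G_n is taken to be ψ_n e^{-iβ_n^+ x}, with ψ_n e^{-iβ_n^- x} for x>0; the printed formula is kept for x>0, and on both sides when κ=-1 and k^+=k^-. *)

(* Defs.v *)
From HB Require Import structures.
From mathcomp Require Import all_boot all_order all_algebra.
From mathcomp Require Import complex.
From mathcomp Require Import all_classical all_reals all_analysis.

Set Implicit Arguments.
Unset Strict Implicit.
Unset Printing Implicit Defensive.

Import Order.TTheory GRing.Theory Num.Theory.
Import numFieldNormedType.Exports.
Local Open Scope classical_set_scope.
Local Open Scope ring_scope.


Section measurable_rV.
Context {R : realType} {n : nat}.

Definition rv_coord (i : 'I_n) (v : 'rV[R]_n) : measurableTypeR R := v ord0 i.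

Let rV_set0 : g_sigma_preimage rv_coord set0.
Proof. exact: sigma_algebra0. Qed.

Let rV_setC A : g_sigma_preimage rv_coord A -> g_sigma_preimage rv_coord (~` A).
Proof. exact: sigma_algebraC. Qed.

Let rV_bigcup (F : _^nat) : (forall i, g_sigma_preimage rv_coord (F i)) ->
  g_sigma_preimage rv_coord (\bigcup_i (F i)).
Proof. exact: sigma_algebra_bigcup. Qed.

HB.instance Definition _ := @isMeasurable.Build
  (measure_tuple_display default_measure_display)
  'rV[R]_n (g_sigma_preimage rv_coord) rV_set0 rV_setC rV_bigcup.
End measurable_rV.

Section lebesgue_rV.
Context {R : realType}.

Definition rv_cons n (p : measurableTypeR R * 'rV[R]_n) : 'rV[R]_n.+1 :=
  \row_i oapp (fun j => p.2 ord0 j) p.1 (unlift ord0 i).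

Lemma measurable_rv_coord n (i : 'I_n) :
  measurable_fun [set: 'rV[R]_n] (@rv_coord R n i).
Proof.
move=> _ Y mY; rewrite setTI; apply: sub_sigma_algebra => /=.
rewrite -bigcup_seq/=; exists i => /=; first by rewrite mem_index_enum.
by exists Y => //; rewrite setTI.
Qed.

Lemma measurable_fun_rvP d (T : measurableType d) n (f : T -> 'rV[R]_n) :
  (forall i, measurable_fun [set: T] (@rv_coord R n i \o f)) ->
  measurable_fun [set: T] f.
Proof.
move=> mf.
suff : g_sigma_preimage (fun i => @rv_coord R n i \o f) `<=` measurable.
  by rewrite g_sigma_preimage_comp => h _ A mA; apply: h; exists A.
apply: smallest_sub; first exact: sigma_algebra_measurable.
case: n => [|n] in f mf *; first by rewrite big_ord0.
rewrite -bigcup_mkord_ord; apply: bigcup_sub => i Ii.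
by move=> A [B mB <-]; exact: mf.
Qed.

Lemma measurable_rv_cons n : measurable_fun setT (@rv_cons n).
Proof.
apply: measurable_fun_rvP => i.
case: (unliftP ord0 i) => [j ->|->].
  rewrite (_ : _ \o _ = @rv_coord R n j \o snd).
    by apply: measurableT_comp => //; exact: measurable_rv_coord.
  by apply/funext => p /=; rewrite /rv_coord /rv_cons mxE liftK.
rewrite (_ : _ \o _ = fst); first exact: measurable_fst.
by apply/funext => p /=; rewrite /rv_coord /rv_cons mxE unlift_none.
Qed.

Section step.
Local Open Scope ereal_scope.
Context {n : nat}.
Variable m : {sigma_finite_measure set 'rV[R]_n -> \bar R}.

Definition lebesgue_rv_cons : set 'rV[R]_n.+1 -> \bar R :=
  pushforward (@lebesgue_measure R \x m) (@rv_cons n).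

Let mcons A : measurable A -> measurable (@rv_cons n @^-1` A).
Proof. by move=> mA; rewrite -[X in measurable X]setTI; exact: measurable_rv_cons. Qed.

Let step0 : lebesgue_rv_cons set0 = 0.
Proof. by rewrite /lebesgue_rv_cons /pushforward preimage_set0 measure0. Qed.

Let step_ge0 A : 0 <= lebesgue_rv_cons A.
Proof. exact: (measure_ge0 (@lebesgue_measure R \x m)). Qed.

Let step_sigma_additive : semi_sigma_additive lebesgue_rv_cons.
Proof.
move=> F mF tF mUF; rewrite /lebesgue_rv_cons /pushforward preimage_bigcup.
apply: measure_semi_sigma_additive => [k||]; first exact: mcons.
- apply/trivIsetP => i j _ _ ij; rewrite -preimage_setI.
  by move/trivIsetP : tF => /(_ _ _ _ _ ij) ->//; rewrite preimage_set0.
- by rewrite -preimage_bigcup; exact: mcons.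
Qed.

HB.instance Definition _ := isMeasure.Build _ _ _ lebesgue_rv_cons
  step0 step_ge0 step_sigma_additive.

Let rv_head (v : 'rV[R]_n.+1) : measurableTypeR R := rv_coord ord0 v.
Let rv_tail (v : 'rV[R]_n.+1) : 'rV[R]_n := \row_j v ord0 (lift ord0 j).

Let mtail : measurable_fun setT rv_tail.
Proof.
apply: measurable_fun_rvP => i.
rewrite (_ : _ \o _ = @rv_coord R n.+1 (lift ord0 i)).
  exact: measurable_rv_coord.
by apply/funext => v; rewrite /rv_coord /= mxE.
Qed.

Let step_sigma_finite : sigma_finite setT lebesgue_rv_cons.
Proof.
have /sigma_finiteP[F [TF ndF Foo]] := sigma_finiteT (@lebesgue_measure R).
have /sigma_finiteP[G [TG ndG Goo]] := sigma_finiteT m.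
exists (fun k => (rv_head @^-1` F k) `&` (rv_tail @^-1` G k)).
  apply/seteqP; split=> [v _|//].
  have [i _ Fi] : (\bigcup_i F i) (rv_head v) by rewrite -TF.
  have [j _ Gj] : (\bigcup_i G i) (rv_tail v) by rewrite -TG.
  exists (maxn i j) => //; split.
    have /subsetPset FF := ndF _ _ (leq_maxl i j); exact: (FF _ Fi).
  have /subsetPset GG := ndG _ _ (leq_maxr i j); exact: (GG _ Gj).
move=> k; have [mFk Fk] := Foo k; have [mGk Gk] := Goo k; split.
  apply: measurableI.
    by rewrite -[X in measurable X]setTI; exact: measurable_rv_coord.
  by rewrite -[X in measurable X]setTI; exact: mtail.
rewrite /lebesgue_rv_cons /pushforward (_ : _ @^-1` _ = F k `*` G k).
  by rewrite product_measure1E// lte_mul_pinfty// ge0_fin_numE.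
apply/seteqP; split=> -[x v] /=; rewrite /rv_head /rv_coord /rv_cons mxE unlift_none /=.
  move=> [Fx]; rewrite (_ : rv_tail _ = v)//.
  by apply/rowP => i; rewrite !mxE liftK.
move=> [Fx Gv]; split=> //; rewrite (_ : rv_tail _ = v)//.
by apply/rowP => i; rewrite !mxE liftK.
Qed.

HB.instance Definition _ := Measure_isSigmaFinite.Build _ _ _ lebesgue_rv_cons
  step_sigma_finite.
End step.

(* Lebesgue measure on the Borel sets of R^n; see lebesgue_rV_box. *)
Fixpoint lebesgue_rV n : {sigma_finite_measure set 'rV[R]_n -> \bar R} :=
  if n is n'.+1 return {sigma_finite_measure set 'rV[R]_n -> \bar R}
  then lebesgue_rv_cons (lebesgue_rV n') else dirac (0 : 'rV[R]_0).

Lemma lebesgue_rV_box n (A : 'I_n -> set R) : (forall i, measurable (A i)) ->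
  lebesgue_rV n [set v | forall i, A i (v ord0 i)] =
  (\prod_(i < n) lebesgue_measure (A i))%E.
Proof.
elim: n A => [|n IH] A mA.
  rewrite big_ord0 /= diracE (_ : _ \in _ = true)//.
  by apply/mem_set => -[].
rewrite big_ord_recl -(IH (fun i => A (lift ord0 i)))//.
set B := [set v : 'rV[R]_n | forall i, A (lift ord0 i) (v ord0 i)].
transitivity ((@lebesgue_measure R \x lebesgue_rV n)%E
    ((A ord0 : set (measurableTypeR R)) `*` B)).
  congr ((@lebesgue_measure R \x lebesgue_rV n)%E _).
  apply/seteqP; split=> -[x v] /=.
    move=> h; split.
      by have := h ord0; rewrite /rv_cons mxE unlift_none.
    by move=> i; have := h (lift ord0 i); rewrite /rv_cons mxE liftK.
  move=> [Ax Av] i; rewrite /rv_cons mxE.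
  by case: (unliftP ord0 i) => [j ->|->]; rewrite ?liftK ?unlift_none.
rewrite product_measure1E//; first exact: mA.
rewrite (_ : B = \bigcap_(i in [set: 'I_n])
    (@rv_coord R n i @^-1` (A (lift ord0 i)))); last first.
  by apply/seteqP; split=> v h i; [move=> _; exact: h | exact: (h i Logic.I)].
apply: fin_bigcap_measurable => // i _.
rewrite -[X in measurable X]setTI; apply: measurable_rv_coord => //.
exact: mA.
Qed.
End lebesgue_rV.

Section cross_section.
Context {R : realType} {m : nat}.
Local Notation C := R[i].
Local Notation V := 'rV[R]_m.
Local Notation mu := (@lebesgue_rV R m).
Implicit Types (Gam : set V) (u v w : V -> C).

Definition dotv (a b : V) : R := (a *m b^T) ord0 ord0.

(* A graph over the hyperplane orthogonal to e is written without choosing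
   coordinates of that hyperplane: h is only evaluated at the orthogonal
   projection of y. *)
Definition lipschitz_boundary Gam : Prop :=
  forall p, (closure Gam `\` Gam) p ->
  exists (e : V) (h : V -> R) (L r : R),
    [/\ dotv e e = 1, forall a b, `|h a - h b| <= L * `|a - b|, 0 < r &
      forall y, ball p r y -> (Gam y <-> dotv y e < h (y - dotv y e *: e))].

Definition partials (s : seq 'I_m) (g : V -> R) : V -> R :=
  foldr (fun i h y => 'D_(delta_mx ord0 i) h y) g s.

Definition smooth_on Gam (g : V -> R) : Prop :=
  forall s y, Gam y -> {for y, continuous (partials s g)} /\
    forall i, derivable (partials s g) y (delta_mx ord0 i).

Definition csmooth_on Gam u : Prop :=
  smooth_on Gam (fun y => complex.Re (u y)) /\
  smooth_on Gam (fun y => complex.Im (u y)).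

Definition test_function Gam (phi : V -> R) : Prop :=
  smooth_on setT phi /\
  exists K, [/\ compact K, K `<=` Gam & forall y, ~ K y -> phi y = 0].

Definition laplacian (phi : V -> R) : V -> R :=
  fun y => \sum_i partials [:: i; i] phi y.

Definition cint Gam u : C :=
  ((\int[mu]_(y in Gam) complex.Re (u y))%R +i*
   (\int[mu]_(y in Gam) complex.Im (u y))%R)%C.

Definition ae_eq_on Gam u v : Prop := \forall y \ae mu, Gam y -> u y = v y.

(* Elements of L^2 are represented by functions; they are compared with
   ae_eq_on. *)
Definition L2 Gam u : Prop :=
  [/\ measurable_fun Gam (fun y => complex.Re (u y)),
      measurable_fun Gam (fun y => complex.Im (u y)) &
      mu.-integrable Gam (fun y => (Normc.normc (u y) ^+ 2)%:E)].

(* Squared norm, kept in the extended reals: a real-valued integral would be 0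
   on functions that are not square integrable. *)
Definition sqnorm Gam u : \bar R :=
  (\int[mu]_(y in Gam) (Normc.normc (u y) ^+ 2)%:E)%E.

Definition L2inner Gam u v : C := cint Gam (fun y => u y * (v y)^*%C).

Definition L2_cvg Gam {T : Type} (F : set_system T) (u_ : T -> V -> C) u : Prop :=
  (fun t => sqnorm Gam (fun y => u_ t y - u y)) @ F --> (0 : \bar R)%E.

Definition weak_laplacian Gam u w : Prop :=
  forall phi, test_function Gam phi ->
    cint Gam (fun y => u y * (laplacian phi y)%:C%C) =
    cint Gam (fun y => w y * (phi y)%:C%C).

Definition resolvent_eq Gam (dom : set (V -> C)) (z : C) u f : Prop :=
  dom u /\ exists l, [/\ L2 Gam l, weak_laplacian Gam u l &
    ae_eq_on Gam (fun y => - l y - z * u y) f].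

(* The boundary conditions are encoded by the domain dom of the corresponding
   realization of the Laplacian on L^2(Gam). *)
Record selfadjoint_laplacian Gam (dom : set (V -> C)) : Prop := {
  dom_L2 : forall u, dom u ->
    L2 Gam u /\ exists2 l, L2 Gam l & weak_laplacian Gam u l;
  dom_ae : forall u v, dom u -> L2 Gam v -> ae_eq_on Gam u v -> dom v;
  dom_lin : forall (a : C) u v, dom u -> dom v -> dom (fun y => a * u y + v y);
  dom_dense : forall u (eps : R), L2 Gam u -> 0 < eps ->
    exists2 v, dom v & (sqnorm Gam (fun y => (u y - v y)%R) < eps%:E)%E;
  lap_selfadjoint : forall v w, L2 Gam v -> L2 Gam w ->
    (dom v /\ weak_laplacian Gam v w) <->
    (forall u l, dom u -> L2 Gam l -> weak_laplacian Gam u l ->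
       L2inner Gam l v = L2inner Gam u w);
  lap_compact_resolvent : exists z : C,
    [/\ forall f, L2 Gam f -> exists u, resolvent_eq Gam dom z u f,
        forall u, resolvent_eq Gam dom z u (fun=> 0) -> ae_eq_on Gam u (fun=> 0) &
        forall (M : R) (f_ u_ : nat -> V -> C),
          (forall j, L2 Gam (f_ j) /\ (sqnorm Gam (f_ j) <= M%:E)%E) ->
          (forall j, resolvent_eq Gam dom z (u_ j) (f_ j)) ->
          exists (sigma : nat -> nat) (u : V -> C),
            [/\ {homo sigma : i j / (i < j)%N}, L2 Gam u &
                L2_cvg Gam \oo (u_ \o sigma) u]] }.

Record eigenbasis Gam (dom : set (V -> C))
    (lam : nat -> R) (psi : nat -> V -> C) : Prop := {
  eig_dom : forall n, dom (psi n);
  eig_eq : forall n, weak_laplacian Gam (psi n) (fun y => - (lam n)%:C%C * psi n y);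
  (* interior regularity: psi n is taken to be its smooth representative, so
     that elements of the dual of C^oo(Gam) can be applied to its conjugate *)
  eig_smooth : forall n, csmooth_on Gam (psi n);
  eig_orthonormal : forall n k, L2inner Gam (psi n) (psi k) = (n == k)%:R;
  eig_complete : forall u, L2 Gam u ->
    L2_cvg Gam \oo (fun N y => \sum_(n < N) L2inner Gam u (psi n) * psi n y) u;
  eig_ge0 : forall n, 0 <= lam n;
  eig_pinfty : lam @ \oo --> +oo }.

End cross_section.

Section sobolev_scale.
Context {R : realType} {m : nat}.
Local Notation C := R[i].
Local Notation V := 'rV[R]_m.
Variables (Gam : set V) (lam : nat -> R) (psi : nat -> V -> C).

Definition weighted_summable (t : R) (c : nat -> C) : Prop :=
  (\sum_(0 <= n <oo)
     ((1 + lam n) `^ t * Normc.normc (c n) ^+ 2)%R%:E < +oo)%E.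

Definition Hpos (t : R) (u : V -> C) : Prop :=
  L2 Gam u /\ weighted_summable t (fun n => L2inner Gam u (psi n)).

(* Linear functionals on C^oo(Gam), as total functions of which only the values
   on C^oo(Gam) matter. No continuity is imposed, so that the results below hold
   in particular for continuous functionals. *)
Definition smooth_functional (phi : (V -> C) -> C) : Prop :=
  (forall (a : C) u v, csmooth_on Gam u -> csmooth_on Gam v ->
     phi (fun y => a * u y + v y) = a * phi u + phi v) /\
  (forall u v, csmooth_on Gam u -> csmooth_on Gam v ->
     (forall y, Gam y -> u y = v y) -> phi u = phi v).

Inductive datum := of_fun of V -> C | of_functional of (V -> C) -> C.

Definition dcoef (g : datum) (n : nat) : C :=
  match g with
  | of_fun u => L2inner Gam u (psi n)
  | of_functional phi => phi (fun y => (psi n y)^*%C)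
  end.

(* The space of exponent t in R: functions for t >= 0, functionals for t < 0. *)
Definition Hscale (t : R) (g : datum) : Prop :=
  match g with
  | of_fun u => 0 <= t /\ Hpos t u
  | of_functional phi =>
      [/\ t < 0, smooth_functional phi & weighted_summable t (dcoef g)]
  end.

End sobolev_scale.

Section waveguide.
Context {R : realType} {m : nat}.
Local Notation C := R[i].
Local Notation V := 'rV[R]_m.

Definition cexp (z : C) : C :=
  (expR (complex.Re z) * cos (complex.Im z) +i*
   (expR (complex.Re z) * sin (complex.Im z)))%C.

Definition beta_plus (kp lam : R) : C :=
  if lam < kp ^+ 2 then (Num.sqrt (kp ^+ 2 - lam))%:C%C
  else 'i%C * (Num.sqrt (lam - kp ^+ 2))%:C%C.

Definition beta_minus (km lam : R) : C :=
  if lam < km ^+ 2 then (Num.sqrt (km ^+ 2 - lam))%:C%C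
  else - ('i%C * (Num.sqrt (lam - km ^+ 2))%:C%C).

(* A function on a half-guide is seen as the family of its slices u x, each an
   element of L^2(Gam). A wave is the pair (u^+, u^-): only the values of u^+
   for x < 0 and those of u^- for x > 0 are meaningful. *)
Definition guide_fun := R -> V -> C.
Definition wave : Type := guide_fun * guide_fun.

Definition left_half : set R := [set x | x < 0].
Definition right_half : set R := [set x | 0 < x].

Variables (Gam : set V) (dom : set (V -> C)).

Definition dx_on (I : set R) (u v : guide_fun) : Prop :=
  forall x, I x -> L2 Gam (v x) /\
    L2_cvg Gam (0 : R)^' (fun h y => (h^-1)%:C%C * (u (x + h) y - u x y)) (v x).

(* The Laplacian of the guide is d^2/dx^2 + Delta_y, with x-derivatives in
   L^2(Gam) and Delta_y in the sense of distributions on Gam. *)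
Definition helmholtz (I : set R) (k : R) (u : guide_fun) : Prop :=
  exists v w, [/\ dx_on I u v, dx_on I v w &
    forall x, I x -> exists l, [/\ L2 Gam l, weak_laplacian Gam (u x) l &
      ae_eq_on Gam (fun y => w x y + l y + (k ^+ 2)%:C%C * u x y) (fun=> 0)]].

Definition boundary_condition (I : set R) (u : guide_fun) : Prop :=
  forall x, I x -> dom (u x).

Variables (lam : nat -> R) (psi : nat -> V -> C).

Definition guide_mode (beta : C) (n : nat) : guide_fun :=
  fun x y => psi n y * cexp (- 'i%C * beta * x%:C%C).

Definition radiating (I : set R) (beta : nat -> C) (u : guide_fun) : Prop :=
  exists c : nat -> C, forall x, I x ->
    L2_cvg Gam \oo (fun N y => \sum_(n < N) c n * guide_mode (beta n) n x y) (u x).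

Definition interface_trace (F : set_system R) (u : guide_fun) (t : V -> C) : Prop :=
  L2 Gam t /\ L2_cvg Gam F u t.

(* The normal is - e_x. The trace of the normal derivative is not in general in
   L^2(Gam): it is given by its coefficients b n on the basis psi. *)
Definition normal_trace (I : set R) (F : set_system R) (u : guide_fun)
    (b : nat -> C) : Prop :=
  exists2 v, dx_on I u v & forall n,
    (fun x => Normc.normc (- L2inner Gam (v x) (psi n) - b n)) @ F --> (0 : R).

Record transmission_solution (kp km kappa : R) (f : V -> C) (g : datum)
    (U : wave) : Prop := {
  sol_pde_plus : helmholtz left_half kp U.1;
  sol_pde_minus : helmholtz right_half km U.2;
  sol_jump : exists tp tm, [/\ interface_trace (0 : R)^'- U.1 tp,
    interface_trace (0 : R)^'+ U.2 tm &
    ae_eq_on Gam (fun y => tm y - tp y) f];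
  sol_flux : exists bp bm, [/\ normal_trace left_half (0 : R)^'- U.1 bp,
    normal_trace right_half (0 : R)^'+ U.2 bm &
    forall n, bm n - kappa%:C%C * bp n = dcoef Gam psi g n];
  sol_bc_plus : boundary_condition left_half U.1;
  sol_bc_minus : boundary_condition right_half U.2;
  sol_rad_plus : radiating left_half (fun n => beta_plus kp (lam n)) U.1;
  sol_rad_minus : radiating right_half (fun n => beta_minus km (lam n)) U.2 }.

Definition wave_eq (U W : wave) : Prop :=
  (forall x, x < 0 -> ae_eq_on Gam (U.1 x) (W.1 x)) /\
  (forall x, 0 < x -> ae_eq_on Gam (U.2 x) (W.2 x)).

Definition traces_in (t : R) (U : wave) : Prop :=
  exists tp tm, [/\ interface_trace (0 : R)^'- U.1 tp,
    interface_trace (0 : R)^'+ U.2 tm,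
    Hpos Gam lam psi t tm & Hpos Gam lam psi t tp].

Definition unique_solution (kp km kappa t : R) (f : V -> C) (g : datum) : Prop :=
  exists U, [/\ transmission_solution kp km kappa f g U, traces_in t U &
    forall W, transmission_solution kp km kappa f g W -> wave_eq W U].

Definition transmission_kernel (kp km kappa : R) : set wave :=
  [set U | transmission_solution kp km kappa (fun=> 0) (of_fun (fun=> 0)) U].

Definition zero_wave : wave := (fun _ _ => 0, fun _ _ => 0).

Definition lincomb (s : seq nat) (c : nat -> C) (G : nat -> wave) : wave :=
  (fun x y => \sum_(n <- s) c n * (G n).1 x y,
   fun x y => \sum_(n <- s) c n * (G n).2 x y).

Definition lin_indep (s : seq nat) (G : nat -> wave) : Prop :=
  forall c, wave_eq (lincomb s c G) zero_wave -> forall n, n \in s -> c n = 0.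

Definition is_basis (K : set wave) (s : seq nat) (G : nat -> wave) : Prop :=
  [/\ uniq s, forall n, n \in s -> K (G n), lin_indep s G &
      forall U, K U -> exists c, wave_eq U (lincomb s c G)].

Definition has_dim (K : set wave) (N : nat) : Prop :=
  exists G, is_basis K (iota 0 N) G.

Definition infinite_dim (K : set wave) : Prop :=
  forall N, exists2 G : nat -> wave,
    (forall n, (n < N)%N -> K (G n)) & lin_indep (iota 0 N) G.

(* Closed linear span, for the convergence in L^2(Gam) uniform in x. *)
Definition closed_span (P : set nat) (G : nat -> wave) : set wave :=
  [set U | [/\ forall x, x < 0 -> L2 Gam (U.1 x),
               forall x, 0 < x -> L2 Gam (U.2 x) &
    forall eps : R, 0 < eps -> exists (s : seq nat) (c : nat -> C),
      [/\ forall n, n \in s -> P n,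
          forall x, x < 0 ->
            (sqnorm Gam (fun y => (U.1 x y - (lincomb s c G).1 x y)%R) <= eps%:E)%E &
          forall x, 0 < x ->
            (sqnorm Gam (fun y => (U.2 x y - (lincomb s c G).2 x y)%R) <= eps%:E)%E]]].

Definition evanescent (kp km : R) : set nat :=
  [set n | Num.max (km ^+ 2) (kp ^+ 2) < lam n].

Definition exceptional (kp km kappa : R) : set nat :=
  [set n | evanescent kp km n /\
    Num.sqrt (lam n - km ^+ 2) + kappa * Num.sqrt (lam n - kp ^+ 2) = 0].

(* On x > 0 this is psi_n(y) exp(-i beta_n^- |x|). On x < 0 the decaying solution
   is psi_n(y) exp(-i beta_n^+ x) = psi_n(y) exp(i beta_n^+ |x|), which coincides
   with the even extension of the right branch only if beta_n^- = - beta_n^+;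
   beta_n^- = kappa beta_n^+ then means kappa = -1. *)
Definition evanescent_wave (kp km : R) (n : nat) : wave :=
  (guide_mode (beta_plus kp (lam n)) n, guide_mode (beta_minus km (lam n)) n).

End waveguide.

(* Main.v *)
(** Everything is read on the coefficients in the Hilbert basis psi. The operator
    being self-adjoint, its graph consists of all pairs (v, w) of L^2 functions with
    w_n = - lam_n v_n. Hence a function on a half-guide that has a trace in L^2 at
    x = 0 satisfies the Helmholtz equation, the boundary conditions and the
    radiation condition iff its coefficients are c_n e^(- i beta_n x), where the
    square-summable c_n are the coefficients of the trace; the exponential decay
    of all but finitely many modes makes the x-derivatives of the series converge
    in L^2 away from the interface, and the L^2 functions needed are provided by
    the Riesz-Fischer theorem. The jump conditions become, for every n, a 2 x 2
    linear system with determinant i (beta_n^- - kappa beta_n^+). This vanishes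
    exactly at the exceptional n. For large n its modulus is of order
    lam_n^(1/2) if kappa <> -1, and of order lam_n^(-1/2) if kappa = -1 and
    k^+ <> k^-, which costs two orders of regularity; if kappa = -1 and k^+ = k^-
    it vanishes on all evanescent modes. *)

Require Import Defs.
From HB Require Import structures.
From mathcomp Require Import all_boot all_order all_algebra.
From mathcomp Require Import complex.
From mathcomp Require Import all_classical all_reals all_analysis.
From mathcomp Require Import measurable_realfun ring lra.

Set Implicit Arguments.
Unset Strict Implicit.
Unset Printing Implicit Defensive.

Import Order.TTheory GRing.Theory Num.Theory.
Import numFieldNormedType.Exports.
Local Open Scope classical_set_scope.
Local Open Scope ring_scope.

(** * Square-integrable functions *)

(** The exponents z_n = - i beta_n are unbounded, and the c_n of a wave are not known to be
    square-summable until a trace is available. Away from the interface, the estimates therefore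
    compare the slice at x with the slice at x/2: of the two factors in e^(z x) = e^(z x/2) e^(z
    x/2), one belongs to the L^2 slice u(x/2), and the other absorbs |z_n| or |z_n|^2 uniformly in
    n, because Im z_n stays bounded. No decay is left at x = 0: there the trace is reached by
    domination, and the normal derivative is followed one coefficient at a time.

    The orders of the determinant come from the conjugate factor. With p = sqrt(lam - (k^-)^2) and q
    = sqrt(lam - (k^+)^2), the product of p + kappa q and p - kappa q is (1 - kappa^2) lam + kappa^2
    (k^+)^2 - (k^-)^2, while p - kappa q is O(lam^(1/2)). For kappa = -1 only the constant (k^+)^2 -
    (k^-)^2 survives.

    In the super-critical case the harder inclusion is that of the closed span in the kernel: the
    approximating coefficients change with the accuracy, and one square-summable sequence, common to
    both sides, has to be extracted. *)

Lemma cvgEFin_fin (R : realType) (I : Type) (F : set_system I) (f : I -> R) (a : R) :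
  Filter F -> f @ F --> a -> (fun x => (f x)%:E) @ F --> a%:E.
Proof. by move=> FF fa; apply: cvg_EFin => //; exact: nearW. Qed.

Section square_integrable.
Context d (T : measurableType d) (R : realType).
Variables (mu : {measure set T -> \bar R}) (D : set T) (mD : measurable D).
Implicit Types (f g : T -> R).

Local Notation intg f := (mu.-integrable D (EFin \o f)).
Local Notation I f := (\int[mu]_(y in D) f y)%R.

(** Measurability of [f] is a separate clause, since that of its square does not imply it. *)
Definition sqint f := measurable_fun D f /\ intg (fun y => f y ^+ 2).

Lemma le_integrableR f g : measurable_fun D f ->
  (forall y, `|f y| <= g y) -> intg g -> intg f.
Proof.
move=> mf fg; apply: le_integrable => //; first exact/measurable_EFinP.
move=> y _ /=; rewrite lee_fin; apply: le_trans (fg y) _; exact: ler_norm.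
Qed.

Lemma integrableDR f g : intg f -> intg g -> intg (fun y => f y + g y).
Proof. by move=> If Ig; have := integrableD mD If Ig. Qed.

Lemma integrableZR (a : R) f : intg f -> intg (fun y => a * f y).
Proof. by move=> If; have := integrableZl mD a If. Qed.

Lemma sqint_mul f g : sqint f -> sqint g -> intg (fun y => f y * g y).
Proof.
move=> [mf If] [mg Ig].
apply: (@le_integrableR _ (fun y => f y ^+ 2 + g y ^+ 2)).
- exact: measurable_funM.
- move=> y; rewrite ler_norml; have := sqr_ge0 (f y + g y).
  have := sqr_ge0 (f y - g y); have := sqr_ge0 (f y); have := sqr_ge0 (g y).
  rewrite !expr2 => *; apply/andP; split; nra.
- exact: integrableDR.
Qed.

Lemma sqintD f g : sqint f -> sqint g -> sqint (fun y => f y + g y).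
Proof.
move=> sf sg; have [mf If] := sf; have [mg Ig] := sg.
have Ifg := sqint_mul sf sg.
split; first exact: measurable_funD.
rewrite (_ : _ \o _ =
  EFin \o (fun y => f y ^+ 2 + (2 * (f y * g y) + g y ^+ 2))); last first.
  by apply/funext => y /=; congr EFin; ring.
by apply: integrableDR => //; apply: integrableDR => //; exact: integrableZR.
Qed.

Lemma sqintZ (a : R) f : sqint f -> sqint (fun y => a * f y).
Proof.
move=> [mf If]; split; first exact: measurable_funM.
rewrite (_ : _ \o _ = EFin \o (fun y => a ^+ 2 * f y ^+ 2)); last first.
  by apply/funext => y /=; congr EFin; ring.
exact: integrableZR.
Qed.

Lemma sqintB f g : sqint f -> sqint g -> sqint (fun y => f y - g y).
Proof.
move=> sf /(sqintZ (-1)) sg; have := sqintD sf sg.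
by congr sqint; apply/funext => y; rewrite mulN1r.
Qed.

Lemma sqint0 : sqint (fun=> 0).
Proof.
split; first exact: measurable_cst.
by under eq_fun do rewrite expr0n /=; exact: integrable0.
Qed.

Lemma integral_EFinR f : intg f -> (\int[mu]_(y in D) (f y)%:E)%E = (I f)%:E.
Proof. by move=> If; rewrite /Rintegral fineK//; exact: integrable_fin_num. Qed.

Lemma integrable_nneg f : measurable_fun D f -> (forall y, 0 <= f y) ->
  (\int[mu]_(y in D) (f y)%:E < +oo)%E -> intg f.
Proof.
move=> mf f0 foo; apply/integrableP; split; first exact/measurable_EFinP.
rewrite (eq_integral (EFin \o f))// => y _ /=; by rewrite ger0_norm.
Qed.

(* The weights 4^k turn the bounds 8^-k on the squared increments into an almost
   everywhere bound M 2^-k on the increments themselves. *)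
Lemma ae_cvg_of_increments (f : nat -> T -> R) : (forall k, sqint (f k)) ->
  (forall k, I (fun y => (f k.+1 y - f k y) ^+ 2) <= 8^-1 ^+ k) ->
  \forall y \ae mu, D y -> cvgn (fun k => f k y).
Proof.
move=> sf df.
have half0 k : 0 <= 2^-1 ^+ k :> R by rewrite exprn_ge0 ?invr_ge0.
pose g k y := 4 ^+ k * (f k.+1 y - f k y) ^+ 2.
have g0 k y : 0 <= g k y by apply: mulr_ge0; [exact: exprn_ge0|exact: sqr_ge0].
have sd k : sqint (fun y => f k.+1 y - f k y) by apply: sqintB.
have mg k : measurable_fun D (g k) by have [_ /(integrableZR (4 ^+ k)) /integrableP[/measurable_EFinP]] := sd k.
have mS : measurable_fun D (fun y => \sum_(k <oo) (g k y)%:E)%E.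
  by apply: ge0_emeasurable_sum => [k y _ _|k _]; [rewrite lee_fin|exact/measurable_EFinP].
(* The k-th term integrates to at most 4^k 8^-k = 2^-k, and these bounds sum to 2. *)
have iS : (\int[mu]_(y in D) (\sum_(k <oo) (g k y)%:E) <= 2%:E)%E.
  rewrite integral_nneseries//; [|by move=> k; exact/measurable_EFinP|by move=> k y _; rewrite lee_fin].
  have le2 k : (\int[mu]_(y in D) (g k y)%:E <= (geometric 1 2^-1 k)%:E)%E.
    rewrite integral_EFinR; last by have [_ /(integrableZR (4 ^+ k))] := sd k.
    rewrite lee_fin /g RintegralZl//; last by have [] := sd k.
    apply: (@le_trans _ _ (4 ^+ k * 8^-1 ^+ k)); first by rewrite ler_wpM2l ?exprn_ge0.
    rewrite -exprMn /geometric /= mul1r (_ : 4 * 8^-1 = 2^-1)//.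
    by field.
  apply: (@le_trans _ _ (\sum_(k <oo) (geometric 1 2^-1 k)%:E)%E).
    apply: lee_nneseries => [k _ _|k _]; last exact: le2.
    by apply: integral_ge0 => y _; rewrite lee_fin.
  have := @cvg_geometric_series R 1 2^-1.
  have -> : `|2^-1 : R| < 1 by rewrite ger0_norm ?invr_ge0// invf_lt1 ?ltr1n.
  move=> /(_ isT) cg.
  have -> : (2%:E = (1 * (1 - 2^-1)^-1)%:E :> \bar R)%E by congr EFin; field.
  rewrite -(cvg_lim _ (cvgEFin_fin _ cg))//.
  apply: lee_lim => //.
    by apply: is_cvg_nneseries => k _ _; rewrite lee_fin /geometric /= mul1r.
    by apply/cvg_ex; eexists; exact: cvgEFin_fin cg.
  by near=> n; rewrite /series /= sumEFin.
have ifin : mu.-integrable D (fun y => \sum_(k <oo) (g k y)%:E)%E.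
  apply/integrableP; split => //.
  under eq_integral.
    move=> y _; rewrite gee0_abs; last by apply: nneseries_ge0 => k _ _; rewrite lee_fin.
    over.
  exact: le_lt_trans iS (ltry _).
have := integrable_ae mD ifin; apply: filterS => y /= h Dy.
have {h} := h Dy; set S := (\sum_(k <oo) _)%E => Sfin.
have S0 : 0 <= fine S by apply: fine_ge0; apply: nneseries_ge0 => k _ _; rewrite lee_fin.
have gS k : g k y <= fine S.
  rewrite -lee_fin fineK//.
  apply: le_trans (nneseries_lim_ge k.+1 _); last by move=> i _ _; rewrite lee_fin.
  rewrite sumEFin lee_fin big_mkord big_ord_recr /= lerDr.
  by apply: sumr_ge0.
have incr k : `|f k.+1 y - f k y| <= Num.sqrt (fine S) * 2^-1 ^+ k.
  have h2 : 0 <= Num.sqrt (fine S) * 2^-1 ^+ k by rewrite mulr_ge0 ?sqrtr_ge0.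
  rewrite -(@ler_pXn2r _ 2)// ?nnegrE// real_normK ?num_real// exprMn sqr_sqrtr//.
  have := gS k; rewrite /g => gk.
  have e4 : (4 ^+ k * (2^-1 ^+ k) ^+ 2 : R) = 1.
    by rewrite -exprM mulnC exprM -exprMn (_ : 4 * 2^-1 ^+ 2 = 1) ?expr1n//; field.
  rewrite -(@ler_pM2l _ (4 ^+ k)) ?exprn_gt0//; apply: le_trans gk _.
  by rewrite mulrCA e4 mulr1.
have : cvgn (series (fun k => f k.+1 y - f k y)).
  apply: normed_cvg; apply: (@series_le_cvg _ _ (geometric (Num.sqrt (fine S)) 2^-1)).
  - by move=> n; rewrite normr_ge0.
  - by move=> n; rewrite /geometric /= mulr_ge0 ?sqrtr_ge0 ?exprn_ge0.
  - exact: incr.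
  apply: is_cvg_geometric_series.
  by rewrite ger0_norm ?invr_ge0// invf_lt1 ?ltr1n.
move=> cs; have -> : (fun k => f k y) = (fun k => f 0%N y + series (fun k => f k.+1 y - f k y) k).
  by apply/funext => k; rewrite seriesEnat /= telescope_sumr// addrC subrK.
by apply: is_cvgD => //; exact: is_cvg_cst.
Unshelve. all: by end_near.
Qed.

(** The limit is taken as an upper limit, which is defined and measurable everywhere and agrees with
    the pointwise limit almost everywhere. Fatou's lemma then passes the bound 8^-j from [f k - f j]
    to [g - f j]. *)
Lemma sqint_complete (f : nat -> T -> R) : (forall k, sqint (f k)) ->
  (forall j k, (j <= k)%N -> I (fun y => (f k y - f j y) ^+ 2) <= 8^-1 ^+ j) ->
  exists2 g, sqint g & forall j, I (fun y => (g y - f j y) ^+ 2) <= 8^-1 ^+ j.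
Proof.
move=> sf df.
have cf := ae_cvg_of_increments sf (fun k => df _ _ (leqnSn k)).
pose g y := fine (limn_esup (fun k => (f k y)%:E)).
have mg : measurable_fun D g.
  apply: measurableT_comp => //; apply: measurable_fun_limn_esup => k.
  by apply/measurable_EFinP; have [] := sf k.
have mgf j : measurable_fun D (fun y => (g y - f j y) ^+ 2).
  by apply: measurable_funX; apply: measurable_funB => //; have [] := sf j.
have le8 j : (\int[mu]_(y in D) ((g y - f j y) ^+ 2)%:E <= (8^-1 ^+ j)%:E)%E.
  have mh k : measurable_fun D (fun y => ((f k y - f j y) ^+ 2)%:E).
    by apply/measurable_EFinP; have [_ /integrableP[/measurable_EFinP]] := sqintB (sf k) (sf j).
  have h0 k y : D y -> (0 <= ((f k y - f j y) ^+ 2)%:E)%E by rewrite lee_fin sqr_ge0.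
  apply: (@le_trans _ _ (\int[mu]_(y in D) limn_einf (fun k => ((f k y - f j y) ^+ 2)%:E))%E).
    apply: ae_ge0_le_integral => //.
    - by move=> y _; rewrite lee_fin sqr_ge0.
    - exact/measurable_EFinP.
    - move=> y Dy; rewrite limn_einf_lim; apply: lime_ge.
        exact: is_cvg_einfs.
      by apply: nearW => n; apply: le_ereal_inf_tmp => _ [k _ <-]; exact: h0.
    - rewrite (_ : (fun y => _) = (fun y => - limn_esup (fun k => (- (f k y - f j y) ^+ 2)%:E))%E).
        apply: measurableT_comp => //; apply: measurable_fun_limn_esup => k.
        by have /measurable_EFinP /measurable_funN h := mh k; exact/measurable_EFinP.
      by apply/funext => y; rewrite -limn_einfN; congr limn_einf; apply/funext => k /=; rewrite opprK.
    - apply: filterS cf => y h Dy; have /cvg_ex[l fl] := h Dy.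
      have gl : g y = l.
        rewrite /g; have := @cvg_limn_einf_sup R (fun k => (f k y)%:E) l%:E.
        by move=> [|_ ->//]; exact: cvgEFin_fin fl.
      rewrite gl (cvg_limn_einf_sup (l := ((l - f j y) ^+ 2)%:E))//.
      apply: cvgEFin_fin.
      apply: (@cvg_comp _ _ _ (fun k => f k y - f j y) (fun x => x ^+ 2)).
        by apply: cvgB fl _; exact: cvg_cst.
      exact: exprn_continuous.
  apply: le_trans (fatou mu mD mh h0) _.
  rewrite limn_einf_lim; apply: lime_le; first exact: is_cvg_einfs.
  (* The infimum over indices at least n is tested at max(n, j), as the hypothesis bounds
     [f k - f j] only for k at least j. *)
  near=> n; apply: (@le_trans _ _ (\int[mu]_(y in D) ((f (maxn n j) y - f j y) ^+ 2)%:E)%E).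
    by apply: ge_ereal_inf; eexists; last exact: lexx; exists (maxn n j) => //=; exact: leq_maxl.
  rewrite integral_EFinR; last by have [] := sqintB (sf (maxn n j)) (sf j).
  by rewrite lee_fin; apply: df; exact: leq_maxr.
have ig j : intg (fun y => (g y - f j y) ^+ 2).
  by apply: integrable_nneg => // [y|]; [exact: sqr_ge0 | exact: le_lt_trans (le8 j) (ltry _)].
exists g; last by move=> j; rewrite -lee_fin -integral_EFinR.
have : sqint (fun y => (g y - f 0%N y) + f 0%N y).
  apply: sqintD => //; split => //.
  by apply: measurable_funB => //; have [] := sf 0%N.
by congr sqint; apply/funext => y; rewrite subrK.
Unshelve. all: by end_near.
Qed.

End square_integrable.

(** * Complex numbers through their real and imaginary parts *)

Section complex_parts.
Context {R : realType}.
Local Notation C := R[i].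
Implicit Types (x y z : C) (a : R).
Local Notation normc := Normc.normc.

Lemma Re_addc x y : complex.Re (x + y) = complex.Re x + complex.Re y.
Proof. by case: x; case: y. Qed.
Lemma Im_addc x y : complex.Im (x + y) = complex.Im x + complex.Im y.
Proof. by case: x; case: y. Qed.
Lemma Re_oppc x : complex.Re (- x) = - complex.Re x.
Proof. by case: x. Qed.
Lemma Im_oppc x : complex.Im (- x) = - complex.Im x.
Proof. by case: x. Qed.
Lemma Re_mulc x y : complex.Re (x * y) =
  complex.Re x * complex.Re y - complex.Im x * complex.Im y.
Proof. by case: x; case: y. Qed.
Lemma Im_mulc x y : complex.Im (x * y) =
  complex.Re x * complex.Im y + complex.Im x * complex.Re y.
Proof. by case: x => a b; case: y. Qed.
Lemma Re_conjc x : complex.Re x^*%C = complex.Re x.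
Proof. by case: x. Qed.
Lemma Im_conjc x : complex.Im x^*%C = - complex.Im x.
Proof. by case: x. Qed.

Definition complex_partsE := (Re_addc, Im_addc, Re_oppc, Im_oppc, Re_mulc, Im_mulc, Re_conjc, Im_conjc).

Lemma complex_ext x y : complex.Re x = complex.Re y -> complex.Im x = complex.Im y ->
  x = y.
Proof. by case: x; case: y => /= ? ? ? ? -> ->. Qed.

Lemma conjcD x y : (x + y)^*%C = x^*%C + y^*%C.
Proof. by apply: complex_ext; rewrite !complex_partsE //; ring. Qed.

Lemma conjcM x y : (x * y)^*%C = x^*%C * y^*%C.
Proof. by apply: complex_ext; rewrite !complex_partsE; ring. Qed.

Lemma normc_sqr z : normc z ^+ 2 = complex.Re z ^+ 2 + complex.Im z ^+ 2.
Proof. by case: z => a b /=; rewrite sqr_sqrtr// addr_ge0 ?sqr_ge0. Qed.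

Lemma normc_ge0 z : 0 <= normc z.
Proof. by case: z => a b /=; exact: sqrtr_ge0. Qed.

Lemma normc_le z a : 0 <= a -> normc z ^+ 2 <= a ^+ 2 -> normc z <= a.
Proof. by move=> a0; rewrite ler_pXn2r// nnegrE ?normc_ge0. Qed.

Lemma normc_real a : normc a%:C%C = `|a|.
Proof. by rewrite /= expr0n /= addr0 sqrtr_sqr. Qed.

Lemma normc_eq0P z : normc z ^+ 2 = 0 -> z = 0.
Proof. by move=> /eqP; rewrite sqrf_eq0 => /eqP /Normc.eq0_normc. Qed.

Lemma mulc_conjc z : z * z^*%C = (normc z ^+ 2)%:C%C.
Proof.
by apply: complex_ext; rewrite !complex_partsE /= ?normc_sqr; ring.
Qed.

Lemma normc_opp x : normc (- x) = normc x.
Proof. by case: x => a b /=; rewrite !sqrrN. Qed.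

Lemma normc_triangle x y : normc (x + y) <= normc x + normc y.
Proof. by rewrite -lecR rmorphD; have := ler_normD x y; rewrite !normc_def; case: x; case: y. Qed.

Lemma normc_small_eq x y : (forall e : R, 0 < e -> normc (x - y) <= e) -> x = y.
Proof.
move=> h; apply/eqP; rewrite -subr_eq0; apply/eqP/Normc.eq0_normc.
apply/eqP; rewrite eq_le normc_ge0 andbT; apply/ler_addgt0Pl => e e0.
by rewrite addr0; exact: h.
Qed.

(** Uniqueness of limits in C. Coefficients are identified below by showing that one family tends to
    two numbers. *)
Lemma normc_dist (T : Type) (F : set_system T) {FF : ProperFilter F} (f : T -> C) x y :
  (fun t => normc (f t - x)) @ F --> (0 : R) ->
  (fun t => normc (f t - y)) @ F --> (0 : R) -> x = y.
Proof.
move=> fx fy; apply/normc_small_eq => e e0.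
have e20 : 0 < e / 2 by rewrite divr_gt0.
have /fcvgrPdist_lt/(_ _ e20) hx := fx; have /fcvgrPdist_lt/(_ _ e20) hy := fy.
near F => t.
have h1 : normc (f t - x) < e / 2.
  by rewrite -[ltLHS]ger0_norm ?normc_ge0// -normrN -sub0r; near: t.
have h2 : normc (f t - y) < e / 2.
  by rewrite -[ltLHS]ger0_norm ?normc_ge0// -normrN -sub0r; near: t.
have -> : x - y = (f t - y) - (f t - x) by ring.
by apply: le_trans (normc_triangle _ _) _; rewrite normc_opp; lra.
Unshelve. all: by end_near.
Qed.

End complex_parts.

(** * Complex-valued square-integrable functions *)

Section L2_complex.
Context {R : realType} {m : nat}.
Local Notation C := R[i].
Local Notation V := 'rV[R]_m.
Local Notation mu := (@lebesgue_rV R m).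
Local Notation normc := Normc.normc.
Variables (Gam : set V) (mGam : measurable Gam).
Implicit Types u v w : V -> C.
Local Notation I f := (\int[mu]_(y in Gam) f y)%R.
Local Notation re u := (fun y => complex.Re (u y)).
Local Notation im u := (fun y => complex.Im (u y)).
Local Notation sqi := (sqint mu Gam).
Local Notation intg f := (mu.-integrable Gam (EFin \o f)).
Local Notation L2 := (L2 Gam).

Lemma L2P u : L2 u <-> sqi (re u) /\ sqi (im u).
Proof.
split.
  move=> [mr mi iu].
  have h (f : V -> R) : measurable_fun Gam f -> (forall y, f y ^+ 2 <= normc (u y) ^+ 2) -> sqi f.
    move=> mf fu; split => //; apply: (le_integrableR mGam _ _ iu); first exact: measurable_funX.
    by move=> y; rewrite ger0_norm ?sqr_ge0.
  by split; apply: h => // y; rewrite normc_sqr ?lerDl ?lerDr sqr_ge0.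
move=> [[mr ir] [mi ii]]; split => //.
have := integrableDR mGam ir ii; congr (integrable _ _ _).
by apply/funext => y /=; rewrite normc_sqr.
Qed.

Lemma L2_lin (a : C) u v : L2 u -> L2 v -> L2 (fun y => a * u y + v y).
Proof.
move=> /L2P[ur ui] /L2P[vr vi]; apply/L2P; split.
  have := sqintD mGam (sqintB mGam (sqintZ mGam (complex.Re a) ur) (sqintZ mGam (complex.Im a) ui)) vr.
  by congr sqint; apply/funext => y; rewrite !complex_partsE.
have := sqintD mGam (sqintD mGam (sqintZ mGam (complex.Re a) ui) (sqintZ mGam (complex.Im a) ur)) vi.
by congr sqint; apply/funext => y; rewrite !complex_partsE.
Qed.

Lemma L2_0 : L2 (fun=> 0).
Proof. by apply/L2P; split; exact: sqint0. Qed.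

Lemma L2Z (a : C) u : L2 u -> L2 (fun y => a * u y).
Proof. by move=> /(L2_lin a)/(_ L2_0); congr (Defs.L2 _); apply/funext => y; rewrite addr0. Qed.

Lemma L2B u v : L2 u -> L2 v -> L2 (fun y => u y - v y).
Proof.
by move=> uL /(L2_lin (-1))/(_ uL); congr (Defs.L2 _); apply/funext => y; rewrite mulN1r addrC.
Qed.

Lemma L2_sum (r : seq nat) (c : nat -> C) (p : nat -> V -> C) : (forall n, L2 (p n)) ->
  L2 (fun y => \sum_(n <- r) c n * p n y).
Proof.
move=> hp; elim: r => [|n r IH].
  by under eq_fun do rewrite big_nil; exact: L2_0.
by under eq_fun do rewrite big_cons; exact: L2_lin.
Qed.

(** Real counterpart of [sqnorm], meaningful on L^2, where [sqnormE] relates the two. *)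
Definition norm2 u : R := I (fun y => normc (u y) ^+ 2).

Lemma norm2_ge0 u : 0 <= norm2 u.
Proof. by apply: Rintegral_ge0 => y _; exact: sqr_ge0. Qed.

Lemma sqnormE u : L2 u -> sqnorm Gam u = (norm2 u)%:E.
Proof. by move=> [_ _ iu]; rewrite /sqnorm integral_EFinR. Qed.

Lemma L2inner_lin (a : C) u v w : L2 u -> L2 v -> L2 w ->
  L2inner Gam (fun y => a * u y + v y) w = a * L2inner Gam u w + L2inner Gam v w.
Proof.
move=> /L2P[ur ui] /L2P[vr vi] /L2P[wr wi].
have urwr := sqint_mul mGam ur wr. have urwi := sqint_mul mGam ur wi.
have uiwr := sqint_mul mGam ui wr. have uiwi := sqint_mul mGam ui wi.
have vrwr := sqint_mul mGam vr wr. have vrwi := sqint_mul mGam vr wi.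
have viwr := sqint_mul mGam vi wr. have viwi := sqint_mul mGam vi wi.
have lin3 (x1 x2 : R) (f1 f2 f3 : V -> R) : intg f1 -> intg f2 -> intg f3 ->
    I (fun y => (x1 * f1 y + x2 * f2 y) + f3 y) = x1 * I f1 + x2 * I f2 + I f3.
  move=> i1 i2 i3; have j1 := integrableZR mGam x1 i1; have j2 := integrableZR mGam x2 i2.
  by rewrite (RintegralD mGam (integrableDR mGam j1 j2) i3) (RintegralD mGam j1 j2) !RintegralZl.
have reE u' : re (fun y => u' y * (w y)^*%C) = (fun y => re u' y * re w y + im u' y * im w y).
  by apply/funext => y; rewrite !complex_partsE; ring.
have imE u' : im (fun y => u' y * (w y)^*%C) = (fun y => im u' y * re w y - re u' y * im w y).
  by apply/funext => y; rewrite !complex_partsE; ring.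
have iur := integrableDR mGam urwr uiwi.
have iui := integrableDR mGam uiwr (integrableZR mGam (-1) urwi).
have ivr := integrableDR mGam vrwr viwi.
have ivi := integrableDR mGam viwr (integrableZR mGam (-1) vrwi).
apply: complex_ext; rewrite !complex_partsE /L2inner /cint /=.
- transitivity (I (fun y => (complex.Re a * (re u y * re w y + im u y * im w y) +
      (- complex.Im a) * (im u y * re w y + -1 * (re u y * im w y))) +
      (re v y * re w y + im v y * im w y))).
    by apply: eq_Rintegral => y _; rewrite !complex_partsE; ring.
  rewrite lin3// mulNr; congr (_ * _ - _ * _ + _); apply: eq_Rintegral => y _;
    by rewrite !complex_partsE; ring.
- transitivity (I (fun y => (complex.Re a * (im u y * re w y + -1 * (re u y * im w y)) +
      complex.Im a * (re u y * re w y + im u y * im w y)) +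
      (im v y * re w y + -1 * (re v y * im w y)))).
    by apply: eq_Rintegral => y _; rewrite !complex_partsE; ring.
  rewrite lin3//; congr (_ * _ + _ * _ + _); apply: eq_Rintegral => y _;
    by rewrite !complex_partsE; ring.
Qed.

Lemma L2inner0l w : L2inner Gam (fun=> 0) w = 0.
Proof.
apply: complex_ext; rewrite /L2inner /cint /=.
- transitivity (I (fun=> 0 : R)); last by rewrite Rintegral_cst ?mul0r.
  by apply: eq_Rintegral => y _; rewrite mul0r.
- transitivity (I (fun=> 0 : R)); last by rewrite Rintegral_cst ?mul0r.
  by apply: eq_Rintegral => y _; rewrite mul0r.
Qed.

Lemma L2innerZ (a : C) u w : L2 u -> L2 w ->
  L2inner Gam (fun y => a * u y) w = a * L2inner Gam u w.
Proof.
move=> uL wL; have := L2inner_lin a uL L2_0 wL.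
rewrite L2inner0l addr0 => <-; congr L2inner; by apply/funext => y; rewrite addr0.
Qed.

Lemma L2innerB u v w : L2 u -> L2 v -> L2 w ->
  L2inner Gam (fun y => u y - v y) w = L2inner Gam u w - L2inner Gam v w.
Proof.
move=> uL vL wL; have := L2inner_lin (-1) vL uL wL; rewrite mulN1r addrC => <-.
by congr L2inner; apply/funext => y; rewrite mulN1r addrC.
Qed.

Lemma L2inner_conj u v : L2 u -> L2 v -> (L2inner Gam u v)^*%C = L2inner Gam v u.
Proof.
move=> /L2P[ur ui] /L2P[vr vi]; apply: complex_ext; rewrite ?Re_conjc ?Im_conjc /L2inner /cint /=.
  by apply: eq_Rintegral => y _; rewrite !complex_partsE; ring.
have urvi := sqint_mul mGam ur vi; have uivr := sqint_mul mGam ui vr.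
rewrite -mulN1r -RintegralZl//; last first.
  have := integrableDR mGam uivr (integrableZR mGam (-1) urvi); congr (integrable _ _ _).
  by apply/funext => y /=; rewrite !complex_partsE; congr EFin; ring.
by apply: eq_Rintegral => y _; rewrite !complex_partsE; ring.
Qed.

Lemma L2inner_self u : L2inner Gam u u = (norm2 u)%:C%C.
Proof.
apply: complex_ext; rewrite /L2inner /cint /norm2 /=.
  by apply: eq_Rintegral => y _; rewrite mulc_conjc.
transitivity (I (fun=> 0 : R)); last by rewrite Rintegral_cst ?mul0r.
by apply: eq_Rintegral => y _; rewrite mulc_conjc.
Qed.

Lemma ae_eq_norm2 u v : L2 u -> L2 v -> ae_eq_on Gam u v <-> norm2 (fun y => u y - v y) = 0.
Proof.
move=> uL vL; have [mr mi iuv] := L2B uL vL; have mf := measurable_int mu iuv.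
have e : (\int[mu]_(y in Gam) `|(normc (u y - v y) ^+ 2)%:E|)%E = (norm2 (fun y => u y - v y))%:E.
  rewrite -integral_EFinR//; apply: eq_integral => y _.
  by rewrite gee0_abs// lee_fin sqr_ge0.
have := ae_eq_integral_abs mu mGam mf; rewrite e => h; split.
  move=> uv; suff : (norm2 (fun y => u y - v y))%:E = 0%:E by case.
  apply/h; apply: filterS uv => y uv Dy /=.
  by rewrite uv// subrr Normc.normc0 expr0n.
move=> n0; rewrite n0 in h; have {}h := h.1 erefl; apply: filterS h => y h Dy.
by have /= := h Dy; case=> /normc_eq0P /eqP; rewrite subr_eq0 => /eqP.
Qed.

Lemma ae_eq_L2innerl u v w : L2 u -> L2 v -> L2 w -> ae_eq_on Gam u v ->
  L2inner Gam u w = L2inner Gam v w.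
Proof.
move=> uL vL wL uv; rewrite /L2inner /cint /Rintegral.
have mm x : L2 x -> measurable_fun Gam (re (fun y => x y * (w y)^*%C)) /\
    measurable_fun Gam (im (fun y => x y * (w y)^*%C)).
  move=> /L2P[[xr _] [xi _]]; have [[wr _] [wi _]] := (L2P w).1 wL; split.
    rewrite (_ : (fun _ => _) = (fun y => re x y * re w y + im x y * im w y)).
      by apply: measurable_funD; exact: measurable_funM.
    by apply/funext => y; rewrite !complex_partsE; ring.
  rewrite (_ : (fun _ => _) = (fun y => im x y * re w y - re x y * im w y)).
    by apply: measurable_funB; exact: measurable_funM.
  by apply/funext => y; rewrite !complex_partsE; ring.
have [mur mui] := mm u uL; have [mvr mvi] := mm v vL.
congr (Complex (fine _) (fine _)); apply: ae_eq_integral => //;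
  try exact/measurable_EFinP; by apply: filterS uv => y uv Dy; rewrite uv.
Qed.

End L2_complex.

(** * Hilbert bases *)

#[local] Arguments Normc.normc : simpl never.
#[local] Arguments L2inner : simpl never.

Section hilbert.
Context {R : realType} {m : nat}.
Local Notation C := R[i].
Local Notation V := 'rV[R]_m.
Local Notation mu := (@lebesgue_rV R m).
Local Notation normc := Normc.normc.
Variables (Gam : set V) (mGam : measurable Gam).
Implicit Types u v w : V -> C.
Local Notation L2 := (L2 Gam).
Local Notation norm2 := (@norm2 R m Gam).
Local Notation ip := (L2inner Gam).

Lemma L2inner_linr (a : C) u v w : L2 u -> L2 v -> L2 w ->
  ip w (fun y => a * u y + v y) = a^*%C * ip w u + ip w v.
Proof.
move=> uL vL wL; rewrite -(L2inner_conj mGam (L2_lin mGam a uL vL) wL).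
by rewrite (L2inner_lin mGam)// conjcD conjcM !(L2inner_conj mGam).
Qed.

Lemma norm2_lin (a : C) u v : L2 u -> L2 v ->
  norm2 (fun y => a * u y + v y) =
  normc a ^+ 2 * norm2 u + 2 * complex.Re (a * ip u v) + norm2 v.
Proof.
move=> uL vL; have wL := L2_lin mGam a uL vL.
have := L2inner_self mGam (fun y => a * u y + v y).
rewrite (L2inner_lin mGam)// !L2inner_linr// !(L2inner_self mGam) -(L2inner_conj mGam uL vL).
move=> /(congr1 (@complex.Re R)) /= <-.
by rewrite normc_sqr !complex_partsE /=; ring.
Qed.

Lemma norm2B u v : L2 u -> L2 v ->
  norm2 (fun y => u y - v y) = norm2 u - 2 * complex.Re (ip u v) + norm2 v.
Proof.
move=> uL vL; have := norm2_lin (-1) vL uL.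
rewrite (_ : (fun y => -1 * v y + u y) = (fun y => u y - v y)); last first.
  by apply/funext => y; rewrite mulN1r addrC.
move=> ->; rewrite normc_opp Normc.normc1 expr1n -(L2inner_conj mGam uL vL) !complex_partsE /=.
by ring.
Qed.

Lemma norm2C u v : L2 u -> L2 v -> norm2 (fun y => u y - v y) = norm2 (fun y => v y - u y).
Proof.
move=> uL vL; rewrite (norm2B uL vL) (norm2B vL uL) -(L2inner_conj mGam uL vL).
by rewrite Re_conjc; ring.
Qed.

(** With p the inner product, |u - s p v|^2 is nonnegative for every real s. The choice s = 1/|v|^2
    gives the bound; if |v| = 0, the choice s = (|u|^2 + 1)/|p|^2 shows that p must vanish. *)
Lemma cauchy_schwarz u v : L2 u -> L2 v -> normc (ip u v) ^+ 2 <= norm2 u * norm2 v.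
Proof.
move=> uL vL; set p := ip u v.
have h (s : R) : 0 <= norm2 u - 2 * s * normc p ^+ 2 + s ^+ 2 * (normc p ^+ 2 * norm2 v).
  have := norm2_ge0 Gam (fun y => (- s%:C%C * p) * v y + u y).
  rewrite norm2_lin// -(L2inner_conj mGam uL vL) -/p.
  rewrite (_ : (- s%:C%C * p) * p^*%C = (- (s * normc p ^+ 2))%:C%C); last first.
    by rewrite -mulrA mulc_conjc; apply: complex_ext; rewrite !complex_partsE /=; ring.
  have -> : normc (- s%:C%C * p) ^+ 2 = s ^+ 2 * normc p ^+ 2.
    by rewrite Normc.normcM normc_opp normc_real exprMn real_normK ?num_real.
  move=> /=; lra.
have p0 : 0 <= normc p ^+ 2 by exact: sqr_ge0.
have u0 := norm2_ge0 Gam u; have := norm2_ge0 Gam v; rewrite le_eqVlt => /predU1P[v0|v0].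
  rewrite -v0 mulr0 leNgt; apply/negP => pp.
  have := h ((norm2 u + 1) / normc p ^+ 2); rewrite -v0 !mulr0 addr0 -mulrA mulfVK ?gt_eqF//.
  by lra.
have := h (norm2 v)^-1; set b := norm2 v in v0 *.
have -> : norm2 u - 2 * b^-1 * normc p ^+ 2 + b^-1 ^+ 2 * (normc p ^+ 2 * b) =
  (norm2 u * b - normc p ^+ 2) / b by field; rewrite gt_eqF.
by rewrite pmulr_lge0 ?invr_gt0// subr_ge0.
Qed.

(** Membership in L^2 is asked only eventually, because a slice [u (x + h)] is under control only
    for h so small that x + h stays in the half-guide. *)
Lemma L2_cvgP (T : Type) (F : set_system T) {FF : Filter F} (u_ : T -> V -> C) u :
  (\forall t \near F, L2 (u_ t)) -> L2 u ->
  L2_cvg Gam F u_ u <-> (fun t => norm2 (fun y => u_ t y - u y)) @ F --> (0 : R).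
Proof.
move=> uL vL.
have e : \forall t \near F,
    sqnorm Gam (fun y => u_ t y - u y) = (norm2 (fun y => u_ t y - u y))%:E.
  by apply: filterS uL => t uL; rewrite (sqnormE mGam (L2B mGam uL vL)).
rewrite /L2_cvg; split => h.
  suff /fine_cvgP[] : (fun t => (norm2 (fun y => u_ t y - u y))%:E) @ F --> (0 : \bar R)%E by [].
  by apply: cvg_trans h; apply: near_eq_cvg; apply: filterS e => t ->.
apply: (@cvg_trans _ ((fun t => (norm2 (fun y => u_ t y - u y))%:E) @ F)).
  by apply: near_eq_cvg; apply: filterS e => t ->.
exact: cvgEFin_fin.
Qed.

Lemma ip_cvg (T : Type) (F : set_system T) {FF : Filter F} (u_ : T -> V -> C) u v :
  (\forall t \near F, L2 (u_ t)) -> L2 u -> L2 v -> L2_cvg Gam F u_ u ->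
  (fun t => normc (ip (u_ t) v - ip u v)) @ F --> (0 : R).
Proof.
move=> uL u0L vL /(L2_cvgP uL u0L) h; apply/cvgrPdist_lt => e e0.
have e2 : 0 < e ^+ 2 / (norm2 v + 1) by rewrite divr_gt0 ?exprn_gt0// ltr_wpDl ?norm2_ge0.
have /cvgrPdist_lt/(_ _ e2) := h; apply: filterS2 uL => t tL.
rewrite !sub0r !normrN !ger0_norm ?norm2_ge0 ?normc_ge0// => ht.
rewrite -(@ltr_pXn2r _ 2)// ?nnegrE ?normc_ge0 ?(ltW e0)//.
rewrite -(L2innerB mGam)//; apply: le_lt_trans (cauchy_schwarz (L2B mGam tL u0L) vL) _.
move: ht; rewrite ltr_pdivlMr ?ltr_wpDl ?norm2_ge0//; apply: le_lt_trans.
by rewrite ler_wpM2l ?norm2_ge0// lerDl.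
Qed.

End hilbert.

Section orthonormal.
Context {R : realType} {m : nat}.
Local Notation C := R[i].
Local Notation V := 'rV[R]_m.
Local Notation mu := (@lebesgue_rV R m).
Local Notation normc := Normc.normc.
Variables (Gam : set V) (mGam : measurable Gam).
Implicit Types u v w : V -> C.
Local Notation L2 := (L2 Gam).
Local Notation norm2 := (@norm2 R m Gam).
Local Notation ip := (L2inner Gam).
Variable psi : nat -> V -> C.
Hypothesis psiL : forall n, L2 (psi n).
Hypothesis ortho : forall n k, ip (psi n) (psi k) = (n == k)%:R.
Hypothesis complete : forall u, L2 u ->
    L2_cvg Gam \oo (fun N y => \sum_(n < N) ip u (psi n) * psi n y) u.

(** An arbitrary index sequence accommodates blocks of consecutive indices and finite sets of
    evanescent modes alike. *)
Definition psum (r : seq nat) (c : nat -> C) : V -> C := fun y => \sum_(n <- r) c n * psi n y.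

Lemma L2_psum r c : L2 (psum r c).
Proof. exact: L2_sum. Qed.

Lemma ip_psum r c w : L2 w -> ip (psum r c) w = \sum_(n <- r) c n * ip (psi n) w.
Proof.
move=> wL; rewrite /psum; elim: r => [|n r IH].
  rewrite big_nil (_ : (fun y => _) = (fun=> 0)) ?L2inner0l//.
  by apply/funext => y; rewrite big_nil.
rewrite (_ : (fun y => _) = (fun y => c n * psi n y + psum r c y)); last first.
  by apply/funext => y; rewrite big_cons.
by rewrite (L2inner_lin mGam)// ?big_cons ?IH//; exact: L2_sum.
Qed.

Lemma coef_psum r c k : ip (psum r c) (psi k) = \sum_(n <- r) c n * (n == k)%:R.
Proof. by rewrite ip_psum//; apply: eq_bigr => n _; rewrite ortho. Qed.

Lemma coef_psum_uniq r c k : uniq r ->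
  ip (psum r c) (psi k) = if k \in r then c k else 0.
Proof.
move=> ur; rewrite coef_psum; case: ifPn => kr.
  rewrite (bigD1_seq k)//= eqxx mulr1 big1 ?addr0// => n /negPf ->.
  by rewrite mulr0.
rewrite big1_seq// => n /andP[_ nr].
by case: eqP => [nk|]; [rewrite -nk nr in kr|rewrite mulr0].
Qed.

Lemma norm2_psum r c : uniq r -> norm2 (psum r c) = \sum_(n <- r) normc (c n) ^+ 2.
Proof.
move=> ur; have := L2inner_self mGam (psum r c).
rewrite ip_psum; last exact: L2_psum.
have -> : \sum_(n <- r) c n * ip (psi n) (psum r c) = \sum_(n <- r) (normc (c n) ^+ 2)%:C%C.
  apply: eq_big_seq => n nr; rewrite -(L2inner_conj mGam (L2_psum _ _))// coef_psum_uniq// nr.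
  exact: mulc_conjc.
by rewrite -rmorph_sum => /complexI.
Qed.

Lemma norm2_sub_psum r u : uniq r -> L2 u ->
  norm2 (fun y => psum r (fun n => ip u (psi n)) y - u y) =
  norm2 u - \sum_(n <- r) normc (ip u (psi n)) ^+ 2.
Proof.
move=> ur uL; rewrite (norm2B mGam (L2_psum r _) uL) norm2_psum// ip_psum//.
under [X in complex.Re X]eq_bigr => n _.
  rewrite -(L2inner_conj mGam uL (psiL n)) mulc_conjc; over.
by rewrite -rmorph_sum /=; ring.
Qed.

Lemma psum_ord (c : nat -> C) N : (fun y => \sum_(n < N) c n * psi n y) = psum (index_iota 0 N) c.
Proof. by apply/funext => y; rewrite /psum big_mkord. Qed.

Definition partial2 (c : nat -> C) (N : nat) : R := \sum_(0 <= n < N) normc (c n) ^+ 2.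

Lemma partial2_nd c : nondecreasing_seq (partial2 c).
Proof.
move=> i j ij; rewrite /partial2 (big_cat_nat (leq0n i) ij)//= lerDl.
by apply: sumr_ge0 => n _; exact: sqr_ge0.
Qed.

Lemma parseval u : L2 u -> partial2 (fun n => ip u (psi n)) @ \oo --> norm2 u.
Proof.
move=> uL; have := complete uL.
have -> : (fun N y => \sum_(n < N) ip u (psi n) * psi n y) =
    (fun N => psum (index_iota 0 N) (fun n => ip u (psi n))).
  by apply/funext => N; exact: psum_ord.
move/(L2_cvgP mGam (nearW _ (fun N => L2_psum _ _)) uL).
under eq_fun do rewrite norm2_sub_psum ?iota_uniq//.
move=> h.
have -> : partial2 (fun n => ip u (psi n)) =
    (fun N => norm2 u - (norm2 u - partial2 (fun n => ip u (psi n)) N)).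
  by apply/funext => N; rewrite subKr.
by have := cvgB (cvg_cst (norm2 u)) h; rewrite subr0; apply.
Qed.

Lemma bessel u N : L2 u -> partial2 (fun n => ip u (psi n)) N <= norm2 u.
Proof.
move=> uL; rewrite -(cvg_lim _ (parseval uL))//.
apply: nondecreasing_cvgn_le; first exact: partial2_nd.
by apply/cvg_ex; eexists; exact: parseval.
Qed.

Lemma bessel_seq u r : uniq r -> L2 u -> \sum_(n <- r) normc (ip u (psi n)) ^+ 2 <= norm2 u.
Proof.
by move=> ur uL; have := norm2_ge0 Gam (fun y => psum r (fun n => ip u (psi n)) y - u y);
  rewrite norm2_sub_psum// subr_ge0.
Qed.

Lemma coef_le u n : L2 u -> normc (ip u (psi n)) ^+ 2 <= norm2 u.
Proof. by move=> uL; have := @bessel_seq u [:: n] isT uL; rewrite big_seq1. Qed.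

Lemma norm2_le_coef u M : L2 u ->
  (forall N, partial2 (fun n => ip u (psi n)) N <= M) -> norm2 u <= M.
Proof.
move=> uL h; rewrite -(cvg_lim _ (parseval uL))//; apply: limr_le.
  by apply/cvg_ex; eexists; exact: parseval.
exact: nearW.
Qed.

(** A multiplier bounded by [K] on coefficients is bounded by [K] on L^2. Norm estimates for waves
    thus reduce to scalar ones, uniform in n. *)
Lemma norm2_le_mul u v (K : R) : L2 u -> L2 v -> 0 <= K ->
  (forall n, normc (ip u (psi n)) <= K * normc (ip v (psi n))) ->
  norm2 u <= K ^+ 2 * norm2 v.
Proof.
move=> uL vL K0 h; apply: norm2_le_coef => // N.
apply: (@le_trans _ _ (K ^+ 2 * partial2 (fun n => ip v (psi n)) N)); last first.
  by rewrite ler_wpM2l ?sqr_ge0// bessel.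
rewrite /partial2 mulr_sumr; apply: ler_sum => n _; rewrite -exprMn.
by rewrite ler_pXn2r// nnegrE ?mulr_ge0// normc_ge0.
Qed.

Lemma coef_eq_ae u v : L2 u -> L2 v -> (forall n, ip u (psi n) = ip v (psi n)) ->
  ae_eq_on Gam u v.
Proof.
move=> uL vL uv; apply/(ae_eq_norm2 mGam uL vL); apply/eqP; rewrite eq_le norm2_ge0 andbT.
apply: norm2_le_coef => [|N]; first exact: L2B.
by rewrite /partial2 big1// => n _; rewrite (L2innerB mGam)// uv subrr Normc.normc0 expr0n.
Qed.

(** Dominated convergence for series: beyond some N the coefficients contribute at most [K]^2 times
    the tail of [v], whatever t is, and the N remaining ones tend to 0 one by one. *)
Lemma tannery (T : Type) (F : set_system T) {FF : Filter F} (u_ : T -> V -> C) v (K : R) :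
  (\forall t \near F, L2 (u_ t)) -> L2 v -> 0 <= K ->
  (\forall t \near F, forall n, normc (ip (u_ t) (psi n)) <= K * normc (ip v (psi n))) ->
  (forall n, (fun t => normc (ip (u_ t) (psi n))) @ F --> (0 : R)) ->
  (fun t => norm2 (u_ t)) @ F --> (0 : R).
Proof.
move=> uL vL K0 dom pt; apply/cvgrPdist_lt => e e0.
have K1 : 0 < K ^+ 2 + 1 by rewrite ltr_wpDl ?sqr_ge0.
have d0 : 0 < e / 2 / (K ^+ 2 + 1) by rewrite !divr_gt0.
have /cvgrPdist_lt/(_ _ d0) [N _ hN] := parseval vL.
have {hN} := hN N (leqnn N); rewrite ger0_norm ?subr_ge0 ?bessel// => hN.
have fin : (fun t => partial2 (fun n => ip (u_ t) (psi n)) N) @ F --> (0 : R).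
  rewrite /partial2; elim: N {hN} => [|N IH].
    by under eq_fun do rewrite big_geq//; exact: cvg_cst.
  under eq_fun do rewrite big_nat_recr//=.
  by have := cvgD IH (cvgM (pt N) (pt N)); rewrite mulr0 addr0; apply.
have e20 : 0 < e / 2 by rewrite divr_gt0.
have /cvgrPdist_lt/(_ _ e20) := fin.
apply: filterS3 uL dom => t tL dt; rewrite !sub0r !normrN ger0_norm; last first.
  by apply: sumr_ge0 => n _; exact: sqr_ge0.
move=> ft; rewrite ger0_norm ?norm2_ge0//.
apply: (@le_lt_trans _ _ (partial2 (fun n => ip (u_ t) (psi n)) N +
   K ^+ 2 * (norm2 v - partial2 (fun n => ip v (psi n)) N))).
  apply: norm2_le_coef => // M.
  apply: (@le_trans _ _ (partial2 (fun n => ip (u_ t) (psi n)) (maxn N M))).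
    by apply: partial2_nd; exact: leq_maxr.
  rewrite {1}/partial2 (big_cat_nat (leq0n N) (leq_maxl N M))//= lerD2l.
  apply: (@le_trans _ _ (K ^+ 2 * \sum_(N <= n < maxn N M) normc (ip v (psi n)) ^+ 2)).
    rewrite mulr_sumr; apply: ler_sum => n _; rewrite -exprMn.
    by rewrite ler_pXn2r// nnegrE ?mulr_ge0// normc_ge0.
  rewrite ler_wpM2l ?sqr_ge0// lerBrDl.
  have := bessel (maxn N M) vL; by rewrite {1}/partial2 (big_cat_nat (leq0n N) (leq_maxl N M)).
have : (K ^+ 2 + 1) * (norm2 v - partial2 (fun n => ip v (psi n)) N) < e / 2.
  by rewrite mulrC -ltr_pdivlMr.
have : 0 <= norm2 v - partial2 (fun n => ip v (psi n)) N by rewrite subr_ge0 bessel.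
by set x := norm2 v - _ => x0 h; nra.
Qed.

(* Partial sums are regrouped along indices N k at which the tail is below 8^-k. *)
Lemma riesz_fischer (c : nat -> C) : cvgn (partial2 c) ->
  exists2 u, L2 u & forall n, ip u (psi n) = c n.
Proof.
move=> /cvg_ex[l cl].
have pl N : partial2 c N <= l.
  rewrite -(cvg_lim _ cl)//; apply: nondecreasing_cvgn_le; first exact: partial2_nd.
  by apply/cvg_ex; exists l.
have ex k : exists N, (k <= N)%N /\ forall M, (N <= M)%N -> l - partial2 c M <= 8^-1 ^+ k.
  have h8 : 0 < 8^-1 ^+ k :> R by rewrite exprn_gt0 ?invr_gt0.
  have /cvgrPdist_lt/(_ _ h8) [N _ hN] := cl.
  exists (maxn N k); split; first exact: leq_maxr.
  move=> M NM; have /= := hN M (leq_trans (leq_maxl _ _) NM).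
  by rewrite ger0_norm ?subr_ge0// => /ltW.
have [N0 hN0] := choice ex.
(* The running maximum makes the cut-offs monotone, so that [s k - s j] is the sum over one block of
   indices. *)
pose N k := (\max_(j < k.+1) N0 j)%N.
have N0N k : (N0 k <= N k)%N by apply: (@leq_bigmax _ (fun j : 'I_k.+1 => N0 j) ord_max).
have Nmono j k : (j <= k)%N -> (N j <= N k)%N.
  move=> jk; apply/bigmax_leqP => i _.
  have ik : (i < k.+1)%N by apply: leq_trans (ltn_ord i) _.
  exact: (@leq_bigmax _ (fun j : 'I_k.+1 => N0 j) (Ordinal ik)).
pose s k := psum (index_iota 0 (N k)) c.
have sL k : L2 (s k) by exact: L2_psum.
have sd j k : (j <= k)%N -> norm2 (fun y => s k y - s j y) <= 8^-1 ^+ j.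
  move=> jk; have -> : (fun y => s k y - s j y) = psum (index_iota (N j) (N k)) c.
    apply/funext => y; rewrite /s /psum (big_cat_nat (leq0n _) (Nmono _ _ jk))//.
    by rewrite addrAC subrr add0r.
  rewrite norm2_psum ?iota_uniq//; apply: le_trans (proj2 (hN0 j) (N j) (N0N j)).
  rewrite lerBrDl; apply: le_trans (pl (N k)).
  by rewrite [leRHS]/partial2 (big_cat_nat (leq0n _) (Nmono _ _ jk)).
(* Real completeness is applied with [P] the real part, then with [P] the imaginary part. *)
have part (P : C -> R) : (forall x y, P (x - y) = P x - P y) ->
    (forall x, P x ^+ 2 <= normc x ^+ 2) -> (forall u, L2 u -> sqint mu Gam (P \o u)) ->
    exists2 g, sqint mu Gam g &
      forall j, (\int[mu]_(y in Gam) (g y - P (s j y)) ^+ 2 <= 8^-1 ^+ j)%R.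
  move=> PB Pn Ps; apply: (@sqint_complete _ _ _ mu _ mGam (fun k => P \o s k)) => [k|j k jk].
    exact: Ps.
  apply: le_trans (sd _ _ jk).
  have L := L2B mGam (sL k) (sL j).
  apply: le_Rintegral => //.
  - have [_] := Ps _ L; congr (integrable _ _ _).
    by apply/funext => y /=; rewrite PB.
  - by have [] := L.
  - by move=> y _; rewrite /= -PB.
have [g gs gd] := part (@complex.Re R) (fun x y => etrans (Re_addc x (-y)) (congr1 _ (Re_oppc y)))
  (fun x => ltac:(rewrite normc_sqr lerDl sqr_ge0//)) (fun u uL => proj1 ((L2P mGam u).1 uL)).
have [h hs hd] := part (@complex.Im R) (fun x y => etrans (Im_addc x (-y)) (congr1 _ (Im_oppc y)))
  (fun x => ltac:(rewrite normc_sqr lerDr sqr_ge0//)) (fun u uL => proj2 ((L2P mGam u).1 uL)).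
pose u y := Complex (g y) (h y).
have uL : L2 u by apply/(L2P mGam).
exists u => // n; apply: normc_small_eq => e e0.
have us k : norm2 (fun y => u y - s k y) <= 2 * 8^-1 ^+ k.
  have Ls := L2B mGam uL (sL k).
  have [[_ i1] [_ i2]] := (L2P mGam _).1 Ls.
  have -> : norm2 (fun y => u y - s k y) =
     (\int[mu]_(y in Gam) (g y - complex.Re (s k y)) ^+ 2)%R +
     (\int[mu]_(y in Gam) (h y - complex.Im (s k y)) ^+ 2)%R.
    transitivity ((\int[mu]_(y in Gam) (complex.Re (u y - s k y)) ^+ 2)%R +
     (\int[mu]_(y in Gam) (complex.Im (u y - s k y)) ^+ 2)%R).
      rewrite -RintegralD//; apply: eq_Rintegral => y _.
      by rewrite normc_sqr.
    by congr (_ + _); apply: eq_Rintegral => y _; rewrite !complex_partsE.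
  by have := gd k; have := hd k; lra.
have e2 : 0 < e ^+ 2 / 2 by rewrite divr_gt0 ?exprn_gt0.
have : (fun k => 8^-1 ^+ k : R) @ \oo --> (0 : R).
  by apply: cvg_expr; rewrite ger0_norm ?invr_ge0// invf_lt1 ?ltr1n.
move=> /cvgrPdist_lt/(_ _ e2) [K _ hK].
(* An index above n ensures n < N k, so that the n-th coefficient of [s k] is already c n. *)
pose k := maxn K n.+1.
have /= := hK k (leq_maxl _ _); rewrite sub0r normrN ger0_norm ?exprn_ge0 ?invr_ge0// => h8.
have -> : c n = ip (s k) (psi n).
  rewrite coef_psum_uniq ?iota_uniq// mem_index_iota /=.
  have -> // : (n < N k)%N.
  apply: leq_trans (N0N k); apply: leq_trans (proj1 (hN0 k)).
  exact: leq_maxr.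
rewrite -(L2innerB mGam)//; apply: normc_le; first exact: ltW.
apply: le_trans (coef_le n (L2B mGam uL (sL k))) _.
by apply: le_trans (us k) _; lra.
Qed.

End orthonormal.

(** * Measurability of open sets of R^n *)

Section open_rV.
Context {R : realType} {n : nat}.

Lemma measurable_box_rV (A : 'I_n -> set R) : (forall i, measurable (A i)) ->
  measurable [set v : 'rV[R]_n | forall i, A i (v ord0 i)].
Proof.
move=> mA; rewrite (_ : [set v | _] = \bigcap_(i in [set: 'I_n]) (@rv_coord R n i @^-1` A i)).
  apply: fin_bigcap_measurable => // i _.
  by rewrite -[X in measurable X]setTI; apply: measurable_rv_coord => //; exact: mA.
by apply/seteqP; split=> v h i; [move=> _; exact: h | exact: (h i Logic.I)].
Qed.

(* An open set is the countable union of the rational cubes it contains. *)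
Lemma open_measurable_rV (G : set 'rV[R]_n) : open G -> measurable G.
Proof.
move=> oG.
pose box (p : 'rV[rat]_n * nat) : set 'rV[R]_n :=
  [set v | forall i, ball (ratr (p.1 ord0 i) : R) p.2.+1%:R^-1 (v ord0 i)].
have mbox p : measurable (box p).
  by apply: (measurable_box_rV (A := fun i => ball (ratr (p.1 ord0 i) : R) p.2.+1%:R^-1)) => i;
    exact: measurable_ball.
have -> : G = \bigcup_(p in [set p | box p `<=` G]) box p.
  apply/seteqP; split => [x Gx|x [p bp /bp]//].
  have /nbhs_ballP[e /= e0 eG] : nbhs x G by apply: open_nbhs_nbhs.
  have [k hk] : exists k : nat, k.+1%:R^-1 < e / 2.
    have e20 : 0 < (e / 2)^-1 by rewrite invr_gt0 divr_gt0.
    exists (Num.bound (e / 2)^-1); rewrite -[ltRHS]invrK ltf_pV2 ?posrE ?ltr0Sn//.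
    apply: lt_le_trans (archi_boundP (ltW e20)) _; by rewrite ler_nat.
  have k0 : 0 < k.+1%:R^-1 :> R by rewrite invr_gt0.
  have ex i : exists q : rat, ball (ratr q : R) k.+1%:R^-1 (x ord0 i).
    move: k0; set r : R := k.+1%:R^-1 => r0.
    have /rat_in_itvoo[q] : x ord0 i - r < x ord0 i + r by lra.
    rewrite in_itv /= => /andP[h1 h2]; exists q; rewrite -ball_normE /= ltr_norml.
    by apply/andP; split; lra.
  have [q hq] := choice ex.
  exists (\row_i q i, k); last by move=> i; rewrite mxE; exact: hq.
  move=> y hy; apply: eG; split => // i j /=; rewrite (ord1 i).
  have := hy j; have := hq j; rewrite mxE -!ball_normE /= => h1 h2.
  have -> : x ord0 j - y ord0 j = - (ratr (q j) - x ord0 j) + (ratr (q j) - y ord0 j) by ring.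
  apply: le_lt_trans (ler_normD _ _) _; rewrite normrN.
  apply: (lt_trans (ltrD h1 h2)); move: hk; by set r := _^-1 => hk; lra.
rewrite bigcup_mkcond; apply: countable_bigcupT_measurable => [|p]; first exact: countableP.
by case: ifP.
Qed.

End open_rV.

(** * The complex exponential *)

Section complex_exponential.
Context {R : realType}.
Local Notation C := R[i].
Local Notation normc := Normc.normc.
Implicit Types (z w : C) (p q : R).

Lemma cexpD z w : cexp (z + w) = cexp z * cexp w.
Proof.
by apply: complex_ext; rewrite !complex_partsE /cexp /= !complex_partsE expRD ?cosD ?sinD; ring.
Qed.

Lemma normc_cexp z : normc (cexp z) = expR (complex.Re z).
Proof.
apply/eqP; rewrite -(@eqrXn2 _ 2)// ?normc_ge0 ?expR_ge0// normc_sqr /= !exprMn -mulrDr.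
by rewrite cos2Dsin2 mulr1.
Qed.

Lemma cexp_neq0 z : cexp z != 0.
Proof.
apply/eqP => z0; have := normc_cexp z; rewrite z0 Normc.normc0 => /esym/eqP.
by rewrite gt_eqF ?expR_gt0.
Qed.

(** The localisation of q is what [sin_sub_sqr] exploits: it turns the error cos q - 1 into a
    multiple of |p|. *)
Lemma sin_mvt p : exists2 q, `|q| <= `|p| & sin p = cos q * p.
Proof.
have [p0|p0|->] := ltgtP p 0; last by exists 0; rewrite // sin0 mulr0.
- have [|q] := @MVT R sin cos p 0 p0.
    by apply: continuous_subspaceT; exact: continuous_sin.
  rewrite in_itv /= sin0 => /andP[h1 h2] e; exists q; last by lra.
  by rewrite !ltr0_norm//; lra.
- have [|q] := @MVT R sin cos 0 p p0.
    by apply: continuous_subspaceT; exact: continuous_sin.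
  rewrite in_itv /= sin0 => /andP[h1 h2] e; exists q; last by lra.
  by rewrite !gtr0_norm//; lra.
Qed.

Lemma sin_le_norm p : `|sin p| <= `|p|.
Proof.
have [q _ ->] := sin_mvt p; rewrite normrM ler_piMl// ler_norml cos_geN1 cos_le1 //.
Qed.

Lemma one_sub_cos p : 1 - cos p = 2 * sin (p / 2) ^+ 2.
Proof.
have {1}-> : p = p / 2 + p / 2 by field.
by rewrite cosD; have := cos2Dsin2 (p / 2); rewrite !expr2; lra.
Qed.

Lemma cos_sub1_sqr p : `|cos p - 1| <= p ^+ 2.
Proof.
rewrite distrC one_sub_cos ger0_norm; last by apply: mulr_ge0 => //; exact: sqr_ge0.
have h : sin (p / 2) ^+ 2 <= (p / 2) ^+ 2.
  by rewrite -(real_normK (num_real (sin _))) -(real_normK (num_real (p / 2))) ler_pXn2r ?nnegrE//; exact: sin_le_norm.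
have := sqr_ge0 p; move: h; rewrite expr_div_n; lra.
Qed.

Lemma cos_sub1_norm p : `|cos p - 1| <= `|p|.
Proof.
rewrite distrC one_sub_cos ger0_norm; last by apply: mulr_ge0 => //; exact: sqr_ge0.
have := sin_le_norm (p / 2); rewrite normf_div (ger0_norm (_ : 0 <= 2))// => h.
have h1 : `|sin (p / 2)| <= 1 by rewrite ler_norml sin_geN1 sin_le1.
by rewrite -(real_normK (num_real (sin _))) expr2; have := normr_ge0 (sin (p / 2)); nra.
Qed.

Lemma sin_sub_sqr p : `|sin p - p| <= p ^+ 2.
Proof.
have [q qp ->] := sin_mvt p.
have -> : cos q * p - p = (cos q - 1) * p by ring.
rewrite normrM -(real_normK (num_real p)) expr2 ler_wpM2r//.
exact: le_trans (cos_sub1_norm q) qp.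
Qed.

Lemma expR_le_norm p : expR p <= expR `|p|.
Proof. by rewrite ler_expR ler_norm. Qed.

Lemma expR_sub1_norm p : `|expR p - 1| <= `|p| * expR `|p|.
Proof.
have E1 : 1 <= expR `|p| by rewrite -[leLHS]expR0 ler_expR.
have h := expR_ge1Dx p; have := expR_ge1Dx (- p); rewrite expRN => h'.
have e0 := expR_gt0 p.
have {}h' : expR p - 1 <= p * expR p.
  have : (1 - p) * expR p <= 1 by rewrite -ler_pdivlMr// div1r.
  lra.
have [p0|p0] := leP 0 p.
  by rewrite (ger0_norm p0) in E1 *; rewrite ger0_norm//; lra.
by rewrite ltr0_norm in E1 *; rewrite // ler_norml; apply/andP; split; nra.
Qed.

(** The inequality 1 + x <= e^x at x = p and at x = - p gives 0 <= e^p - 1 - p <= p (e^p - 1). *)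
Lemma expR_taylor1 p : `|expR p - 1 - p| <= p ^+ 2 * expR `|p|.
Proof.
have h := expR_ge1Dx p; have := expR_ge1Dx (- p); rewrite expRN => h'.
have e0 := expR_gt0 p.
have {}h' : expR p - 1 <= p * expR p.
  have : (1 - p) * expR p <= 1 by rewrite -ler_pdivlMr// div1r.
  lra.
rewrite ger0_norm; last by lra.
apply: (@le_trans _ _ (p * (expR p - 1))); first by lra.
apply: le_trans (ler_norm _) _; rewrite normrM -(real_normK (num_real p)) expr2 -mulrA.
by rewrite ler_wpM2l// expR_sub1_norm.
Qed.

Lemma normc_le_parts z : normc z <= `|complex.Re z| + `|complex.Im z|.
Proof.
apply: normc_le; first by rewrite addr_ge0.
rewrite normc_sqr -(real_normK (num_real (complex.Re z))) -(real_normK (num_real (complex.Im z))).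
have := normr_ge0 (complex.Re z); have := normr_ge0 (complex.Im z); rewrite !expr2; nra.
Qed.

(** For z = p + i q the real part costs p^2 + q^2 and the imaginary part q^2 + |p| |q|, whence the
    factor 3. Only the real part enters the exponential, which the decay of the modes can absorb
    later. *)
Lemma cexp_taylor1 z :
  normc (cexp z - 1 - z) <= 3 * normc z ^+ 2 * expR `|complex.Re z|.
Proof.
case: z => p q; apply: le_trans (normc_le_parts _) _.
rewrite normc_sqr /=.
have E1 : 1 <= expR `|p| by rewrite -[leLHS]expR0 ler_expR.
have e0 := expR_gt0 p; have ee := expR_le_norm p.
have h1 : `|expR p * cos q - 1 - p| <= (q ^+ 2 + p ^+ 2) * expR `|p|.
  have -> : expR p * cos q - 1 - p = expR p * (cos q - 1) + (expR p - 1 - p) by ring.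
  apply: le_trans (ler_normD _ _) _; rewrite [leRHS]mulrDl; apply: lerD; last exact: expR_taylor1.
  by rewrite normrM (gtr0_norm e0) mulrC; apply: ler_pM => //; exact: cos_sub1_sqr.
have h2 : `|expR p * sin q - 0 - q| <= (q ^+ 2 + `|p| * `|q|) * expR `|p|.
  have -> : expR p * sin q - 0 - q = expR p * (sin q - q) + (expR p - 1) * q by ring.
  apply: le_trans (ler_normD _ _) _; rewrite [leRHS]mulrDl; apply: lerD.
    by rewrite normrM (gtr0_norm e0) mulrC; apply: ler_pM => //; exact: sin_sub_sqr.
  by rewrite normrM mulrAC ler_wpM2r// expR_sub1_norm.
apply: le_trans (lerD h1 h2) _; rewrite -mulrDl ler_wpM2r ?expR_ge0//.
have := sqr_ge0 (`|p| - `|q|).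
rewrite -(real_normK (num_real p)) -(real_normK (num_real q)) !expr2.
have := normr_ge0 p; have := normr_ge0 q; nra.
Qed.

(** With y = a t/2 the left side is 4/a^2 times (y e^(-y))^2, and y <= e^y. *)
Lemma sqr_mul_expR_le (a t : R) : 0 < a -> 0 <= t -> t ^+ 2 * expR (- (a * t)) <= 4 / a ^+ 2.
Proof.
move=> a0 t0; set y := a * t / 2.
have y0 : 0 <= y by rewrite /y divr_ge0// mulr_ge0// ltW.
have -> : - (a * t) = - (y + y) by rewrite /y; field.
rewrite expRN expRD ler_pdivrMr ?mulr_gt0 ?expR_gt0//.
have h := expR_ge1Dx y.
have -> : t ^+ 2 = 4 / a ^+ 2 * y ^+ 2 by rewrite /y; field; rewrite gt_eqF.
apply: ler_wpM2l; first by rewrite divr_ge0 ?sqr_ge0.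
by rewrite expr2; apply: ler_pM => //; lra.
Qed.

End complex_exponential.

(** * Modes in a half-guide *)

Section graph_of_laplacian.
Context {R : realType} {m : nat}.
Local Notation C := R[i].
Local Notation V := 'rV[R]_m.
Variables (Gam : set V) (mGam : measurable Gam) (dom : set (V -> C)).
Variables (lam : nat -> R) (psi : nat -> V -> C).
Hypotheses (hlap : selfadjoint_laplacian Gam dom) (heig : eigenbasis Gam dom lam psi).
Local Notation normc := Normc.normc.
Local Notation L2 := (L2 Gam).
Local Notation ip := (L2inner Gam).

Lemma conj_opp_real (a : R) : (- a%:C%C)^*%C = - a%:C%C :> C.
Proof. by apply: complex_ext; rewrite /= ?oppr0. Qed.

Lemma L2_psi n : L2 (psi n).
Proof. by have [] := dom_L2 hlap (eig_dom heig n). Qed.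

Lemma dom_is_L2 u : dom u -> L2 u.
Proof. by move=> du; have [] := dom_L2 hlap du. Qed.

(** The pair formed by [psi n] and - lam_n [psi n] lies in the graph of the operator, so
    [lap_selfadjoint] moves the Laplacian from [u] onto [psi n]. *)
Lemma coef_laplacian u l n : dom u -> L2 l -> weak_laplacian Gam u l ->
  ip l (psi n) = - (lam n)%:C%C * ip u (psi n).
Proof.
move=> du lL ul; have pL := L2_psi n.
have [h _] := lap_selfadjoint hlap pL (L2Z mGam (- (lam n)%:C%C) pL).
rewrite (h (conj (eig_dom heig n) (eig_eq heig n)) u l du lL ul).
have := L2inner_linr mGam (- (lam n)%:C%C) pL (L2_0 mGam) (dom_is_L2 du).
rewrite (_ : (fun y => _ * _ + 0) = (fun y => - (lam n)%:C%C * psi n y)); last first.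
  by apply/funext => y; rewrite addr0.
move=> ->; rewrite -[X in _ + X](L2inner_conj mGam (L2_0 mGam) (dom_is_L2 du)) L2inner0l//.
by rewrite conjc0 addr0 conj_opp_real.
Qed.

(* The operator is self-adjoint, hence its graph is closed: it contains every
   pair of L^2 functions whose coefficients are related by the eigenvalues. *)
Lemma dom_of_coef v w : L2 v -> L2 w ->
  (forall n, ip w (psi n) = - (lam n)%:C%C * ip v (psi n)) ->
  dom v /\ weak_laplacian Gam v w.
Proof.
move=> vL wL vw; apply/(lap_selfadjoint hlap vL wL) => u l du lL ul.
have uL := dom_is_L2 du.
pose s x N := psum psi (index_iota 0 N) (fun n => ip x (psi n)).
have sL x N : L2 (s x N) by exact: (L2_psum mGam L2_psi).
have scvg x : L2 x -> L2_cvg Gam \oo (s x) x.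
  move=> xL; suff -> : s x = (fun N y => \sum_(n < N) ip x (psi n) * psi n y).
    exact: eig_complete heig _ xL.
  by apply/funext => N; rewrite (psum_ord psi (fun n => ip x (psi n))).
(* On partial sums the symmetry identity holds term by term; both sides then converge to the two
   inner products to be compared. *)
have e N : ip (s l N) v = ip (s u N) w.
  rewrite !(ip_psum mGam L2_psi)//; apply: eq_bigr => n _.
  rewrite (coef_laplacian n du lL ul).
  rewrite -(L2inner_conj mGam vL (L2_psi n)) -(L2inner_conj mGam wL (L2_psi n)) vw conjcM.
  by rewrite conj_opp_real; ring.
apply: (@normc_dist _ _ \oo _ (fun N => ip (s l N) v)).
  by apply: (ip_cvg mGam) => //; [exact: nearW|exact: scvg].
under eq_fun do rewrite e.
by apply: (ip_cvg mGam) => //; [exact: nearW|exact: scvg].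
Qed.

End graph_of_laplacian.

(** * Scalar estimates for the exponential factors of the modes *)

Section decay.
Context {R : realType}.
Local Notation C := R[i].
Local Notation normc := Normc.normc.

Lemma Re_mul_real (z : C) (t : R) : complex.Re (z * t%:C%C) = complex.Re z * t.
Proof. by case: z => p q /=; rewrite mulr0 subr0. Qed.

(** The filter is kept abstract to serve both one-sided limits at the interface and the punctured
    neighbourhoods of difference quotients. *)
Lemma normc_cvg0_linear (F : set_system R) {FF : Filter F} (f : R -> C) (K : R) :
  (forall d, 0 < d -> \forall t \near F, `|t| < d) ->
  (\forall t \near F, normc (f t) <= K * `|t|) ->
  (fun t => normc (f t)) @ F --> (0 : R).
Proof.
move=> F0 fK; apply/cvgrPdist_lt => e e0.
have K1 : 0 < `|K| + 1 by rewrite ltr_wpDl.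
have d0 : 0 < e / (`|K| + 1) by rewrite divr_gt0.
apply: filterS2 (F0 _ d0) fK => t; rewrite ltr_pdivlMr// => td ft.
rewrite sub0r normrN ger0_norm ?normc_ge0//; apply: le_lt_trans ft _.
apply: le_lt_trans td; rewrite mulrC ler_wpM2l//.
by apply: le_trans (ler_norm _) _; rewrite lerDl.
Qed.

Lemma normc_le_Re (w : C) : `|complex.Re w| <= normc w.
Proof.
by rewrite -(@ler_pXn2r _ 2)// ?nnegrE ?normc_ge0// normc_sqr real_normK ?num_real// lerDl sqr_ge0.
Qed.

Lemma cexp_sub1_le (w : C) : normc w <= 1 -> normc (cexp w - 1) <= (1 + 3 * expR 1) * normc w.
Proof.
move=> w1; have -> : cexp w - 1 = (cexp w - 1 - w) + w by ring.
apply: le_trans (normc_triangle _ _) _.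
have h := cexp_taylor1 w; have w0 := normc_ge0 w.
have e1 : expR `|complex.Re w| <= expR 1 by rewrite ler_expR; apply: le_trans (normc_le_Re w) w1.
have : 3 * normc w ^+ 2 * expR `|complex.Re w| <= 3 * normc w * expR 1.
  apply: ler_pM => //.
    by rewrite mulr_ge0// sqr_ge0.
  by rewrite ler_wpM2l// expr2 ler_piMl.
lra.
Qed.

Lemma cexp_cvg1 (F : set_system R) {FF : Filter F} (a z : C) :
  (forall d, 0 < d -> \forall t \near F, `|t| < d) ->
  (fun t : R => normc (a * (cexp (z * t%:C%C) - 1))) @ F --> (0 : R).
Proof.
move=> F0.
apply: (@normc_cvg0_linear _ _ _ (normc a * ((1 + 3 * expR 1) * normc z))) => //.
have z1 : 0 < normc z + 1 by rewrite ltr_wpDl ?normc_ge0.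
have d0 : 0 < (normc z + 1)^-1 by rewrite invr_gt0.
apply: filterS (F0 _ d0) => t td.
rewrite Normc.normcM -mulrA ler_wpM2l ?normc_ge0//.
rewrite -mulrA -normc_real -Normc.normcM; apply: cexp_sub1_le.
rewrite Normc.normcM normc_real; apply: (@le_trans _ _ ((normc z + 1) * `|t|)).
  by rewrite ler_wpM2r// lerDl.
by rewrite mulrC -ler_pdivlMr// div1r ltW.
Qed.

Lemma dnbhs0_small (d : R) : 0 < d -> \forall h \near (0 : R)^', h != 0 /\ `|h| < d.
Proof.
move=> d0; near=> h; split; first by near: h; exact: nbhs_dnbhs_neq.
by near: h; exact: dnbhs0_lt.
Unshelve. all: by end_near.
Qed.

(** The error is linear in h but carries |z|^2 and a possible growth e^(|Re z| |h|). Neither is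
    bounded along the modes; both are to be absorbed by the decay of the mode itself. *)
Lemma quot_taylor (z : C) (h : R) : h != 0 ->
  normc ((h^-1)%:C%C * (cexp (z * h%:C%C) - 1) - z) <=
  3 * `|h| * (normc z ^+ 2 * expR `|complex.Re z * h|).
Proof.
move=> h0.
have -> : (h^-1)%:C%C * (cexp (z * h%:C%C) - 1) - z =
    (h^-1)%:C%C * (cexp (z * h%:C%C) - 1 - z * h%:C%C).
  rewrite [in RHS]mulrBr; congr (_ - _).
  by rewrite mulrCA -rmorphM mulVf// mulr1.
rewrite Normc.normcM normc_real normfV mulrC ler_pdivrMr ?normr_gt0//.
apply: le_trans (cexp_taylor1 _) _.
rewrite Normc.normcM normc_real exprMn Re_mul_real.
by rewrite le_eqVlt; apply/orP; left; apply/eqP; ring.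
Qed.

Lemma cexp_shift (z : C) (x h : R) :
  cexp (z * (x + h)%:C%C) = cexp (z * x%:C%C) * cexp (z * h%:C%C).
Proof. by rewrite -cexpD -mulrDr -rmorphD. Qed.

Lemma cexp_quotient_cvg (z c : C) (x : R) :
  (fun h : R => normc ((h^-1)%:C%C * (c * cexp (z * (x + h)%:C%C) - c * cexp (z * x%:C%C))
     - z * (c * cexp (z * x%:C%C)))) @ (0 : R)^' --> (0 : R).
Proof.
set A := c * cexp (z * x%:C%C).
apply: (@normc_cvg0_linear _ _ _ (normc A * (3 * (normc z ^+ 2 * expR `|complex.Re z|)))).
  by move=> d d0; apply: filterS (dnbhs0_small d0) => h [].
apply: filterS (dnbhs0_small ltr01) => h [h0 h1].
have -> : (h^-1)%:C%C * (c * cexp (z * (x + h)%:C%C) - A) - z * A =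
    A * ((h^-1)%:C%C * (cexp (z * h%:C%C) - 1) - z).
  by rewrite cexp_shift /A; ring.
rewrite Normc.normcM -mulrA ler_wpM2l ?normc_ge0//.
apply: le_trans (quot_taylor z h0) _.
rewrite mulrAC ler_wpM2r// ler_wpM2l// ler_wpM2l ?sqr_ge0// ler_expR normrM.
by rewrite ler_piMr// ltW.
Qed.

End decay.

Section half_guide.
Context {R : realType} {m : nat}.
Local Notation C := R[i].
Local Notation V := 'rV[R]_m.
Variables (Gam : set V) (mGam : measurable Gam) (dom : set (V -> C)).
Variables (lam : nat -> R) (psi : nat -> V -> C).
Hypotheses (hlap : selfadjoint_laplacian Gam dom) (heig : eigenbasis Gam dom lam psi).
Local Notation normc := Normc.normc.
Local Notation L2 := (L2 Gam).
Local Notation norm2 := (@norm2 R m Gam).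
Local Notation ip := (L2inner Gam).

Variables (sg k B : R) (beta : nat -> C).
Hypothesis sg1 : sg ^+ 2 = 1.
(** Modes become e^(z_n x), and the two half-guides are treated at once: what they have in common is
    the decay away from the interface, the bound on Im z_n and the value of z_n^2 assumed below. *)
Definition exponent n : C := - 'i%C * beta n.
Local Notation z := exponent.

(* With sg = 1 or sg = -1, the right or the left half-guide. *)
Definition half_line : set R := [set x | 0 < sg * x].
Hypothesis z_decay : forall n, sg * complex.Re (z n) <= 0.
Hypothesis z_Im : forall n, `|complex.Im (z n)| <= B.
Hypothesis z_sqr : forall n, z n ^+ 2 = (lam n - k ^+ 2)%:C%C.

Let psiL := L2_psi hlap heig.
Let ortho := eig_orthonormal heig.
Let complete := @eig_complete _ _ _ _ _ _ heig.

(** Square-summability of [c] is deliberately absent: it amounts to a trace at x = 0, while the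
    differential equation concerns only the inside of the half-guide. *)
Definition modal (u : guide_fun) (c : nat -> C) : Prop :=
  forall x, half_line x ->
    L2 (u x) /\ forall n, ip (u x) (psi n) = c n * cexp (z n * x%:C%C).

Lemma normc_mode n (x : R) : half_line x ->
  normc (cexp (z n * x%:C%C)) = expR (- (`|x| * `|complex.Re (z n)|)).
Proof.
move=> x0; rewrite normc_cexp Re_mul_real; congr expR.
have e : x * complex.Re (z n) = (sg * x) * (sg * complex.Re (z n)).
  by rewrite mulrACA -expr2 sg1 mul1r.
rewrite -normrM [LHS]mulrC ler0_norm ?opprK//.
by rewrite e pmulr_rle0.
Qed.

Lemma normc_mode_le1 n (x : R) : half_line x -> normc (cexp (z n * x%:C%C)) <= 1.
Proof. by move=> x0; rewrite normc_mode// -[leRHS]expR0 ler_expR oppr_le0 mulr_ge0. Qed.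

(** Uniform in n: the imaginary part is bounded by [B], and the square of the real part, possibly
    large, is absorbed by the exponential. *)
Lemma exponent_decay n (a : R) : 0 < a ->
  normc (z n) ^+ 2 * expR (- (a * `|complex.Re (z n)|)) <= B ^+ 2 + 4 / a ^+ 2.
Proof.
move=> a0; rewrite normc_sqr mulrDl addrC; apply: lerD.
  apply: (@le_trans _ _ (complex.Im (z n) ^+ 2 * 1)).
    by rewrite ler_wpM2l ?sqr_ge0// -[leRHS]expR0 ler_expR oppr_le0 mulr_ge0// ltW.
  have := z_Im n; rewrite mulr1 -(real_normK (num_real (complex.Im _))) => h.
  by rewrite ler_pXn2r// nnegrE//; exact: le_trans h.
by rewrite -(real_normK (num_real (complex.Re _))); exact: sqr_mul_expR_le.
Qed.

Lemma half_line_half x : half_line x -> half_line (x / 2).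
Proof. by rewrite /half_line /= mulrA => x0; rewrite divr_gt0. Qed.

Lemma half_line_neq0 x : half_line x -> 0 < `|x|.
Proof. by rewrite normr_gt0 => h; apply: contraTneq h => ->; rewrite mulr0 ltxx. Qed.

(** One factor is kept with [c] to form a coefficient of the L^2 slice at x/2, the other provides
    decay. *)
Lemma mode_split n (x : R) (c : C) :
  c * cexp (z n * x%:C%C) = (c * cexp (z n * (x / 2)%:C%C)) * cexp (z n * (x / 2)%:C%C).
Proof. by rewrite -mulrA -cexp_shift -splitr. Qed.

Lemma is_cvg_partial2 (c : nat -> C) (M : R) : (forall N, partial2 c N <= M) -> cvgn (partial2 c).
Proof.
move=> h; apply: nondecreasing_is_cvgn; first exact: partial2_nd.
by exists M => _ [N _ <-].
Qed.

Lemma is_cvg_partial2_mul u (c : nat -> C) (K : R) : L2 u -> 0 <= K ->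
  (forall n, normc (c n) <= K * normc (ip u (psi n))) -> cvgn (partial2 c).
Proof.
move=> uL K0 h; apply: (@is_cvg_partial2 _ (K ^+ 2 * norm2 u)) => N.
apply: (@le_trans _ _ (K ^+ 2 * partial2 (fun n => ip u (psi n)) N)); last first.
  by rewrite ler_wpM2l ?sqr_ge0// (bessel mGam psiL ortho complete).
rewrite /partial2 mulr_sumr; apply: ler_sum => n _; rewrite -exprMn.
by rewrite ler_pXn2r// nnegrE ?mulr_ge0// normc_ge0.
Qed.

(** Multiplication by z_n is x-differentiation on coefficients. Its result is in L^2 at x because it
    is a bounded multiplier of the slice at x/2; Riesz-Fischer supplies the function. *)
Lemma modal_mul u c : modal u c -> exists v, modal v (fun n => z n * c n).
Proof.
move=> uc.
have ex x : exists w, half_line x ->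
    L2 w /\ forall n, ip w (psi n) = z n * c n * cexp (z n * x%:C%C).
  have [Ix|nIx] := pselect (half_line x); last by exists (fun=> 0).
  have [uL ux] := uc _ (half_line_half Ix).
  have a0 := half_line_neq0 (half_line_half Ix).
  set a := `|x / 2| in a0.
  (* With E <= 1 the modulus of the spare factor, |z| <= 1 + |z|^2 gives |z| E <= 1 + |z|^2 E, and
     [exponent_decay] bounds the last term. *)
  have K0 : 0 <= 1 + (B ^+ 2 + 4 / a ^+ 2) by rewrite !addr_ge0 ?sqr_ge0// divr_ge0 ?sqr_ge0.
  have cv : cvgn (partial2 (fun n => z n * c n * cexp (z n * x%:C%C))).
    apply: (is_cvg_partial2_mul uL K0) => n.
    rewrite -mulrA mode_split ux; set D := c n * _; set e := cexp _.
    rewrite (_ : z n * (D * e) = (z n * e) * D); last by ring.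
    rewrite Normc.normcM ler_wpM2r ?normc_ge0// Normc.normcM (normc_mode _ (half_line_half Ix)) -/a.
    have := exponent_decay n a0.
    set E := expR _; have E0 : 0 <= E by exact: expR_ge0.
    have E1 : E <= 1 by rewrite /E -[leRHS]expR0 ler_expR oppr_le0 mulr_ge0// ltW.
    have := sqr_ge0 (normc (z n) - 1); have := normc_ge0 (z n); rewrite !expr2; nra.
  by have [w wL wc] := riesz_fischer mGam psiL ortho cv; exists w.
by have [v hv] := choice ex; exists v => x; exact: hv.
Qed.

Lemma half_line_near (x : R) : half_line x ->
  \forall h \near (0 : R)^', [/\ h != 0, `|h| < `|x| / 4 & half_line (x + h)].
Proof.
move=> x0; have x4 : 0 < `|x| / 4 by rewrite divr_gt0// half_line_neq0.
apply: filterS (dnbhs0_small x4) => h [h0 hx]; split => //.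
move: x0; rewrite /half_line /= mulrDr => x0.
have sn : `|sg| = 1 by apply/eqP; rewrite -(@eqrXn2 _ 2)// real_normK ?num_real// sg1 expr1n.
have xs : `|x| = sg * x by rewrite -[LHS]mul1r -sn -normrM gtr0_norm.
have : `|sg * h| < sg * x / 4 by rewrite normrM sn mul1r -xs.
by rewrite ltr_norml => /andP[]; lra.
Qed.

(** Relative to the slice at x/2, the error of the n-th difference quotient is at most K |h|, with K
    independent of n. *)
Lemma modal_dx u v c : modal u c -> modal v (fun n => z n * c n) -> dx_on Gam half_line u v.
Proof.
move=> uc vc x Ix; have [vL vx] := vc _ Ix; split => //.
have [uL ux] := uc _ Ix; have Ih := half_line_half Ix.
have [u2L ux2] := uc _ Ih.
have x4 : 0 < `|x| / 4 by rewrite divr_gt0// half_line_neq0.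
pose q h y := (h^-1)%:C%C * (u (x + h) y - u x y).
have qL : \forall h \near (0 : R)^', L2 (q h).
  apply: filterS (half_line_near Ix) => h [_ _ Ixh].
  by have [uhL _] := uc _ Ixh; apply: (L2Z mGam); exact: (L2B mGam).
apply/(L2_cvgP mGam qL vL).
(* The mode at x/2 decays like e^(-|x| |Re z|/2), and for |h| < |x|/4 the Taylor remainder grows at
   most like e^(|x| |Re z|/4). The rate left over is |x|/4, at which [exponent_decay] is applied. *)
set K := 3 * (B ^+ 2 + 4 / (`|x| / 4) ^+ 2).
have K0 : 0 <= K by rewrite mulr_ge0// addr_ge0 ?divr_ge0 ?sqr_ge0.
have bnd : \forall h \near (0 : R)^', norm2 (fun y => q h y - v x y) <= (K * `|h|) ^+ 2 * norm2 (u (x / 2)).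
  apply: filterS2 qL (half_line_near Ix) => h qhL [h0 hx Ixh].
  have [uhL uxh] := uc _ Ixh.
  apply: (norm2_le_mul mGam psiL ortho complete) => //; first exact: (L2B mGam).
    by rewrite mulr_ge0.
  move=> n; rewrite (L2innerB mGam qhL vL (psiL n)).
  rewrite /q (L2innerZ mGam _ (L2B mGam uhL uL) (psiL n)) (L2innerB mGam uhL uL (psiL n)).
  rewrite vx ux uxh ux2.
  set D := c n * cexp (z n * (x / 2)%:C%C).
  have -> : (h^-1)%:C%C * (c n * cexp (z n * (x + h)%:C%C) - c n * cexp (z n * x%:C%C)) -
      z n * c n * cexp (z n * x%:C%C) =
      (cexp (z n * (x / 2)%:C%C) * ((h^-1)%:C%C * (cexp (z n * h%:C%C) - 1) - z n)) * D.
    rewrite cexp_shift /D.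
    have -> : cexp (z n * x%:C%C) = cexp (z n * (x / 2)%:C%C) * cexp (z n * (x / 2)%:C%C).
      by have := mode_split n x 1; rewrite !mul1r.
    by ring.
  rewrite Normc.normcM ler_wpM2r ?normc_ge0// Normc.normcM (normc_mode _ Ih).
  have qt := quot_taylor (z n) h0.
  apply: le_trans (ler_wpM2l (expR_ge0 _) qt) _.
  rewrite mulrCA (_ : K * `|h| = 3 * `|h| * (B ^+ 2 + 4 / (`|x| / 4) ^+ 2)); last by rewrite /K; ring.
  rewrite ler_wpM2l ?mulr_ge0//; apply: le_trans (exponent_decay n x4).
  rewrite mulrCA ler_wpM2l ?sqr_ge0// -expRD ler_expR.
  rewrite (normrM (complex.Re _)) normf_div (ger0_norm (_ : 0 <= 2))//.
  by have := normr_ge0 (complex.Re (z n)); have := normr_ge0 h; nra.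
apply/cvgrPdist_lt => e e0; set N := norm2 (u (x / 2)) in bnd.
have N0 : 0 <= N by exact: norm2_ge0.
have M0 : 0 < K ^+ 2 * N + 1 by rewrite ltr_wpDl// mulr_ge0 ?sqr_ge0.
have d0 : 0 < e / (K ^+ 2 * N + 1) by rewrite divr_gt0.
apply: filterS3 bnd (dnbhs0_small ltr01) (dnbhs0_small d0) => h hb [_ h1] [_].
rewrite ltr_pdivlMr// => he; rewrite sub0r normrN ger0_norm ?norm2_ge0//.
apply: le_lt_trans hb _; apply: le_lt_trans he.
have := normr_ge0 h; have KN : 0 <= K ^+ 2 * N by rewrite mulr_ge0 ?sqr_ge0.
rewrite (_ : (K * `|h|) ^+ 2 * N = `|h| * (`|h| * (K ^+ 2 * N))); last by ring.
move=> hh; rewrite ler_wpM2l//; nra.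
Qed.

Lemma modal_pde u c : modal u c ->
  helmholtz Gam half_line k u /\ boundary_condition dom half_line u.
Proof.
move=> uc; have [v vc] := modal_mul uc; have [w wc] := modal_mul vc.
(* The equation forces the transverse Laplacian to be - w - k^2 u. Since z_n^2 + k^2 = lam_n,
   [dom_of_coef] gives at once this Laplacian and the boundary condition. *)
have op x : half_line x -> let l := fun y => -1 * w x y + - (k ^+ 2)%:C%C * u x y in
    L2 l /\ dom (u x) /\ weak_laplacian Gam (u x) l.
  move=> Ix l; have [uL ux] := uc _ Ix; have [wL wx] := wc _ Ix.
  have kL : L2 (fun y => - (k ^+ 2)%:C%C * u x y) by exact: L2Z.
  have lL : L2 l by exact: L2_lin.
  split => //; apply: (dom_of_coef mGam hlap heig) => // n.
  rewrite (L2inner_lin mGam _ wL kL (psiL n)) (L2innerZ mGam _ uL (psiL n)) wx ux.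
  have -> : (lam n)%:C%C = z n ^+ 2 + (k ^+ 2)%:C%C by rewrite z_sqr -rmorphD subrK.
  by ring.
split; last by move=> x Ix; have [_ []] := op x Ix.
exists v, w; split; [exact: modal_dx uc vc|exact: modal_dx vc wc|move=> x Ix].
have [lL [_ ul]] := op x Ix; exists (fun y => -1 * w x y + - (k ^+ 2)%:C%C * u x y).
by split => //; apply: aeW => y _; ring.
Qed.

Lemma modal_radiating u c : modal u c -> radiating Gam psi half_line beta u.
Proof.
move=> uc; exists c => x Ix; have [uL ux] := uc _ Ix.
suff -> : (fun N y => \sum_(n < N) c n * guide_mode psi (beta n) n x y) =
    (fun N y => \sum_(n < N) ip (u x) (psi n) * psi n y) by exact: complete.
apply/funext => N; apply/funext => y; apply: eq_bigr => n _.
by rewrite ux /guide_mode mulrCA mulrC.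
Qed.

(** The coefficient of index k' of the partial sums is stationary once N > k', so the L^2 limit has
    the same one. The boundary condition ensures that the slices are in L^2. *)
Lemma radiating_modal u : boundary_condition dom half_line u ->
  radiating Gam psi half_line beta u -> exists c, modal u c.
Proof.
move=> bu [c hc]; exists c => x Ix; have uL := dom_is_L2 hlap (bu x Ix); split => // k'.
pose d n := c n * cexp (z n * x%:C%C).
have e N : (fun y => \sum_(n < N) c n * guide_mode psi (beta n) n x y) = psum psi (index_iota 0 N) d.
  apply/funext => y; rewrite /psum big_mkord; apply: eq_bigr => n _.
  by rewrite /d /guide_mode mulrCA mulrC.
have := hc x Ix; have -> : (fun N y => \sum_(n < N) c n * guide_mode psi (beta n) n x y) =
    (fun N => psum psi (index_iota 0 N) d) by apply/funext => N; exact: e.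
have sL N := L2_psum mGam psiL (index_iota 0 N) d.
move=> /(ip_cvg mGam (nearW _ sL) uL (psiL k')) h.
apply: (@normc_dist _ _ \oo _ _ _ _ h).
apply: cvg_near_cst; exists k'.+1 => // N /= kN.
rewrite (coef_psum_uniq mGam psiL ortho) ?iota_uniq// mem_index_iota kN /=.
by rewrite subrr Normc.normc0.
Qed.

(** * Limits at the interface *)

Section at_interface.
Context (F : set_system R) {FF : ProperFilter F}.
Hypothesis F_half_line : \forall x \near F, half_line x.
Hypothesis F0 : forall d, 0 < d -> \forall x \near F, `|x| < d.

(** The factors e^(z_n x) - 1 tend to 0 for each n but not uniformly in n. They are bounded by 2,
    which gives the domination needed by [tannery]. *)
Lemma modal_trace u c t : modal u c -> L2 t -> (forall n, ip t (psi n) = c n) ->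
  L2_cvg Gam F u t.
Proof.
move=> uc tL tc.
have uL : \forall x \near F, L2 (u x) by apply: filterS F_half_line => x /uc[].
have e x n : half_line x -> ip (fun y => u x y - t y) (psi n) = c n * (cexp (z n * x%:C%C) - 1).
  move=> Ix; have [uxL ux] := uc _ Ix.
  by rewrite (L2innerB mGam uxL tL (psiL n)) ux tc mulrBr mulr1.
apply/(L2_cvgP mGam uL tL).
apply: (tannery mGam psiL ortho complete (v := t) (K := 2)) => //.
- by apply: filterS uL => x uxL; exact: L2B.
- apply: filterS F_half_line => x Ix n; rewrite e// tc Normc.normcM mulrC.
  rewrite ler_wpM2r ?normc_ge0//; apply: le_trans (normc_triangle _ _) _.
  by rewrite normc_opp Normc.normc1; have := normc_mode_le1 n Ix; lra.
- move=> n; apply: cvg_trans (cexp_cvg1 (c n) (z n) F0).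
  by apply: near_eq_cvg; apply: filterS F_half_line => x Ix; rewrite e.
Qed.

(** The sequence z_n c_n need not be square-summable, so convergence is established for each n
    separately; the sign is that of the normal - e_x. *)
Lemma modal_normal_trace u c : modal u c ->
  normal_trace Gam psi half_line F u (fun n => - (z n * c n)).
Proof.
move=> uc; have [v vc] := modal_mul uc; exists v; first exact: modal_dx uc vc.
move=> n; apply: cvg_trans (cexp_cvg1 (- (z n * c n)) (z n) F0).
apply: near_eq_cvg; apply: filterS F_half_line => x Ix.
by have [_ ->] := vc _ Ix; congr normc; ring.
Qed.

Lemma trace_coef u c t n : modal u c -> interface_trace Gam F u t ->
  ip t (psi n) = c n.
Proof.
move=> uc [tL ut].
have uL : \forall x \near F, L2 (u x) by apply: filterS F_half_line => x /uc[].
apply: (@normc_dist _ _ F _ (fun x => ip (u x) (psi n))).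
  exact: (ip_cvg mGam).
apply: cvg_trans (cexp_cvg1 (c n) (z n) F0).
apply: near_eq_cvg; apply: filterS F_half_line => x Ix.
by have [_ ->] := uc _ Ix; congr normc; ring.
Qed.

(** [normal_trace] provides some derivative [v]; its coefficients are forced by those of the
    difference quotients. *)
Lemma coef_dx u v c x n : modal u c -> dx_on Gam half_line u v -> half_line x ->
  ip (v x) (psi n) = z n * (c n * cexp (z n * x%:C%C)).
Proof.
move=> uc uv Ix; have [vL qv] := uv _ Ix; have [uL ux] := uc _ Ix.
pose q h y := (h^-1)%:C%C * (u (x + h) y - u x y).
have qc h : half_line (x + h) -> L2 (q h) /\ ip (q h) (psi n) =
    (h^-1)%:C%C * (c n * cexp (z n * (x + h)%:C%C) - c n * cexp (z n * x%:C%C)).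
  move=> Ixh; have [uhL uxh] := uc _ Ixh; have dL := L2B mGam uhL uL.
  split; first exact: L2Z.
  by rewrite /q (L2innerZ mGam _ dL (psiL n)) (L2innerB mGam uhL uL (psiL n)) ux uxh.
have qL : \forall h \near (0 : R)^', L2 (q h).
  by apply: filterS (half_line_near Ix) => h [_ _ /qc[]].
apply: (@normc_dist _ _ (0 : R)^' _ (fun h => ip (q h) (psi n))).
  exact: (ip_cvg mGam).
apply: cvg_trans (cexp_quotient_cvg (z n) (c n) x).
apply: near_eq_cvg; apply: filterS (half_line_near Ix) => h [_ _ /qc[_ ->]].
by [].
Qed.

Lemma normal_trace_coef u c b n : modal u c -> normal_trace Gam psi half_line F u b ->
  b n = - (z n * c n).
Proof.
move=> uc [v uv hb]; apply: (@normc_dist _ _ F _ (fun x => - ip (v x) (psi n))); first exact: hb.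
apply: cvg_trans (cexp_cvg1 (- (z n * c n)) (z n) F0).
apply: near_eq_cvg; apply: filterS F_half_line => x Ix.
by rewrite (coef_dx n uc uv Ix); congr normc; ring.
Qed.

End at_interface.

Lemma exists_modal (c : nat -> C) : cvgn (partial2 c) -> exists u, modal u c.
Proof.
move=> /(riesz_fischer mGam psiL ortho)[t tL tc].
have ex x : exists w, half_line x -> L2 w /\ forall n, ip w (psi n) = c n * cexp (z n * x%:C%C).
  have [Ix|nIx] := pselect (half_line x); last by exists (fun=> 0).
  have cv : cvgn (partial2 (fun n => c n * cexp (z n * x%:C%C))).
    apply: (is_cvg_partial2_mul tL ler01) => n.
    by rewrite tc Normc.normcM mulrC ler_wpM2r ?normc_ge0// normc_mode_le1.
  by have [w wL wc] := riesz_fischer mGam psiL ortho cv; exists w.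
by have [u hu] := choice ex; exists u => x; exact: hu.
Qed.

Lemma modal_ae_eq u v c : modal u c -> modal v c ->
  forall x, half_line x -> ae_eq_on Gam (u x) (v x).
Proof.
move=> uc vc x Ix; have [uL ux] := uc _ Ix; have [vL vx] := vc _ Ix.
by apply: (coef_eq_ae mGam psiL ortho complete) => // n; rewrite ux vx.
Qed.

(** The coefficients are written as sums because [r] may repeat an index, as is allowed in
    [closed_span]. *)
Lemma modal_lincomb (r : seq nat) (c : nat -> C) :
  modal (fun x y => \sum_(n <- r) c n * guide_mode psi (beta n) n x y)
    (fun k => \sum_(n <- r) c n * (n == k)%:R).
Proof.
move=> x _; have -> : (fun y => \sum_(n <- r) c n * guide_mode psi (beta n) n x y) =
    psum psi r (fun n => c n * cexp (z n * x%:C%C)).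
  by apply/funext => y; apply: eq_bigr => n _; rewrite /guide_mode mulrCA mulrC.
split => [|k']; first exact: L2_psum.
rewrite (coef_psum mGam psiL ortho) mulr_suml; apply: eq_bigr => n _.
by case: eqP => [->|_]; rewrite ?mulr1 ?mulr0 ?mul0r.
Qed.

Lemma modal_mode n : modal (guide_mode psi (beta n) n) (fun k => (n == k)%:R).
Proof.
move=> x _; have -> : guide_mode psi (beta n) n x = (fun y => cexp (z n * x%:C%C) * psi n y).
  by apply/funext => y; rewrite mulrC.
split => [|k']; first exact: L2Z.
rewrite (L2innerZ mGam _ (psiL n) (psiL k')) ortho.
by case: eqP => [->|_]; rewrite ?mulr1 ?mul1r ?mulr0 ?mul0r.
Qed.

(** The exponential factors have modulus at most 1, so an estimate at the interface holds uniformly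
    in x. *)
Lemma modal_sub_le u w a b t : modal u a -> modal w b -> L2 t ->
  (forall n, ip t (psi n) = a n - b n) ->
  forall x, half_line x -> norm2 (fun y => u x y - w x y) <= norm2 t.
Proof.
move=> ua wb tL tab x Ix; have [uL ux] := ua _ Ix; have [wL wx] := wb _ Ix.
rewrite -[leRHS]mul1r -(expr1n _ 2).
apply: (norm2_le_mul mGam psiL ortho complete) => //; first exact: L2B.
move=> n; rewrite (L2innerB mGam uL wL (psiL n)) ux wx -mulrBl tab Normc.normcM mulrC.
by rewrite ler_wpM2r ?normc_ge0// normc_mode_le1.
Qed.

(** A partial converse of [modal_sub_le]: for given N, a slice close enough to the interface leaves
    the first N factors with squared modulus at least 1/2. The resulting bound no longer depends on
    N. *)
Lemma modal_sub_partial2 u w a b (M : R) : modal u a -> modal w b ->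
  (forall x, half_line x -> norm2 (fun y => u x y - w x y) <= M) ->
  forall N, partial2 (fun n => a n - b n) N <= 2 * M.
Proof.
move=> ua wb h N.
pose S := \sum_(0 <= n < N) `|complex.Re (z n)|.
have S0 : 0 <= S by exact: sumr_ge0.
have reS n : (n < N)%N -> `|complex.Re (z n)| <= S.
  by move=> nN; rewrite /S big_mkord (bigD1 (Ordinal nN))//= lerDl; exact: sumr_ge0.
(* This distance gives d |Re z_n| <= 1/4 for n < N, so each factor is at least 3/4 and its square
   exceeds 1/2; the 1 added to S guards against S = 0. *)
pose d := (4 * (S + 1))^-1.
have S1 : 0 < S + 1 by rewrite ltr_wpDl.
have d0 : 0 < d by rewrite invr_gt0 mulr_gt0.
have dS : d * S <= 4^-1.
  rewrite /d invfM -mulrA ler_piMr ?invr_ge0// mulrC ler_pdivrMr//.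
  by rewrite mul1r lerDl.
have sn : `|sg| = 1 by apply/eqP; rewrite -(@eqrXn2 _ 2)// real_normK ?num_real// sg1 expr1n.
have Ix : half_line (sg * d) by rewrite /half_line /= mulrA -expr2 sg1 mul1r.
have [uL ux] := ua _ Ix; have [wL wx] := wb _ Ix.
have := le_trans (bessel mGam psiL ortho complete N (L2B mGam uL wL)) (h _ Ix).
rewrite -(@ler_pM2l _ 2)//; apply: le_trans.
rewrite /partial2 mulr_sumr; apply: ler_sum_nat => n /andP[_ nN].
rewrite (L2innerB mGam uL wL (psiL n)) ux wx -mulrBl Normc.normcM exprMn mulrCA.
rewrite -[leLHS]mulr1 ler_wpM2l ?sqr_ge0// normc_mode// normrM sn mul1r (gtr0_norm d0).
have e1 := expR_ge1Dx (- (d * `|complex.Re (z n)|)).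
have e2 : d * `|complex.Re (z n)| <= 4^-1.
  by apply: le_trans dS; rewrite ler_wpM2l ?reS// ltW.
set E := expR _ in e1 *; have e3 : 3 / 4 <= E by lra.
rewrite expr2; nra.
Qed.

End half_guide.

(** * The dispersion relation *)

#[local] Arguments exponent : simpl never.

Section propagation_constants.
Context {R : realType}.
Local Notation C := R[i].
Local Notation normc := Normc.normc.
Variables (kp km kappa : R) (lam : nat -> R).
Hypotheses (hkp : 0 < kp) (hkm : 0 < km) (hkappa : kappa < 0).
Hypotheses (lam0 : forall n, 0 <= lam n).
Hypotheses (hkp_lam : forall n, kp ^+ 2 != lam n) (hkm_lam : forall n, km ^+ 2 != lam n).

Local Notation bp n := (beta_plus kp (lam n)).
Local Notation bm n := (beta_minus km (lam n)).
Local Notation sp n := (Num.sqrt (lam n - kp ^+ 2)).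
Local Notation sm n := (Num.sqrt (lam n - km ^+ 2)).

Lemma beta_plus_parts n :
  (lam n < kp ^+ 2 /\ exists2 r, 0 < r & bp n = Complex r 0 /\ r ^+ 2 = kp ^+ 2 - lam n) \/
  (kp ^+ 2 < lam n /\ bp n = Complex 0 (sp n)).
Proof.
rewrite /beta_plus; case: ltgtP (hkp_lam n) => // h _.
  left; split => //; exists (Num.sqrt (kp ^+ 2 - lam n)); first by rewrite sqrtr_gt0 subr_gt0.
  by rewrite sqr_sqrtr// subr_ge0 ltW.
by right; split => //; apply: complex_ext => /=; ring.
Qed.

Lemma beta_minus_parts n :
  (lam n < km ^+ 2 /\ exists2 r, 0 < r & bm n = Complex r 0 /\ r ^+ 2 = km ^+ 2 - lam n) \/
  (km ^+ 2 < lam n /\ bm n = Complex 0 (- sm n)).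
Proof.
rewrite /beta_minus; case: ltgtP (hkm_lam n) => // h _.
  left; split => //; exists (Num.sqrt (km ^+ 2 - lam n)); first by rewrite sqrtr_gt0 subr_gt0.
  by rewrite sqr_sqrtr// subr_ge0 ltW.
by right; split => //; apply: complex_ext => /=; ring.
Qed.

Lemma sqr_sqrt_sub (k l : R) : k ^+ 2 < l -> Num.sqrt (l - k ^+ 2) ^+ 2 = l - k ^+ 2.
Proof. by move=> h; rewrite sqr_sqrtr// subr_ge0 ltW. Qed.

Lemma Re_muli (w : C) : complex.Re (- 'i%C * w) = complex.Im w.
Proof. by case: w => a b /=; ring. Qed.

Lemma Im_muli (w : C) : complex.Im (- 'i%C * w) = - complex.Re w.
Proof. by case: w => a b /=; ring. Qed.

Lemma sqr_muli (w : C) : (- 'i%C * w) ^+ 2 = - w ^+ 2.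
Proof. by rewrite exprMn sqrrN sqr_i mulN1r. Qed.

Lemma complex_sqr_real (r : R) : (Complex r 0) ^+ 2 = (r ^+ 2)%:C%C :> C.
Proof. by apply: complex_ext; rewrite !expr2 /=; ring. Qed.

Lemma complex_sqr_imag (r : R) : (Complex 0 r) ^+ 2 = (- r ^+ 2)%:C%C :> C.
Proof. by apply: complex_ext; rewrite !expr2 /=; ring. Qed.

(** Supplies the half-guide hypotheses with sign -1 and bound kp: an evanescent exponent is real, a
    propagating one is imaginary of modulus at most kp because lam_n >= 0. *)
Lemma exponent_plus n : let z := exponent (fun n => bp n) n in
  [/\ -1 * complex.Re z <= 0, `|complex.Im z| <= kp & z ^+ 2 = (lam n - kp ^+ 2)%:C%C].
Proof.
rewrite /exponent /= Re_muli Im_muli sqr_muli normrN.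
case: (beta_plus_parts n) => [[h [r r0 [-> r2]]]|[h ->]].
  split; rewrite /= ?mulr0//.
    rewrite gtr0_norm// -(@ler_pXn2r _ 2) ?nnegrE ?(ltW r0) ?(ltW hkp)// r2.
    by have := lam0 n; lra.
  by rewrite complex_sqr_real r2; apply: complex_ext => /=; ring.
have s2 := sqr_sqrt_sub h; split.
- by have := sqrtr_ge0 (lam n - kp ^+ 2); rewrite /=; lra.
- by rewrite normr0 ltW.
- by rewrite complex_sqr_imag ?sqrrN s2; apply: complex_ext => /=; ring.
Qed.

Lemma exponent_minus n : let z := exponent (fun n => bm n) n in
  [/\ 1 * complex.Re z <= 0, `|complex.Im z| <= km & z ^+ 2 = (lam n - km ^+ 2)%:C%C].
Proof.
rewrite /exponent /= Re_muli Im_muli sqr_muli normrN.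
case: (beta_minus_parts n) => [[h [r r0 [-> r2]]]|[h ->]].
  split; rewrite /= ?mulr0//.
    rewrite gtr0_norm// -(@ler_pXn2r _ 2) ?nnegrE ?(ltW r0) ?(ltW hkm)// r2.
    by have := lam0 n; lra.
  by rewrite complex_sqr_real r2; apply: complex_ext => /=; ring.
have s2 := sqr_sqrt_sub h; split.
- by have := sqrtr_ge0 (lam n - km ^+ 2); rewrite /=; lra.
- by rewrite normr0 ltW.
- by rewrite complex_sqr_imag ?sqrrN s2; apply: complex_ext => /=; ring.
Qed.

(* Determinant of the jump conditions written for the n-th mode, up to a factor i. *)
Definition dispersion n : C := bm n - kappa%:C%C * bp n.

Lemma evanescentP n : evanescent lam kp km n <-> km ^+ 2 < lam n /\ kp ^+ 2 < lam n.
Proof. by rewrite /evanescent /= gt_max; split => [/andP//|[-> ->]]. Qed.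

Lemma dispersion_evanescent n : evanescent lam kp km n ->
  dispersion n = Complex 0 (- (sm n + kappa * sp n)).
Proof.
move=> /evanescentP[hm hp]; rewrite /dispersion.
case: (beta_plus_parts n) => [[h _]|[_ ->]]; first by rewrite ltNge (ltW hp) in h.
case: (beta_minus_parts n) => [[h _]|[_ ->]]; first by rewrite ltNge (ltW hm) in h.
by apply: complex_ext => /=; ring.
Qed.

(** As kappa < 0, the real parts of beta_n^- and of - kappa beta_n^+ are both nonnegative, and
    positive for a propagating mode. They cannot cancel, so a zero occurs only where both modes are
    evanescent. *)
Lemma dispersion_eq0 n : dispersion n = 0 <-> exceptional lam kp km kappa n.
Proof.
split; last first.
  by move=> [ev e]; rewrite dispersion_evanescent// e oppr0.
move=> e0; suff ev : evanescent lam kp km n.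
  split => //; move: e0; rewrite dispersion_evanescent// => -[] /eqP.
  by rewrite oppr_eq0 => /eqP.
apply/evanescentP; move: e0; rewrite /dispersion.
case: (beta_plus_parts n) => [[h [r r0 [-> _]]]|[hp ->]];
  case: (beta_minus_parts n) => [[h' [r' r0' [-> _]]]|[hm ->]] // e;
  have := congr1 (@complex.Re R) e; rewrite !complex_partsE /= ?mul0r ?mulr0 ?oppr0 ?subr0 ?addr0 ?add0r => eR;
  exfalso; try (have kr : kappa * r < 0 by rewrite nmulr_rlt0); lra.
Qed.

Lemma normc_dispersion n : evanescent lam kp km n ->
  normc (dispersion n) ^+ 2 = (sm n + kappa * sp n) ^+ 2.
Proof. by move=> ev; rewrite dispersion_evanescent// normc_sqr /= expr0n add0r sqrrN. Qed.

Lemma normc_beta_minus n : normc (bm n) ^+ 2 <= (1 + km ^+ 2) * (1 + lam n).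
Proof.
have l0 := lam0 n; have k0 := sqr_ge0 km; have kl := mulr_ge0 k0 l0; rewrite normc_sqr.
case: (beta_minus_parts n) => [[h [r r0 [-> r2]]]|[h ->]] /=.
  by rewrite r2 expr0n /=; lra.
by rewrite sqrrN sqr_sqrt_sub// expr0n /=; lra.
Qed.

(** The expression on the left is the square of (s + kappa t)(s - kappa t), s and t being the two
    square roots; moreover 0 <= s - kappa t <= (1 - kappa) sqrt(lam_n). *)
Lemma dispersion_lower n : evanescent lam kp km n ->
  ((1 - kappa ^+ 2) * lam n + (kappa ^+ 2 * kp ^+ 2 - km ^+ 2)) ^+ 2 <=
  normc (dispersion n) ^+ 2 * ((1 - kappa) ^+ 2 * lam n).
Proof.
move=> ev; rewrite normc_dispersion//; have [hm hp] := (evanescentP n).1 ev.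
have s2 := sqr_sqrt_sub hm; have t2 := sqr_sqrt_sub hp.
set s := Num.sqrt _ in s2 *; set t := Num.sqrt _ in t2 *.
have s0 : 0 <= s by exact: sqrtr_ge0. have t0 : 0 <= t by exact: sqrtr_ge0.
have -> : (1 - kappa ^+ 2) * lam n + (kappa ^+ 2 * kp ^+ 2 - km ^+ 2) =
  (s + kappa * t) * (s - kappa * t).
  rewrite -[RHS]/(_) (_ : (s + kappa * t) * (s - kappa * t) = s ^+ 2 - kappa ^+ 2 * t ^+ 2); last by ring.
  by rewrite s2 t2; ring.
rewrite exprMn ler_wpM2l ?sqr_ge0//.
set q := Num.sqrt (lam n); have q2 : q ^+ 2 = lam n by rewrite sqr_sqrtr.
have q0 : 0 <= q by exact: sqrtr_ge0.
have sq : s <= q by rewrite ler_wsqrtr// lerBlDr lerDl sqr_ge0.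
have tq : t <= q by rewrite ler_wsqrtr// lerBlDr lerDl sqr_ge0.
have kt : kappa * q <= kappa * t by rewrite ler_wnM2l// ltW.
have kt0 : kappa * t <= 0 by rewrite nmulr_rle0.
have h1 : 0 <= s - kappa * t by lra.
have h2 : s - kappa * t <= (1 - kappa) * q by lra.
by rewrite -q2 -exprMn ler_pXn2r ?nnegrE//; lra.
Qed.

(** Passes from an asymptotic bound to one for all n: the ratios p/q at the finitely many indices
    below [M] are positive, and the minimum takes them in one at a time. *)
Lemma exists_lower_bound (p q : nat -> R) (c : R) M : 0 < c ->
  (forall n, 0 < p n) -> (forall n, 0 < q n) -> (forall n, (M <= n)%N -> c * q n <= p n) ->
  exists2 c', 0 < c' & forall n, c' * q n <= p n.
Proof.
move=> c0 p0 q0; elim: M c c0 => [|M IH] c c0 h; first by exists c => // n; exact: h.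
apply: (IH (Num.min c (p M / q M))); first by rewrite lt_min c0 divr_gt0.
move=> n; rewrite leq_eqVlt => /predU1P[<-|Mn].
  by rewrite -ler_pdivlMr// ge_min lexx orbT.
apply: le_trans _ (h _ Mn); apply: ler_wpM2r; first exact: ltW.
by rewrite ge_min lexx.
Qed.

Hypothesis lam_pinfty : lam @ \oo --> +oo.

Lemma lam_large (A : R) : exists M, forall n, (M <= n)%N -> A < lam n.
Proof.
have /cvgryPgt/(_ A) := lam_pinfty => -[M _ h]; by exists M.
Qed.

Lemma kappa_sqr_neq1 : kappa <> -1 -> kappa ^+ 2 != 1.
Proof.
move=> k1; rewrite sqrf_eq1 negb_or; apply/andP; split; apply/eqP => //.
by move=> h; move: hkappa; rewrite h ltr10.
Qed.

Lemma dispersion_bound_standard : kappa <> -1 ->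
  ~ (exists n, exceptional lam kp km kappa n) ->
  exists2 c, 0 < c & forall n, c * (1 + lam n) <= normc (dispersion n) ^+ 2.
Proof.
move=> k1 nexc.
have pos n : 0 < normc (dispersion n) ^+ 2.
  rewrite lt_neqAle sqr_ge0 andbT; apply/eqP => /esym /normc_eq0P /dispersion_eq0 en.
  by apply: nexc; exists n.
have q0 n : 0 < 1 + lam n by rewrite ltr_pwDl.
set a := 1 - kappa ^+ 2; set b := kappa ^+ 2 * kp ^+ 2 - km ^+ 2.
have a0 : 0 < a ^+ 2.
  by rewrite lt_neqAle sqr_ge0 andbT eq_sym sqrf_eq0 subr_eq0 eq_sym kappa_sqr_neq1.
set w := (1 - kappa) ^+ 2.
have w0 : 0 < w by rewrite exprn_gt0// subr_gt0 (lt_trans hkappa).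
(* Past these thresholds the modes are evanescent, 1 + lam <= 2 lam and b^2 <= a^2 lam^2/8. Then (a
   lam + b)^2 >= a^2 lam^2/2 - b^2 >= 3 a^2 lam^2/8, which leaves ample room for the constant
   a^2/(16 w). *)
have [M hM] := lam_large (Num.max (Num.max (km ^+ 2) (kp ^+ 2)) (Num.max 1 (8 * b ^+ 2 / a ^+ 2))).
apply: (@exists_lower_bound (fun n => normc (dispersion n) ^+ 2) (fun n => 1 + lam n) (a ^+ 2 / (16 * w)) M) => //.
  by rewrite divr_gt0// mulr_gt0.
move=> n /hM; rewrite !gt_max => /andP[/andP[hm hp] /andP[l1]].
rewrite ltr_pdivrMr// => lb.
have ev : evanescent lam kp km n by apply/evanescentP.
have := dispersion_lower ev; rewrite -/a -/b -/w; set D := normc _ ^+ 2; set l := lam n in l1 lb *.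
move=> hD.
have D0 : 0 <= D by exact: sqr_ge0.
rewrite mulrAC ler_pdivrMr; last by apply: mulr_gt0.
have h1 : a ^+ 2 * l ^+ 2 / 2 - b ^+ 2 <= (a * l + b) ^+ 2.
  have := sqr_ge0 (a * l + b * 2); rewrite !expr2; lra.
have l0 : 0 < l by lra.
have h2 : b ^+ 2 <= a ^+ 2 * l ^+ 2 / 8.
  have : a ^+ 2 * l <= a ^+ 2 * l ^+ 2.
    by rewrite ler_wpM2l ?sqr_ge0// expr2; apply: ler_peMl; exact: ltW.
  by lra.
have h3 : a ^+ 2 * l * (3 / 8) <= D * w.
  by rewrite -(ler_pM2r l0); move: h1 h2 hD; rewrite !expr2; lra.
have h4 : a ^+ 2 <= a ^+ 2 * l by apply: ler_peMr; [exact: sqr_ge0|exact: ltW].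
have h5 : 0 <= D * w by rewrite mulr_ge0// ltW.
lra.
Qed.

(** For kappa = -1 the term in lam_n drops out of [dispersion_lower] and leaves the nonzero constant
    kp^2 - km^2; a zero of the determinant would make the two square roots equal, hence kp = km. *)
Lemma dispersion_bound_critical : kappa = -1 -> kp <> km ->
  exists2 c, 0 < c & forall n, c * (1 + lam n)^-1 <= normc (dispersion n) ^+ 2.
Proof.
move=> k1 kpm.
have q0 n : 0 < 1 + lam n by rewrite ltr_pwDl.
have kpm2 : kp ^+ 2 - km ^+ 2 != 0.
  by rewrite subr_eq0 eqrXn2 ?ltW//; apply/eqP.
have D0 : 0 < (kp ^+ 2 - km ^+ 2) ^+ 2 by rewrite lt_neqAle sqr_ge0 andbT eq_sym sqrf_eq0.
have [M hM] := lam_large (Num.max (km ^+ 2) (kp ^+ 2)).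
apply: (@exists_lower_bound (fun n => normc (dispersion n) ^+ 2) (fun n => (1 + lam n)^-1) ((kp ^+ 2 - km ^+ 2) ^+ 2 / 4) M) => //.
- by rewrite divr_gt0.
- move=> n; rewrite lt_neqAle sqr_ge0 andbT; apply/eqP => /esym /normc_eq0P /dispersion_eq0.
  move=> [/evanescentP[hm hp]]; rewrite k1 mulN1r => /eqP; rewrite subr_eq0.
  rewrite eqr_sqrt ?subr_ge0 ?ltW// => /eqP /addrI /oppr_inj /eqP.
  by rewrite eqrXn2 ?ltW// => /eqP /esym.
- by move=> n; rewrite invr_gt0.
move=> n /hM; rewrite gt_max => /andP[hm hp].
have := dispersion_lower ((evanescentP n).2 (conj hm hp)); rewrite k1.
have -> : (1 - (-1) ^+ 2) * lam n + ((-1) ^+ 2 * kp ^+ 2 - km ^+ 2) = kp ^+ 2 - km ^+ 2.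
  by ring.
have -> : (1 - -1) ^+ 2 * lam n = 4 * lam n by ring.
set D := normc _ ^+ 2 => hD; have D0' : 0 <= D by exact: sqr_ge0.
by rewrite ler_pdivrMr// ; have := lam0 n; nra.
Qed.

(** The formula results from squaring. Conversely the squared equation factors, and the factor sm -
    kappa sp is positive because kappa < 0. *)
Lemma exceptionalP n : kappa <> -1 -> evanescent lam kp km n ->
  exceptional lam kp km kappa n <->
  lam n = (kappa ^+ 2 * kp ^+ 2 - km ^+ 2) / (kappa ^+ 2 - 1).
Proof.
move=> k1 ev; have [hm hp] := (evanescentP n).1 ev.
have k2 : kappa ^+ 2 - 1 != 0 by rewrite subr_eq0 kappa_sqr_neq1.
have s2 := sqr_sqrt_sub hm; have t2 := sqr_sqrt_sub hp.
have s0 : 0 < sm n by rewrite sqrtr_gt0 subr_gt0.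
have t0 : 0 < sp n by rewrite sqrtr_gt0 subr_gt0.
split.
  move=> [_ e]; apply/eqP; rewrite -[_ == _](inj_eq (mulIf k2)) mulfVK//; apply/eqP.
  have : sm n ^+ 2 = kappa ^+ 2 * sp n ^+ 2 by rewrite (_ : sm n = - (kappa * sp n)) ?sqrrN ?exprMn//; lra.
  by rewrite s2 t2; lra.
move=> /eqP; rewrite eq_sym -[_ == _](inj_eq (mulIf k2)) mulfVK// => /eqP e; split => //.
have : (sm n + kappa * sp n) * (sm n - kappa * sp n) = 0.
  rewrite (_ : _ * _ = sm n ^+ 2 - kappa ^+ 2 * sp n ^+ 2); last by ring.
  by rewrite s2 t2; lra.
move=> /eqP; rewrite mulf_eq0 => /orP[/eqP//|/eqP h].
have kt : kappa * sp n < 0 by rewrite nmulr_rlt0.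
by exfalso; lra.
Qed.

End propagation_constants.

(** * The transmission problem *)

Section weighted_sequences.
Context {R : realType}.
Local Notation C := R[i].
Local Notation normc := Normc.normc.
Variable lam : nat -> R.
Hypothesis lam0 : forall n, 0 <= lam n.

Lemma weight_ge0 t n (c : C) : 0 <= (1 + lam n) `^ t * normc c ^+ 2.
Proof. by rewrite mulr_ge0 ?powR_ge0 ?sqr_ge0. Qed.

Lemma weighted_summable_le t t1 t2 (c f g : nat -> C) (K1 K2 : R) :
  0 <= K1 -> 0 <= K2 ->
  (forall n, (1 + lam n) `^ t * normc (c n) ^+ 2 <=
     K1 * ((1 + lam n) `^ t1 * normc (f n) ^+ 2) + K2 * ((1 + lam n) `^ t2 * normc (g n) ^+ 2)) ->
  weighted_summable lam t1 f -> weighted_summable lam t2 g -> weighted_summable lam t c.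
Proof.
move=> K10 K20 h hf hg; rewrite /weighted_summable.
pose w s (a : nat -> C) n := ((1 + lam n) `^ s * normc (a n) ^+ 2)%:E.
have w0 s a n : (0 <= w s a n)%E by rewrite lee_fin weight_ge0.
apply: (@le_lt_trans _ _ (\sum_(0 <= n <oo) (K1%:E * w t1 f n + K2%:E * w t2 g n))%E).
  apply: lee_nneseries => n _; first by move=> _; rewrite lee_fin weight_ge0.
  by rewrite -!EFinM -EFinD lee_fin.
rewrite nneseriesD; [|by move=> n _; rewrite mule_ge0 ..].
by rewrite !nneseriesZl ?lte_add_pinfty ?lte_mul_pinfty// => n _.
Qed.

Lemma weighted_summable_partial2 t (c : nat -> C) : 0 <= t ->
  weighted_summable lam t c -> cvgn (partial2 c).
Proof.
move=> t0; rewrite /weighted_summable; set S := (X in (X < _)%E) => hc.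
have S0 : (0 <= S)%E by apply: nneseries_ge0 => n _ _; rewrite lee_fin weight_ge0.
have Sf : S \is a fin_num by rewrite ge0_fin_numE.
apply: (@is_cvg_partial2 _ _ (fine S)) => N; rewrite -lee_fin fineK//.
apply: le_trans (nneseries_lim_ge N _); last by move=> n _ _; rewrite lee_fin weight_ge0.
rewrite sumEFin lee_fin /partial2; apply: ler_sum => n _.
rewrite ler_peMl ?sqr_ge0// -[leLHS](@powRr0 R (1 + lam n)).
by apply: ler_powR => //; rewrite lerDl.
Qed.

End weighted_sequences.

Section one_sided_limits.
Context {R : realType}.

Lemma left_half_line : @left_half R = half_line (-1).
Proof. by apply/seteqP; split => x; rewrite /left_half /half_line /= mulN1r oppr_gt0. Qed.

Lemma right_half_line : @right_half R = half_line 1.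
Proof. by apply/seteqP; split => x; rewrite /right_half /half_line /= mul1r. Qed.

Lemma left_near : \forall x \near (0 : R)^'-, half_line (-1) x.
Proof. by rewrite -left_half_line; exact: nbhs_left_lt. Qed.

Lemma right_near : \forall x \near (0 : R)^'+, half_line 1 x.
Proof. by rewrite -right_half_line; exact: nbhs_right_gt. Qed.

Lemma left_small (d : R) : 0 < d -> \forall x \near (0 : R)^'-, `|x| < d.
Proof.
move=> d0; near=> x; rewrite ltr_norml; apply/andP; split.
  by near: x; apply: nbhs_left_gt; rewrite oppr_lt0.
by apply: (@lt_trans _ _ 0) => //; near: x; exact: nbhs_left_lt.
Unshelve. all: by end_near.
Qed.

Lemma right_small (d : R) : 0 < d -> \forall x \near (0 : R)^'+, `|x| < d.
Proof.
move=> d0; near=> x; rewrite ltr_norml; apply/andP; split.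
  by apply: (@lt_trans _ _ 0); [rewrite oppr_lt0|near: x; exact: nbhs_right_gt].
by near: x; exact: nbhs_right_lt.
Unshelve. all: by end_near.
Qed.

End one_sided_limits.

Section transmission.
Context {R : realType} {m : nat}.
Local Notation C := R[i].
Local Notation V := 'rV[R]_m.
Variables (Gam : set V) (mGam : measurable Gam) (dom : set (V -> C)).
Variables (lam : nat -> R) (psi : nat -> V -> C).
Hypotheses (hlap : selfadjoint_laplacian Gam dom) (heig : eigenbasis Gam dom lam psi).
Local Notation normc := Normc.normc.
Local Notation L2 := (L2 Gam).
Local Notation ip := (L2inner Gam).
Variables (kp km kappa : R).
Hypotheses (hkp : 0 < kp) (hkm : 0 < km).
Hypotheses (hkp_lam : forall n, kp ^+ 2 != lam n) (hkm_lam : forall n, km ^+ 2 != lam n).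

Local Notation bp n := (beta_plus kp (lam n)).
Local Notation bm n := (beta_minus km (lam n)).
Local Notation modal_plus := (modal Gam psi (-1) (fun n => bp n)).
Local Notation modal_minus := (modal Gam psi 1 (fun n => bm n)).
Local Notation solution := (transmission_solution Gam dom lam psi kp km kappa).

Let lam0 := eig_ge0 heig.
Let psiL := L2_psi hlap heig.
Let ortho := eig_orthonormal heig.
Let complete := @eig_complete _ _ _ _ _ _ heig.
Let N1sqr : (-1 : R) ^+ 2 = 1. Proof. by rewrite sqrrN expr1n. Qed.
Let P1sqr : (1 : R) ^+ 2 = 1. Proof. by rewrite expr1n. Qed.
Let zp1 n : -1 * complex.Re (exponent (fun n => bp n) n) <= 0.
Proof. by have [] := exponent_plus hkp lam0 hkp_lam n. Qed.
Let zp2 n : `|complex.Im (exponent (fun n => bp n) n)| <= kp.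
Proof. by have [] := exponent_plus hkp lam0 hkp_lam n. Qed.
Let zp3 n : exponent (fun n => bp n) n ^+ 2 = (lam n - kp ^+ 2)%:C%C.
Proof. by have [] := exponent_plus hkp lam0 hkp_lam n. Qed.
Let zm1 n : 1 * complex.Re (exponent (fun n => bm n) n) <= 0.
Proof. by have [] := exponent_minus hkm lam0 hkm_lam n. Qed.
Let zm2 n : `|complex.Im (exponent (fun n => bm n) n)| <= km.
Proof. by have [] := exponent_minus hkm lam0 hkm_lam n. Qed.
Let zm3 n : exponent (fun n => bm n) n ^+ 2 = (lam n - km ^+ 2)%:C%C.
Proof. by have [] := exponent_minus hkm lam0 hkm_lam n. Qed.

(* The normal is - e_x, so the normal derivative of c e^(- i beta x) at the
   interface is i beta c. *)
Definition jump_system (f : V -> C) (g : datum) (a b : nat -> C) : Prop :=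
  forall n, b n - a n = ip f (psi n) /\
    'i%C * (bm n * b n - kappa%:C%C * bp n * a n) = dcoef Gam psi g n.

Lemma solution_of_modal f g U a b tp tm : L2 f ->
  modal_plus U.1 a -> modal_minus U.2 b ->
  L2 tp -> (forall n, ip tp (psi n) = a n) -> L2 tm -> (forall n, ip tm (psi n) = b n) ->
  jump_system f g a b ->
  [/\ solution f g U, interface_trace Gam (0 : R)^'- U.1 tp &
    interface_trace Gam (0 : R)^'+ U.2 tm].
Proof.
move=> fL ua ub tpL tpa tmL tmb sys.
have tpi : interface_trace Gam (0 : R)^'- U.1 tp.
  by split => //; apply: (modal_trace mGam hlap heig N1sqr zp1 left_near left_small ua tpL tpa).
have tmi : interface_trace Gam (0 : R)^'+ U.2 tm.
  by split => //; apply: (modal_trace mGam hlap heig P1sqr zm1 right_near right_small ub tmL tmb).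
have [pde_p bc_p] := modal_pde mGam hlap heig N1sqr zp1 zp2 zp3 ua.
have [pde_m bc_m] := modal_pde mGam hlap heig P1sqr zm1 zm2 zm3 ub.
split => //; split; rewrite ?left_half_line ?right_half_line//.
- exists tp, tm; split => //.
  apply: (coef_eq_ae mGam psiL ortho complete) => // [|n]; first exact: L2B.
  by rewrite (L2innerB mGam tmL tpL (psiL n)) tmb tpa; have [] := sys n.
- exists (fun n => - (exponent (fun n => bp n) n * a n)), (fun n => - (exponent (fun n => bm n) n * b n)).
  split.
  + exact: (modal_normal_trace mGam hlap heig N1sqr zp1 zp2 left_near left_small ua).
  + exact: (modal_normal_trace mGam hlap heig P1sqr zm1 zm2 right_near right_small ub).
  + by move=> n; have [_ <-] := sys n; rewrite /exponent; ring.
- exact: (modal_radiating heig ua).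
- exact: (modal_radiating heig ub).
Qed.

Lemma modal_of_solution f g U : L2 f -> solution f g U ->
  exists a b tp tm, [/\ modal_plus U.1 a, modal_minus U.2 b,
    L2 tp /\ (forall n, ip tp (psi n) = a n),
    L2 tm /\ (forall n, ip tm (psi n) = b n) & jump_system f g a b].
Proof.
move=> fL [_ _ [tp [tm [tpi tmi tf]]] [cp [cm [cpi cmi cg]]] bcp bcm radp radm].
rewrite left_half_line in cpi bcp radp; rewrite right_half_line in cmi bcm radm.
have [a ua] := radiating_modal mGam hlap heig bcp radp.
have [b ub] := radiating_modal mGam hlap heig bcm radm.
have tpL := proj1 tpi; have tmL := proj1 tmi.
have tpa n : ip tp (psi n) = a n.
  exact: (trace_coef mGam hlap heig left_near left_small n ua tpi).
have tmb n : ip tm (psi n) = b n.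
  exact: (trace_coef mGam hlap heig right_near right_small n ub tmi).
exists a, b, tp, tm; split => // n; split.
  rewrite -tmb -tpa -(L2innerB mGam tmL tpL (psiL n)).
  by apply: (ae_eq_L2innerl mGam) => //; exact: L2B.
have := cg n.
rewrite (normal_trace_coef mGam hlap heig N1sqr left_near left_small n ua cpi).
rewrite (normal_trace_coef mGam hlap heig P1sqr right_near right_small n ub cmi) => <-.
by rewrite /exponent; ring.
Qed.

(** The flux equation is multiplied by - i, and b is eliminated with the first jump condition. *)
Lemma jump_system_dispersion f g a b n : jump_system f g a b ->
  dispersion kp km kappa lam n * a n =
  - 'i%C * dcoef Gam psi g n - bm n * ip f (psi n).
Proof.
move=> sys; have [<- <-] := sys n.
rewrite mulrA (_ : - 'i%C * 'i%C = 1 :> C) ?mul1r /dispersion; first by ring.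
by rewrite mulNr -expr2 sqr_i opprK.
Qed.

(** Common to both regular cases, with t the exponent of g: t = s - 1 in the standard case, t = s +
    1 in the critical one. The exponent t + 1 for f compensates beta_n^-, of order lam_n^(1/2); s <=
    t + 1 puts b = a + f in the same space as a. *)
Lemma unique_solution_of_dispersion s t f g : 0 <= s -> s <= t + 1 ->
  (exists2 c, 0 < c & forall n,
     c * (1 + lam n) `^ (s - t) <= normc (dispersion kp km kappa lam n) ^+ 2) ->
  Hpos Gam lam psi (t + 1) f -> weighted_summable lam t (dcoef Gam psi g) ->
  unique_solution Gam dom lam psi kp km kappa s f g.
Proof.
move=> s0 st [c c0 hc] [fL fw] gw.
pose D n := dispersion kp km kappa lam n.
pose fn n := ip f (psi n); pose gn n := dcoef Gam psi g n.
pose a n := (- 'i%C * gn n - bm n * fn n) / D n.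
pose b n := a n + fn n.
have W0 n : 0 < 1 + lam n by rewrite ltr_pwDl.
have D0 n : D n != 0.
  apply/eqP => e; have := hc n; rewrite -/(D n) e Normc.normc0 expr0n /=.
  by apply/negP; rewrite -ltNge mulr_gt0// powR_gt0.
have Da n : D n * a n = - 'i%C * gn n - bm n * fn n by rewrite /a mulrC divfK.
have sq2 (x y : C) : normc (x + y) ^+ 2 <= 2 * normc x ^+ 2 + 2 * normc y ^+ 2.
  apply: (@le_trans _ _ ((normc x + normc y) ^+ 2)).
    by rewrite ler_pXn2r ?nnegrE ?addr_ge0 ?normc_ge0// normc_triangle.
  have := sqr_ge0 (normc x - normc y); rewrite !expr2; lra.
have WD n p q : (1 + lam n) `^ (p + q) = (1 + lam n) `^ p * (1 + lam n) `^ q.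
  by rewrite powRD// (gt_eqF (W0 n)) implybT.
have Wsplit n : (1 + lam n) `^ (t + 1) = (1 + lam n) `^ t * (1 + lam n).
  by rewrite WD powRr1// ltW.
have ha n : (1 + lam n) `^ s * normc (a n) ^+ 2 <=
    2 * (1 + km ^+ 2) / c * ((1 + lam n) `^ (t + 1) * normc (fn n) ^+ 2) +
    2 / c * ((1 + lam n) `^ t * normc (gn n) ^+ 2).
  have Dn : normc (D n) ^+ 2 * normc (a n) ^+ 2 <=
      2 * normc (gn n) ^+ 2 + 2 * ((1 + km ^+ 2) * (1 + lam n)) * normc (fn n) ^+ 2.
    rewrite -exprMn -Normc.normcM Da; apply: le_trans (sq2 _ _) _.
    rewrite !(normc_opp, Normc.normcM) (_ : normc 'i%C = 1) ?mul1r; last first.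
      by rewrite /Normc.normc expr0n expr1n add0r sqrtr1.
    rewrite lerD2l exprMn -(mulrA 2 ((1 + km ^+ 2) * _)) ler_pM2l//.
    by apply: ler_wpM2r; [exact: sqr_ge0|exact: normc_beta_minus].
  have -> : (1 + lam n) `^ s = (1 + lam n) `^ t * (1 + lam n) `^ (s - t).
    by rewrite -WD addrCA subrr addr0.
  rewrite Wsplit; set w := (1 + lam n) `^ t; set w' := (1 + lam n) `^ (s - t) in hc *.
  have w0 : 0 <= w by exact: powR_ge0.
  have h1 : c * (w' * normc (a n) ^+ 2) <= normc (D n) ^+ 2 * normc (a n) ^+ 2.
    by rewrite mulrA ler_wpM2r ?sqr_ge0// hc.
  have h2 := ler_wpM2l w0 (le_trans h1 Dn).
  rewrite (_ : _ + _ = w * (2 * normc (gn n) ^+ 2 +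
      2 * ((1 + km ^+ 2) * (1 + lam n)) * normc (fn n) ^+ 2) / c); last first.
    by field; rewrite gt_eqF.
  by rewrite ler_pdivlMr//; apply: le_trans h2; rewrite le_eqVlt; apply/orP; left; apply/eqP; ring.
have cpos1 : 0 <= 2 * (1 + km ^+ 2) / c by rewrite divr_ge0 ?(ltW c0)// mulr_ge0// addr_ge0 ?sqr_ge0.
have cpos2 : 0 <= 2 / c by rewrite divr_ge0 ?(ltW c0).
have wa : weighted_summable lam s a by apply: weighted_summable_le ha fw gw.
have wb : weighted_summable lam s b.
  (* The constants come from |a + f|^2 <= 2 |a|^2 + 2 |f|^2 and the bound [ha] on a. *)
  apply: (@weighted_summable_le _ _ s (t + 1) t b fn gn
    (2 * (2 * (1 + km ^+ 2) / c) + 2) (2 * (2 / c)) _ _ _ fw gw).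
  - by rewrite addr_ge0// mulr_ge0.
  - by rewrite mulr_ge0.
  move=> n; move: (ha n); set K1 := 2 * (1 + km ^+ 2) / c; set K2 := 2 / c.
  set X := _ `^ (t + 1) * _; set Y := _ `^ t * _ => hX.
  apply: (@le_trans _ _ ((1 + lam n) `^ s * (2 * normc (a n) ^+ 2 + 2 * normc (fn n) ^+ 2))).
    by apply: ler_wpM2l; [exact: powR_ge0|exact: sq2].
  have hf : (1 + lam n) `^ s * normc (fn n) ^+ 2 <= X.
    by rewrite ler_wpM2r ?sqr_ge0// ler_powR// lerDl.
  rewrite (_ : (1 + lam n) `^ s * _ = 2 * ((1 + lam n) `^ s * normc (a n) ^+ 2) +
    2 * ((1 + lam n) `^ s * normc (fn n) ^+ 2)); last by ring.
  rewrite (_ : (2 * K1 + 2) * X + _ = 2 * (K1 * X + K2 * Y) + 2 * X); last by ring.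
  by apply: lerD; rewrite ler_pM2l.
have ca := weighted_summable_partial2 lam0 s0 wa.
have cb := weighted_summable_partial2 lam0 s0 wb.
have [tp tpL tpa] := riesz_fischer mGam psiL ortho ca.
have [tm tmL tmb] := riesz_fischer mGam psiL ortho cb.
have [up upa] := exists_modal mGam hlap heig N1sqr zp1 ca.
have [um umb] := exists_modal mGam hlap heig P1sqr zm1 cb.
have sys : jump_system f g a b.
  move=> n; split; first by rewrite /b addrAC subrr add0r.
  rewrite (_ : bm n * b n - _ = D n * a n + bm n * fn n); last by rewrite /b /D /dispersion; ring.
  by rewrite Da subrK mulrA mulrN -expr2 sqr_i opprK mul1r.
have [sol tpi tmi] := @solution_of_modal f g (up, um) a b tp tm fL upa umb tpL tpa tmL tmb sys.
have tma : (fun n => ip tm (psi n)) = b by apply/funext => n.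
have tpa' : (fun n => ip tp (psi n)) = a by apply/funext => n.
exists (up, um); split; first exact: sol.
  exists tp, tm; split; [exact: tpi|exact: tmi| |].
    by split; [exact: tmL|rewrite tma].
  by split; [exact: tpL|rewrite tpa'].
(* Any other solution is modal too, and the nonzero determinant determines its coefficients. *)
move=> W /(modal_of_solution fL)[a' [b' [_ [_ [Wa Wb _ _ sys']]]]].
have aa : a' = a.
  apply/funext => n; apply: (mulfI (D0 n)).
  by rewrite Da; exact: jump_system_dispersion sys'.
have bb : b' = b.
  by apply/funext => n; have [h _] := sys' n; rewrite /b -aa /fn -h addrC subrK.
rewrite aa in Wa; rewrite bb in Wb; split => x x0.
  by apply: (modal_ae_eq mGam hlap heig Wa upa); rewrite -left_half_line.
by apply: (modal_ae_eq mGam hlap heig Wb umb); rewrite -right_half_line.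
Qed.

Lemma dcoef0 n : dcoef Gam psi (of_fun (fun=> 0)) n = 0.
Proof. exact: L2inner0l. Qed.

Local Notation K := (transmission_kernel Gam dom lam psi kp km kappa).
Local Notation G := (evanescent_wave lam psi kp km).

Lemma kernel_of_modal U a t : modal_plus U.1 a -> modal_minus U.2 a ->
  L2 t -> (forall n, ip t (psi n) = a n) ->
  (forall n, dispersion kp km kappa lam n * a n = 0) -> K U.
Proof.
move=> Up Um tL ta Da; have sys : jump_system (fun=> 0) (of_fun (fun=> 0)) a a.
  move=> n; rewrite dcoef0 L2inner0l// subrr; split => //.
  by rewrite -mulrBl -/(dispersion kp km kappa lam n) Da mulr0.
by have [] := solution_of_modal (L2_0 mGam) Up Um tL ta tL ta sys.
Qed.

Lemma modal_of_kernel U : K U -> exists a t, [/\ modal_plus U.1 a, modal_minus U.2 a,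
  L2 t, (forall n, ip t (psi n) = a n) & forall n, dispersion kp km kappa lam n * a n = 0].
Proof.
move=> /(modal_of_solution (L2_0 mGam))[a [b [t [_ [Ua Ub [tL ta] _ sys]]]]].
have ab : b = a.
  by apply/funext => n; have [/eqP] := sys n; rewrite L2inner0l// subr_eq0 => /eqP.
exists a, t; split => // [|n]; first by rewrite -ab.
by rewrite (jump_system_dispersion n sys) dcoef0 L2inner0l// !mulr0 subrr.
Qed.

Lemma kernel_evanescent n : dispersion kp km kappa lam n = 0 -> K (G n).
Proof.
move=> Dn; apply: (kernel_of_modal (t := psi n) (a := fun k => (n == k)%:R)) => //.
- exact: (modal_mode mGam hlap heig).
- exact: (modal_mode mGam hlap heig).
- by move=> k; case: eqP => [<-|_]; rewrite ?Dn ?mul0r ?mulr0.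
Qed.

Lemma modal_ae_eq_coef sg (beta : nat -> C) u v a b x : half_line sg x ->
  modal Gam psi sg beta u a -> modal Gam psi sg beta v b -> ae_eq_on Gam (u x) (v x) ->
  a =1 b.
Proof.
move=> Ix ua vb uv n; have [uL ux] := ua _ Ix; have [vL vx] := vb _ Ix.
have := ae_eq_L2innerl mGam uL vL (psiL n) uv; rewrite ux vx.
by move/(mulIf (cexp_neq0 _)).
Qed.

(** Read on the single slice x = -1: modal coefficients are determined there, since [cexp] never
    vanishes. *)
Lemma lin_indep_evanescent (r : seq nat) : uniq r -> lin_indep Gam r G.
Proof.
move=> ur c [h _] k kr; have Ix : half_line (-1) (-1 : R) by rewrite /half_line /= mulrNN mulr1.
have m1 := modal_lincomb mGam hlap heig (sg := -1) (fun n => bp n) r c.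
have m0 : modal_plus (fun _ _ => 0) (fun=> 0).
  by move=> x _; split => [|n]; rewrite ?mul0r ?L2inner0l//; exact: L2_0.
have := modal_ae_eq_coef Ix m1 m0 (h _ (ltrN10 _)) k; rewrite (bigD1_seq k)//= eqxx mulr1.
by rewrite big1 ?addr0// => n /negPf ->; rewrite mulr0.
Qed.

(** Off [r] the determinant is nonzero and kills the coefficients of a kernel element, whose
    expansion is thus a finite sum. *)
Lemma is_basis_evanescent (r : seq nat) : uniq r ->
  (forall n, n \in r <-> dispersion kp km kappa lam n = 0) -> is_basis Gam K r G.
Proof.
move=> ur hr; split => //.
- by move=> n /hr; exact: kernel_evanescent.
- exact: lin_indep_evanescent.
move=> U /modal_of_kernel[a [t [Up Um tL ta Da]]]; exists a.
have e : (fun k => \sum_(n <- r) a n * (n == k)%:R) = a.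
  apply/funext => k; case: (boolP (k \in r)) => kr.
    by rewrite (bigD1_seq k)//= eqxx mulr1 big1 ?addr0// => n /negPf ->; rewrite mulr0.
  rewrite big1_seq; last first.
    move=> n /andP[_ nr]; case: eqP => [nk|_]; last by rewrite mulr0.
    by rewrite -nk nr in kr.
  have := Da k => /eqP; rewrite mulf_eq0 => /orP[/eqP /hr|/eqP->//].
  by rewrite (negPf kr).
have m1 := modal_lincomb mGam hlap heig (sg := -1) (fun n => bp n) r a.
have m2 := modal_lincomb mGam hlap heig (sg := 1) (fun n => bm n) r a.
rewrite e in m1 m2; split => x x0.
  by apply: (modal_ae_eq mGam hlap heig Up m1); rewrite -left_half_line.
by apply: (modal_ae_eq mGam hlap heig Um m2); rewrite -right_half_line.
Qed.

End transmission.

Section bases.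
Context {R : realType} {m : nat}.
Local Notation C := R[i].
Local Notation V := 'rV[R]_m.
Variable Gam : set V.

Lemma lincomb_map (r : seq nat) (h : nat -> nat) (c : nat -> C) (G : nat -> @wave R m) :
  lincomb [seq h i | i <- r] c G = lincomb r (c \o h) (G \o h).
Proof. by rewrite /lincomb; congr pair; apply/funext => x; apply/funext => y; rewrite big_map. Qed.

(** Only a relabelling of the basis by positions in [r], as [has_dim] indexes it by an initial
    segment. *)
Lemma has_dim_is_basis (K : set wave) (r : seq nat) (G : nat -> @wave R m) :
  is_basis Gam K r G -> has_dim Gam K (size r).
Proof.
move=> [ur rK ind gen]; exists (G \o nth 0%N r).
have rE : r = [seq nth 0%N r i | i <- iota 0 (size r)] by rewrite map_nth_iota0 ?take_size.
have idx (c : nat -> C) : lincomb (iota 0 (size r)) c (G \o nth 0%N r) =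
    lincomb r (c \o index^~ r) G.
  rewrite [in RHS]rE lincomb_map; congr pair; apply/funext => x; apply/funext => y;
    apply: eq_big_seq => i; rewrite mem_iota add0n => /andP[_ ir] /=;
    by rewrite -rE index_uniq.
split => [|n|c|U KU].
- exact: iota_uniq.
- by rewrite mem_iota add0n => /andP[_ nr]; apply: rK; exact: mem_nth.
- rewrite idx => /ind h n; rewrite mem_iota add0n => /andP[_ nr].
  by rewrite -(h (nth 0%N r n)) ?mem_nth//= index_uniq.
have [c hc] := gen U KU; exists (c \o nth 0%N r).
rewrite idx; move: hc; congr (wave_eq _ _ _); congr pair; apply/funext => x; apply/funext => y;
  by apply: eq_big_seq => i ir /=; rewrite nth_index.
Qed.

End bases.

(** * The super-critical kernel *)

(** The number c may change with d, but the line spanned by (e, e') is closed: c cancels in Y -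
    (X/e) e' = (Y - c e') - (X - c e)(e'/e). *)
Lemma common_ratio (R : realType) (X Y e e' : R[i]) : e != 0 ->
  (forall d : R, 0 < d -> exists c, Normc.normc (X - c * e) <= d /\
    Normc.normc (Y - c * e') <= d) -> Y = X / e * e'.
Proof.
move=> e0 h; apply: normc_small_eq => eps eps0.
set A := Normc.normc (e' / e); have A0 : 0 <= A by exact: normc_ge0.
have A1 : 0 < 1 + A by rewrite ltr_pwDl.
have d0 : 0 < eps / (1 + A) by rewrite divr_gt0.
have [c [h1 h2]] := h _ d0.
have -> : Y - X / e * e' = (Y - c * e') - (X - c * e) * (e' / e) by field.
apply: le_trans (normc_triangle _ _) _; rewrite normc_opp Normc.normcM -/A.
apply: (@le_trans _ _ (eps / (1 + A) + eps / (1 + A) * A)).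
  by apply: lerD => //; apply: ler_wpM2r.
by rewrite -[X in X + _]mulr1 -mulrDr divfK ?gt_eqF.
Qed.

Section supercritical.
Context {R : realType} {m : nat}.
Local Notation C := R[i].
Local Notation V := 'rV[R]_m.
Variables (Gam : set V) (mGam : measurable Gam) (dom : set (V -> C)).
Variables (lam : nat -> R) (psi : nat -> V -> C).
Hypotheses (hlap : selfadjoint_laplacian Gam dom) (heig : eigenbasis Gam dom lam psi).
Local Notation normc := Normc.normc.
Local Notation norm2 := (@norm2 R m Gam).
Local Notation ip := (L2inner Gam).
Variable k : R.
Hypotheses (hk : 0 < k) (hk_lam : forall n, k ^+ 2 != lam n).

Local Notation bp n := (beta_plus k (lam n)).
Local Notation bm n := (beta_minus k (lam n)).
Local Notation modal_plus := (modal Gam psi (-1) (fun n => bp n)).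
Local Notation modal_minus := (modal Gam psi 1 (fun n => bm n)).
Local Notation K := (transmission_kernel Gam dom lam psi k k (-1)).
Local Notation G := (evanescent_wave lam psi k k).
Local Notation Ev := (evanescent lam k k).

Let lam0 := eig_ge0 heig.
Let psiL := L2_psi hlap heig.
Let ortho := eig_orthonormal heig.
Let complete := @eig_complete _ _ _ _ _ _ heig.
Let N1sqr : (-1 : R) ^+ 2 = 1. Proof. by rewrite sqrrN expr1n. Qed.
Let P1sqr : (1 : R) ^+ 2 = 1. Proof. by rewrite expr1n. Qed.
Let zp1 n : -1 * complex.Re (exponent (fun n => bp n) n) <= 0.
Proof. by have [] := exponent_plus hk lam0 hk_lam n. Qed.
Let zm1 n : 1 * complex.Re (exponent (fun n => bm n) n) <= 0.
Proof. by have [] := exponent_minus hk lam0 hk_lam n. Qed.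

Lemma supercritical_dispersion n : dispersion k k (-1) lam n = 0 <-> Ev n.
Proof.
rewrite (dispersion_eq0 (ltrN10 R) hk_lam hk_lam).
by split => [[]//|ev]; split => //; rewrite mulN1r subrr.
Qed.

Lemma infinite_dim_supercritical : infinite_dim Gam K.
Proof.
move=> N; have [M hM] := lam_large (eig_pinfty heig) (k ^+ 2).
have evM i : Ev (M + i)%N by apply/evanescentP; split; apply: hM; exact: leq_addr.
exists (fun i => G (M + i)%N) => [i _|c h i iN].
  by apply: (kernel_evanescent mGam hlap heig hk hk hk_lam hk_lam); apply/supercritical_dispersion.
pose c' n := c (n - M)%N.
have e : lincomb (iota 0 N) c (fun i => G (M + i)%N) =
    lincomb [seq (M + i)%N | i <- iota 0 N] c' G.
  rewrite lincomb_map; congr (lincomb _ _ _); apply/funext => j.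
  by rewrite /c' /= addKn.
rewrite e in h.
have u : uniq [seq (M + i)%N | i <- iota 0 N] by rewrite map_inj_uniq ?iota_uniq//; exact: addnI.
have := lin_indep_evanescent mGam hlap heig u h (n := (M + i)%N).
by rewrite /c' addKn; apply; apply/mapP; exists i.
Qed.

(** The expansion of the trace is truncated where its Parseval tail is below eps; [modal_sub_le]
    carries this accuracy to every x on both sides. *)
Lemma kernel_sub_closed_span : K `<=` closed_span Gam Ev G.
Proof.
move=> U /(modal_of_kernel mGam hlap heig)[a [t [Up Um tL ta Da]]].
split => [x x0|x x0|eps eps0].
- by have [] : L2 Gam (U.1 x) /\ _ := Up x _; rewrite // -left_half_line.
- by have [] : L2 Gam (U.2 x) /\ _ := Um x _; rewrite // -right_half_line.
have /cvgrPdist_lt/(_ _ eps0) [N _ /(_ N (leqnn N))] := parseval mGam psiL ortho complete tL.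
rewrite ger0_norm ?subr_ge0 ?(bessel mGam psiL ortho complete)// => hN.
(* Keeping only evanescent indices changes nothing, as the other coefficients of a kernel element
   vanish. *)
pose r := [seq n <- iota 0 N | `[< Ev n >]].
pose p := psum psi (index_iota 0 N) (fun n => ip t (psi n)).
have pL : L2 Gam p by exact: L2_psum.
have tpL := L2B mGam tL pL.
have tp : norm2 (fun y => t y - p y) < eps.
  by rewrite (norm2C mGam tL pL) (norm2_sub_psum mGam psiL ortho) ?iota_uniq.
have a0 n : ~ Ev n -> a n = 0.
  move=> nev; apply/eqP; have /eqP := Da n; rewrite mulf_eq0 => /orP[/eqP|//].
  by move=> /supercritical_dispersion.
have tpc n : ip (fun y => t y - p y) (psi n) = a n - \sum_(j <- r) a j * (j == n)%:R.
  rewrite (L2innerB mGam tL pL (psiL n)) (coef_psum mGam psiL ortho) ta /index_iota subn0.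
  congr (_ - _); rewrite /r big_filter [RHS]big_mkcond /=; apply: eq_bigr => j _.
  by rewrite ta; case: asboolP => // /a0 ->; rewrite mul0r.
have m1 := modal_lincomb mGam hlap heig (sg := -1) (fun n => bp n) r a.
have m2 := modal_lincomb mGam hlap heig (sg := 1) (fun n => bm n) r a.
exists r, a; split => [n|x x0|x x0].
- by rewrite mem_filter => /andP[/asboolP].
- have Ix : half_line (-1) x by rewrite -left_half_line.
  have [uL _] := Up _ Ix; have [wL _] := m1 _ Ix.
  rewrite (sqnormE mGam (L2B mGam uL wL)) lee_fin; apply: le_trans (ltW tp).
  exact: (modal_sub_le mGam hlap heig N1sqr zp1 Up m1 tpL tpc Ix).
- have Ix : half_line 1 x by rewrite -right_half_line.
  have [uL _] := Um _ Ix; have [wL _] := m2 _ Ix.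
  rewrite (sqnormE mGam (L2B mGam uL wL)) lee_fin; apply: le_trans (ltW tp).
  exact: (modal_sub_le mGam hlap heig P1sqr zm1 Um m2 tpL tpc Ix).
Qed.

(** Closeness of slices controls each coefficient, [common_ratio] turns the varying approximations
    into one sequence a valid on both sides, and a single approximation suffices for
    square-summability. *)
Lemma closed_span_sub_kernel : closed_span Gam Ev G `<=` K.
Proof.
move=> U [U1L U2L hU].
pose gam (r : seq nat) (c : nat -> C) j := \sum_(n <- r) c n * (n == j)%:R.
have approx eps : 0 < eps -> exists r c, [/\ forall n, n \in r -> Ev n,
    forall x, half_line (-1) x -> [/\ L2 Gam (U.1 x),
      norm2 (fun y => U.1 x y - (lincomb r c G).1 x y) <= eps &
      L2 Gam ((lincomb r c G).1 x)] &
    forall x, half_line 1 x -> [/\ L2 Gam (U.2 x),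
      norm2 (fun y => U.2 x y - (lincomb r c G).2 x y) <= eps &
      L2 Gam ((lincomb r c G).2 x)]].
  move=> eps0; have [r [c [rev h1 h2]]] := hU _ eps0; exists r, c; split => // x Ix.
    have x0 : x < 0 by move: Ix; rewrite -left_half_line.
    have uL := U1L _ x0.
    have [wL _] := modal_lincomb mGam hlap heig (sg := -1) (fun n => bp n) r c Ix.
    by split => //; have := h1 _ x0; rewrite (sqnormE mGam (L2B mGam uL wL)) lee_fin.
  have x0 : 0 < x by move: Ix; rewrite -right_half_line.
  have uL := U2L _ x0.
  have [wL _] := modal_lincomb mGam hlap heig (sg := 1) (fun n => bm n) r c Ix.
  by split => //; have := h2 _ x0; rewrite (sqnormE mGam (L2B mGam uL wL)) lee_fin.
have lp r c := modal_lincomb mGam hlap heig (sg := -1) (fun n => bp n) r c.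
have lm r c := modal_lincomb mGam hlap heig (sg := 1) (fun n => bm n) r c.
pose ep n (x : R) := cexp (exponent (fun n => bp n) n * x%:C%C).
pose em n (x : R) := cexp (exponent (fun n => bm n) n * x%:C%C).
have coefs d : 0 < d -> exists g, [/\ forall n, ~ Ev n -> g n = 0,
    forall x n, half_line (-1) x -> normc (ip (U.1 x) (psi n) - g n * ep n x) <= d &
    forall x n, half_line 1 x -> normc (ip (U.2 x) (psi n) - g n * em n x) <= d].
  (* [closed_span] measures squared norms, hence the accuracy d^2. *)
  move=> d0; have d2 : 0 < d ^+ 2 by rewrite exprn_gt0.
  have [r [c [rev h1 h2]]] := approx _ d2; exists (gam r c); split.
  - move=> n nev; rewrite /gam big1_seq// => j /andP[_ /rev jev].
    by case: eqP => [jn|_]; [rewrite jn in jev|rewrite mulr0].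
  - move=> x n Ix; have [uL le wL] := h1 _ Ix; have [_ wx] := lp r c _ Ix.
    rewrite /ep -wx -(L2innerB mGam uL wL (psiL n)); apply: normc_le; first exact: ltW.
    by apply: le_trans le; apply: (coef_le mGam psiL ortho); exact: L2B.
  - move=> x n Ix; have [uL le wL] := h2 _ Ix; have [_ wx] := lm r c _ Ix.
    rewrite /em -wx -(L2innerB mGam uL wL (psiL n)); apply: normc_le; first exact: ltW.
    by apply: le_trans le; apply: (coef_le mGam psiL ortho); exact: L2B.
have I1 : half_line (-1) (-1 : R) by rewrite /half_line /= mulrNN mulr1.
(* The slice x = -1 serves as reference for all slices, including those of the right half-guide. *)
pose a n := ip (U.1 (-1)) (psi n) / ep n (-1).
have Up : modal_plus U.1 a.
  move=> x Ix; split => [|n]; first by apply: U1L; rewrite -left_half_line in Ix.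
  apply: common_ratio => [|d d0]; first exact: cexp_neq0.
  by have [g [_ h1 _]] := coefs d d0; exists (g n); split; exact: h1.
have Um : modal_minus U.2 a.
  move=> x Ix; split => [|n]; first by apply: U2L; rewrite -right_half_line in Ix.
  apply: common_ratio => [|d d0]; first exact: cexp_neq0.
  by have [g [_ h1 h2]] := coefs d d0; exists (g n); split; [exact: h1|exact: h2].
have a0 n : ~ Ev n -> a n = 0.
  move=> nev; rewrite /a (_ : ip _ _ = 0) ?mul0r//; apply: normc_small_eq => d d0.
  have [g [g0 h1 _]] := coefs d d0; have := h1 _ n I1.
  by rewrite g0// mul0r.
(* Accuracy 1 is enough: a then differs from a finitely supported sequence by a square-summable
   one. *)
have [r [c [_ h1 _]]] := approx 1 ltr01.
have da : forall N, partial2 (fun n => a n - gam r c n) N <= 2 * 1.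
  apply: (modal_sub_partial2 mGam hlap heig N1sqr zp1 Up (lp r c)) => x Ix.
  by have [] := h1 _ Ix.
have qL : L2 Gam (psum psi r c) by exact: L2_psum.
have [t tL ta] : exists2 t, L2 Gam t & forall n, ip t (psi n) = a n.
  apply: (riesz_fischer mGam psiL ortho).
  apply: (@is_cvg_partial2 _ _ (2 * (2 * 1) + 2 * norm2 (psum psi r c))) => N.
  apply: (@le_trans _ _ (2 * partial2 (fun n => a n - gam r c n) N + 2 * partial2 (gam r c) N)).
    rewrite /partial2 !mulr_sumr -big_split /=; apply: ler_sum => n _.
    rewrite -{1}(subrK (gam r c n) (a n)).
    apply: (@le_trans _ _ ((normc (a n - gam r c n) + normc (gam r c n)) ^+ 2)).
      by rewrite ler_pXn2r ?nnegrE ?addr_ge0 ?normc_ge0// normc_triangle.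
    have := sqr_ge0 (normc (a n - gam r c n) - normc (gam r c n)); rewrite !expr2; lra.
  apply: lerD; rewrite ler_pM2l//.
  have := bessel mGam psiL ortho complete N qL.
  by under eq_fun do rewrite (coef_psum mGam psiL ortho).
apply: (kernel_of_modal mGam hlap heig hk hk hk_lam hk_lam Up Um tL ta) => n.
have [/supercritical_dispersion ->|/a0 ->] := pselect (Ev n); first by rewrite mul0r.
by rewrite mulr0.
Qed.

End supercritical.

(** Functions and functionals enter the flux condition only through [dcoef], so the sign of the
    exponent plays no further part. *)
Lemma Hscale_weighted (R : realType) (m : nat) (Gam : set 'rV[R]_m) (lam : nat -> R)
  (psi : nat -> 'rV[R]_m -> R[i]) (t : R) (g : datum) :
  Hscale Gam lam psi t g -> weighted_summable lam t (dcoef Gam psi g).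
Proof. by case: g => [u [_ []]|phi []]. Qed.

Theorem theorem2 (R : realType) (d : nat) (hd : (2 <= d)%N)
  (Gam : set 'rV[R]_d.-1)
  (Gam_nonempty : Gam !=set0) (Gam_bounded : bounded_set Gam)
  (Gam_connected : connected Gam) (Gam_open : open Gam)
  (Gam_lipschitz : lipschitz_boundary Gam)
  (dom : set ('rV[R]_d.-1 -> R[i])) (lam : nat -> R)
  (psi : nat -> 'rV[R]_d.-1 -> R[i])
  (hlap : selfadjoint_laplacian Gam dom) (heig : eigenbasis Gam dom lam psi)
  (s kp km kappa : R) (hs : 0 < s) (hkp : 0 < kp) (hkm : 0 < km)
  (hkappa : kappa < 0)
  (hkp_lam : forall n, kp ^+ 2 != lam n) (hkm_lam : forall n, km ^+ 2 != lam n) :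
  let K := transmission_kernel Gam dom lam psi kp km kappa in
  let G := evanescent_wave lam psi kp km in
  let Ev := evanescent lam kp km in
  let Exc := exceptional lam kp km kappa in
  [/\ (* standard case *)
      kappa <> -1 ->
      [/\ (~ (exists n, Exc n)) ->
          forall f g, Hpos Gam lam psi s f -> Hscale Gam lam psi (s - 1) g ->
            unique_solution Gam dom lam psi kp km kappa s f g,
          forall n, Ev n ->
            (Exc n <->
             lam n = (kappa ^+ 2 * kp ^+ 2 - km ^+ 2) / (kappa ^+ 2 - 1)) &
          forall n, Exc n ->
          [/\ exists mult : seq nat,
                [/\ uniq mult, forall k, k \in mult <-> lam k = lam n,
                    has_dim Gam K (size mult) & is_basis Gam K mult G] &
              forall x y, 0 < x ->
                (G n).2 x y =
                  psi n y * cexp (- 'i%C * beta_minus km (lam n) * `|x|%:C%C) /\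
                (G n).2 x y =
                  psi n y * cexp (- 'i%C * kappa%:C%C * beta_plus kp (lam n)
                                  * `|x|%:C%C)]],
      (* critical case *)
      kappa = -1 -> kp <> km ->
      forall f g, Hpos Gam lam psi (s + 2) f -> Hscale Gam lam psi (s + 1) g ->
        unique_solution Gam dom lam psi kp km kappa s f g &
      (* super-critical case *)
      kappa = -1 -> kp = km ->
      [/\ infinite_dim Gam K, K = closed_span Gam Ev G &
          forall n, Ev n ->
          [/\ K (G n),
              forall x y, x < 0 ->
                (G n).1 x y =
                  psi n y * cexp (- 'i%C * beta_minus km (lam n) * `|x|%:C%C) /\
                (G n).1 x y =
                  psi n y * cexp (- 'i%C * kappa%:C%C * beta_plus kp (lam n)
                                  * `|x|%:C%C) &
              forall x y, 0 < x ->
                (G n).2 x y =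
                  psi n y * cexp (- 'i%C * beta_minus km (lam n) * `|x|%:C%C) /\
                (G n).2 x y =
                  psi n y * cexp (- 'i%C * kappa%:C%C * beta_plus kp (lam n)
                                  * `|x|%:C%C)]]].
Proof.
move=> K G Ev Exc.
have mGam : measurable Gam by exact: open_measurable_rV.
have lam0 := eig_ge0 heig; have lamoo := eig_pinfty heig.
have dispE n : dispersion kp km kappa lam n = 0 <-> Exc n.
  exact: dispersion_eq0.
have minus_plus n : Exc n -> beta_minus km (lam n) = kappa%:C%C * beta_plus kp (lam n).
  by move=> /dispE /eqP; rewrite subr_eq0 => /eqP.
have right_mode n x y : 0 < x -> Exc n ->
    (G n).2 x y = psi n y * cexp (- 'i%C * beta_minus km (lam n) * `|x|%:C%C) /\
    (G n).2 x y = psi n y * cexp (- 'i%C * kappa%:C%C * beta_plus kp (lam n) * `|x|%:C%C).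
  by move=> x0 en; rewrite gtr0_norm// -(mulrA (- 'i%C) kappa%:C%C) -(minus_plus n en).
split.
- move=> k1; split.
  + move=> nexc f g Hf Hg.
    have [c c0 hc] := dispersion_bound_standard hkappa lam0 hkp_lam hkm_lam lamoo k1 nexc.
    apply: (unique_solution_of_dispersion (t := s - 1) mGam hlap heig hkp hkm hkp_lam hkm_lam).
    * exact: ltW.
    * by rewrite subrK.
    * exists c => // n; rewrite (_ : s - (s - 1) = 1); last by ring.
      by rewrite powRr1// addr_ge0.
    * by rewrite subrK.
    * exact: Hscale_weighted.
  + by move=> n ev; exact: exceptionalP.
  + move=> n en; split; last by move=> x y x0; exact: right_mode.
    have [M hM] := lam_large lamoo (lam n).
    (* The eigenvalues tend to infinity, so every index carrying the value lam_n lies below M. *)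
    pose mult := [seq j <- iota 0 M | lam j == lam n].
    have umult : uniq mult by rewrite filter_uniq ?iota_uniq.
    have multE j : j \in mult <-> lam j = lam n.
      rewrite mem_filter mem_iota add0n /=; split => [/andP[/eqP]//|e].
      by rewrite e eqxx /= ltnNge; apply/negP => /hM; rewrite e ltxx.
    (* The closed formula gives all exceptional indices the same eigenvalue, so the zeros of the
       determinant are exactly the indices of that eigenvalue. *)
    have multD j : j \in mult <-> dispersion kp km kappa lam j = 0.
      rewrite multE dispE; split => [e|ej].
        by move: en; rewrite /Exc /exceptional /evanescent /= e.
      have := proj1 (exceptionalP hkappa k1 (proj1 en)) en.
      by have := proj1 (exceptionalP hkappa k1 (proj1 ej)) ej => -> ->.
    have B := is_basis_evanescent mGam hlap heig hkp hkm hkp_lam hkm_lam umult multD.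
    by exists mult; split => //; exact: has_dim_is_basis B.
- move=> k1 kpm f g Hf Hg.
  have [c c0 hc] := dispersion_bound_critical hkp hkm hkappa lam0 hkp_lam hkm_lam lamoo k1 kpm.
  apply: (unique_solution_of_dispersion (t := s + 1) mGam hlap heig hkp hkm hkp_lam hkm_lam).
  + exact: ltW.
  + by rewrite -addrA lerDl.
  + exists c => // n; rewrite (_ : s - (s + 1) = -1); last by ring.
    by rewrite powR_inv1// addr_ge0.
  + by rewrite -addrA.
  + exact: Hscale_weighted.
- move=> k1 kpm; subst kappa; subst km.
  split.
  + exact: (infinite_dim_supercritical mGam hlap heig).
  + apply/seteqP; split.
      exact: (kernel_sub_closed_span mGam hlap heig).
    exact: (closed_span_sub_kernel mGam hlap heig).
  (* Equal wavenumbers and kappa = -1 make the two square roots cancel: every evanescent index is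
     exceptional. *)
  + move=> n ev; have en : Exc n by split => //; rewrite mulN1r subrr.
    split.
    * by apply: (kernel_evanescent mGam hlap heig) => //; apply/dispE.
    (* On the left |x| = - x, and beta_n^- = - beta_n^+ restores the sign in the exponent. *)
    * move=> x y x0; rewrite ltr0_norm//= /guide_mode (minus_plus n en).
      split; congr (_ * cexp _); apply: complex_ext; rewrite !complex_partsE /=; ring.
    * by move=> x y x0; exact: right_mode.
Qed.
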